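(* Consider $n$ elements distributed over $p$ processing elements (PEs) such that each PE holds $O(n/p)$ elements (the placement being otherwise arbitrary, and the elements not being sorted). Then the $k$ globally smallest of these elements can be identified in expected time $$O\!\left(\frac{n}{p}+\beta\min\left(\sqrt{p}\,\log_p n,\ \frac{n}{p}\right)+\alpha\log n\right).$$
   Context: Machine model: $p$ PEs, numbered $1,\dots,p$, are connected by a network. Each PE can send and receive at most one message at a time (full-duplex, single-ported communication), and sending a message of $m$ machine words takes time $\alpha+m\beta$. The startup cost $\alpha$ and per-word cost $\beta$ are treated as variables in asymptotic bounds, so that in a bound $O(x+\beta y+\alpha z)$, $x$ is internal work, $y$ communication volume and $z$ latency. Each element is a single machine word, and elements are totally ordered with no ties (ties can be broken by object identity). Expectation is over the random choices of the (randomized) algorithm. ''Identified'' means that each PE knows which of its local elements are among the $k$ globally smallest.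
   Formalization: The constant in O(.) is uniform over α, β with β = O(α) and 1 = O(α) (unit: one instruction); for wholly free α, β the bound fails, e.g. n = p, k = 1, α = 1/log p, β large, where identifying the minimum needs a growing number of word messages in sequence. *)

(* Defs.v *)
From mathcomp Require Import all_boot all_order all_algebra.
From mathcomp Require Import all_classical all_reals all_analysis.

Set Implicit Arguments.
Unset Strict Implicit.
Unset Printing Implicit Defensive.

Import Order.TTheory GRing.Theory Num.Theory numFieldNormedType.Exports.

Local Open Scope ring_scope.

(* A distributed-memory machine: p word-RAMs executing one common program and
   exchanging point-to-point messages.  Elements of the ordered type T are
   opaque one-word items: a program can only copy, send and compare them.
   Integers are bounded by the word capacity M, so that a word cannot be used
   to pack an unbounded amount of information. *)

(** * Programs *)

Inductive binop := Add | Sub | Mul | Div | Leq.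

(* The memory of a PE consists of arrays.  Array names are literals of the
   program, hence finite in number; indices are computed. *)
Inductive expr :=
  | Lit of nat
  | Read (array : nat) (index : expr)
  | Op of binop & expr & expr.

(* Comm (Some (dst, a, off, len)) (Some (src, b, off')) sends the len words of
   array a starting at off to PE dst and, simultaneously, receives a message
   from PE src, storing it in array b from off' on.  Either half may be absent.
   Draw a i e stores in a[i] a uniformly random integer of [0, e[. *)
Inductive instr :=
  | Write (array : nat) (index value : expr)
  | Draw (array : nat) (index bound : expr)
  | Comm (send : option (expr * nat * expr * expr))
         (recv : option (expr * nat * expr))
  | If of expr & seq instr & seq instr
  | While of expr & seq instr.

Definition program := seq instr.

Fixpoint expr_size (e : expr) : nat :=
  match e with
  | Lit _ => 1
  | Read _ i => (expr_size i).+1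
  | Op _ e1 e2 => (expr_size e1 + expr_size e2).+1
  end%N.

(* Internal work of one execution of the instruction; for If and While, of one
   evaluation of the guard. *)
Definition work (c : instr) : nat :=
  match c with
  | Write _ i e | Draw _ i e => (expr_size i + expr_size e).+1
  | Comm o q =>
      (if o is Some (dst, _, off, len)
       then expr_size dst + expr_size off + expr_size len else 0)
      + (if q is Some (src, _, off) then expr_size src + expr_size off else 0)
      + 1
  | If e _ _ | While e _ => (expr_size e).+1
  end%N.

(** * Local semantics *)

Inductive word (T : Type) := Int of nat | Elt of T.
Arguments Int {T} _.

Definition store (T : Type) := nat -> nat -> word T.

Section Local.
Variables (d : Order.disp_t) (T : orderType d) (M : nat).

Definition int_of (w : word T) : nat := if w is Int x then x else 0%N.

Definition leq_word (v w : word T) : bool :=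
  match v, w with
  | Int x, Int y => (x <= y)%N
  | Elt x, Elt y => (x <= y)%O
  | _, _ => false
  end.

Definition arith (o : binop) (v w : word T) : nat :=
  match o with
  | Add => int_of v + int_of w
  | Sub => int_of v - int_of w
  | Mul => int_of v * int_of w
  | Div => int_of v %/ int_of w
  | Leq => leq_word v w
  end%N.

Fixpoint eval (s : store T) (e : expr) : word T :=
  match e with
  | Lit x => Int (x %% M)
  | Read a i => s a (int_of (eval s i))
  | Op o e1 e2 => Int (arith o (eval s e1) (eval s e2) %% M)
  end%N.

Definition evaln (s : store T) (e : expr) : nat := int_of (eval s e).

Definition write_block (s : store T) (a off : nat) (ws : seq (word T)) :
    store T :=
  fun b x => if (b == a) && (off <= x < off + size ws)%N
             then nth (Int 0) ws (x - off) else s b x.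

Definition read_block (s : store T) (a off len : nat) : seq (word T) :=
  [seq s a x | x <- iota off len].

End Local.

(** * Distributed semantics *)

(* clock is the local time of the PE.  While the PE is executing a Comm, sent is
   the completion time of its send half and got the message and completion
   time of its receive half, once these have taken place. *)
Record pe (R T : Type) := Pe {
  code : program;
  memory : store T;
  clock : R;
  sent : option R;
  got : option (seq (word T) * R) }.

Definition config (R T : Type) (p : nat) := 'I_p -> pe R T.

Section Machine.
Variables (R : realType) (d : Order.disp_t) (T : orderType d).
Variables (p M : nat) (alpha beta : R).

Definition pending_send (s : pe R T) : option ('I_p * seq (word T)) :=
  match code s, sent s with
  | Comm (Some (dst, a, off, len)) _ :: _, None =>
      let m := memory s in
      omap (fun j => (j, read_block m a (evaln M m off) (evaln M m len)))
           (insub (evaln M m dst))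
  | _, _ => None
  end.

Definition pending_recv (s : pe R T) : option 'I_p :=
  match code s, got s with
  | Comm _ (Some (src, _, _)) :: _, None => insub (evaln M (memory s) src)
  | _, _ => None
  end.

(* A message is transferred when its sender and its receiver are both ready; it
   occupies the send port of the one and the receive port of the other for
   alpha + m * beta, m being its length. *)
Definition transfer_end (c : config R T p) (i j : 'I_p) (ws : seq (word T)) : R :=
  Num.max (clock (c i)) (clock (c j)) + (alpha + (size ws)%:R * beta).

Definition send_half (c : config R T p) (i : 'I_p) : option R :=
  if sent (c i) is Some t then Some t else
  if pending_send (c i) is Some (j, ws) then
    if pending_recv (c j) == Some i then Some (transfer_end c i j ws) else None
  else None.

Definition recv_half (c : config R T p) (i : 'I_p) :
    option (seq (word T) * R) :=
  if got (c i) is Some g then Some g else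
  if pending_recv (c i) is Some j then
    if pending_send (c j) is Some (i', ws) then
      if i' == i then Some (ws, transfer_end c j i ws) else None
    else None
  else None.

(* One instruction of PE i.  rnd is the random number available to it, uniform
   on [0, M`![, so that rnd %% b is exactly uniform on [0, b[ for 0 < b <= M. *)
Definition step_pe (c : config R T p) (i : 'I_p) (rnd : nat) : pe R T :=
  let s := c i in
  let m := memory s in
  match code s with
  | [::] => s
  | ins :: k =>
    let t := clock s + (work ins)%:R in
    match ins with
    | Write a x e =>
        Pe k (write_block m a (evaln M m x) [:: eval M m e]) t None None
    | Draw a x e =>
        let v := (rnd %% maxn 1 (evaln M m e))%N in
        Pe k (write_block m a (evaln M m x) [:: Int v]) t None None
    | If e k1 k2 =>
        Pe ((if evaln M m e != 0%N then k1 else k2) ++ k) m t None None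
    | While e body =>
        Pe (if evaln M m e != 0%N then body ++ ins :: k else k) m t None None
    | Comm o q =>
        let so := send_half c i in
        let ro := recv_half c i in
        if (o ==> so) && (q ==> ro) then
          let t1 := Num.max (odflt (clock s) so)
                            (odflt (clock s) (omap snd ro)) in
          let m1 := if (q, ro) is (Some (_, b, off), Some (ws, _))
                    then write_block m b (evaln M m off) ws else m in
          Pe k m1 (t1 + (work ins)%:R) None None
        else Pe (ins :: k) m (clock s) so ro
    end
  end.

(* All PEs that are not blocked advance by one instruction.  Since partners are
   named explicitly and transfers are timed by the clocks of both partners, the
   computed values and clocks do not depend on this interleaving. *)
Definition step (c : config R T p) (rnd : {ffun 'I_p -> 'I_(M`!)}) :
    config R T p :=
  fun i => step_pe c i (rnd i).

Definition halted (c : config R T p) : bool :=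
  [forall i, nilp (code (c i))].

Definition makespan (c : config R T p) : R :=
  \big[Num.max/0]_(i < p) clock (c i).

Definition run (c0 : config R T p) (w : seq {ffun 'I_p -> 'I_(M`!)}) :
    config R T p :=
  foldl step c0 w.

(* Expectation of f after s steps: all random numbers of all PEs are mutually
   independent. *)
Definition expect (c0 : config R T p) (s : nat) (f : config R T p -> R) : R :=
  (\sum_(w : s.-tuple {ffun 'I_p -> 'I_(M`!)}) f (run c0 w))
  / #|{: s.-tuple {ffun 'I_p -> 'I_(M`!)}}|%:R.

Definition halts_almost_surely (c0 : config R T p) : Prop :=
  ((fun s => expect c0 s (fun c => (halted c)%:R)) @ \oo --> (1 : R))%classic.

(* Along a run the makespan is nondecreasing and becomes the running time once
   all PEs have halted; hence, by monotone convergence, this supremum is the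
   expected running time of an almost surely halting program. *)
Definition expected_time (c0 : config R T p) : \bar R :=
  ereal_sup (range (fun s => (expect c0 s makespan)%:E)).

(** * The selection problem *)

Definition elements (inp : 'I_p -> seq T) : seq T := flatten (codom inp).

(* Array 0 holds the rank of the PE, p, n, k and the number of local elements;
   array 1 holds the local elements. *)
Definition initial (P : program) (inp : 'I_p -> seq T) (k : nat) :
    config R T p :=
  fun i =>
    let params := [:: nat_of_ord i; p; size (elements inp); k; size (inp i)] in
    Pe P
       (fun a x => match a with
                   | 0 => nth (Int 0) (map Int params) x
                   | 1 => nth (Int 0) (map (@Elt T) (inp i)) x
                   | _ => Int 0
                   end)
       0 None None.

Definition among_smallest (k : nat) (all : seq T) (x : T) : bool :=
  (count (fun y => (y < x)%O) all < k)%N.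

(* Array 2 flags the local elements that are among the k globally smallest. *)
Definition identified (inp : 'I_p -> seq T) (k : nat) (c : config R T p) :
    Prop :=
  forall (i : 'I_p) (j : nat) (x : T), onth (inp i) j = Some x ->
    memory (c i) 2 j = Int (among_smallest k (elements inp) x).

Definition identifies (P : program) (inp : 'I_p -> seq T) (k : nat) : Prop :=
  halts_almost_surely (initial P inp k) /\
  forall w : seq {ffun 'I_p -> 'I_(M`!)},
    halted (run (initial P inp k) w) ->
    identified inp k (run (initial P inp k) w).

End Machine.

(* Main.v *)
(* Sampling and quickselect.  All PEs execute the same instructions in lockstep.  A
   round keeps the N elements that may still be the k-th smallest one, xs: each of
   them is sampled with probability about U^2 / (2 N), where U is of order p^(1/4).
   The sample has S = O(sqrt p) elements, so that p PEs can compare all pairs; after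
   the samples have been routed to distinct PEs, prefix sums and broadcasts yield
   all ranks in O(log p) startups.  The two sampled elements whose ranks are O(U)
   below and above the expected rank of xs serve as pivots.  By Chebyshev's
   inequality they enclose xs with constant probability, and then only O(N / U)
   elements remain; hence there are O(log_p n) rounds.  (If p is bounded, U is 1 and
   a single sampled element in the middle half does.)

   The expected time is bounded by a Hoare logic with time credits, in which a random
   instruction redistributes the credit among its outcomes, preserving the mean.  A
   potential that exceeds the cost of a round plus the mean of the next potential
   pays for the main loop. *)

Require Import Defs.
From mathcomp Require Import all_boot all_order all_algebra.
From mathcomp Require Import all_classical all_reals all_analysis.
From mathcomp Require Import zify ring lra.

Set Implicit Arguments.
Unset Strict Implicit.
Unset Printing Implicit Defensive.

Import Defs Order.TTheory GRing.Theory Num.Theory.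

Local Open Scope ring_scope.

(** * Averages *)

(** The elements are never redistributed, so a round on [N] elements costs up to [min(N, m0)] work
    per PE, where [m0] is the length of the longest list, and not [N / p]. This is affordable: as
    [n <= p * m0] and [ln p <= 80 * ln (growth U)], boundedly many successful rounds lead from [n]
    below [m0], and from there on the work decays geometrically. Hence the two parts of [work_left].

    The term in [beta] stems from moving the sample; all other messages have constant length. A
    block of sampled elements is bounded both by [sqrt p], the size of a sample that can be ranked,
    and by the length of a list, so the same program serves both sides of the minimum.

    Randomness affects the time only. The program does not know [xs], but it knows how many
    remaining elements lie below it, and this tells on which side of a pivot [xs] lies. A sample
    that is too large, or lacks the wanted ranks, at worst makes a round fruitless.

    Lockstep makes every loop run for the longest list, with arithmetic masks in place of branches.
    For [n = 1] the bound contains no startups, so that case has to do without any message. *)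

Section Average.
Variable R : realType.

Definition avg (V : finType) (f : V -> R) : R := (\sum_v f v) / #|V|%:R.

Lemma avg_le (V : finType) (f g : V -> R) :
  (forall v, f v <= g v) -> avg f <= avg g.
Proof.
by move=> le_fg; rewrite ler_wpM2r ?invr_ge0 ?ler0n // ler_sum.
Qed.

Lemma avg_ge0 (V : finType) (f : V -> R) : (forall v, 0 <= f v) -> 0 <= avg f.
Proof. by move=> f0; rewrite divr_ge0 ?ler0n ?sumr_ge0. Qed.

Lemma eq_avg (V : finType) (f g : V -> R) : f =1 g -> avg f = avg g.
Proof. by move=> fg; congr (_ / _); apply: eq_bigr => v _. Qed.

Lemma avg_cst (V : finType) (x : R) : (0 < #|V|)%N -> avg (fun _ : V => x) = x.
Proof.
move=> V0; rewrite /avg sumr_const -[x *+ _]mulr_natr mulfK //.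
by rewrite pnatr_eq0 -lt0n.
Qed.

Lemma avgD (V : finType) (f g : V -> R) :
  avg (fun v => f v + g v) = avg f + avg g.
Proof. by rewrite /avg big_split mulrDl. Qed.

Lemma avgZ (V : finType) (a : R) (f : V -> R) :
  avg (fun v => a * f v) = a * avg f.
Proof. by rewrite /avg -mulr_sumr mulrA. Qed.

Lemma avg_sum (V I : finType) (P : pred I) (f : I -> V -> R) :
  avg (fun v => \sum_(i | P i) f i v) = \sum_(i | P i) avg (f i).
Proof. by rewrite /avg exchange_big /= mulr_suml. Qed.

Lemma avg_tuple0 (V : finType) (f : 0.-tuple V -> R) : avg f = f [tuple].
Proof.
rewrite /avg card_tuple expn0 divr1 (big_pred1 [tuple]) //= => w.
by symmetry; apply/eqP; rewrite (tuple0 w).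
Qed.

(** Peels off the first random row, so that averages over runs follow the recursion of [bounded]
    step by step. *)
Lemma avg_tupleS (V : finType) s (f : s.+1.-tuple V -> R) :
  avg f = avg (fun v => avg (fun w : s.-tuple V => f [tuple of v :: w])).
Proof.
rewrite /avg -mulr_suml pair_bigA /= -mulrA; congr (_ * _); last first.
  by rewrite !card_tuple expnS natrM invfM mulrC.
rewrite (reindex (fun vw : V * s.-tuple V => [tuple of vw.1 :: vw.2])) //=.
exists (fun w => (thead w, [tuple of behead w])) => [[v w] _|w _] /=.
  by congr pair; apply: val_inj.
by rewrite [RHS](tuple_eta w); apply: val_inj.
Qed.

End Average.

(** * A Hoare logic with time credits *)

Section Logic.
Variables (R : realType) (d : Order.disp_t) (T : orderType d).
Variables (p M : nat) (alpha beta : R).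
Hypotheses (p0 : (0 < p)%N) (al0 : 0 <= alpha) (be0 : 0 <= beta).

Notation cfg := (config R T p).
Notation rnd := {ffun 'I_p -> 'I_(M`!)}.
Definition mem := 'I_p -> store T.

Variable final : mem -> Prop.

Notation step := (@Defs.step R d T p M alpha beta).
Notation step_pe := (@Defs.step_pe R d T p M alpha beta).

Lemma card_rnd : (0 < #|{: rnd}|)%N.
Proof. by rewrite card_ffun !card_ord expn_gt0 fact_gt0. Qed.

Definition memories (c : cfg) : mem := fun i => memory (c i).

(* [bounded s j c b]: the expected makespan [s] steps after [c] is at most [b],
   and every halting run from [c] of at most [s] steps ends in a final state.
   As [j] steps have led to [c], each of which takes at least unit time, the
   makespan dominates [j] as long as the machine has not halted. *)
Fixpoint bounded (s j : nat) (c : cfg) (b : R) : Prop :=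
  [/\ halted c -> final (memories c),
      ~~ halted c -> j%:R <= makespan c
    & if s is s'.+1 then
        exists2 g : rnd -> R,
          forall w, bounded s' j.+1 (step c w) (g w) & avg g <= b
      else makespan c <= b].

Lemma step_halted c w : halted c -> step c w = c.
Proof.
move=> /forallP hc; apply: funext => i.
by rewrite /Defs.step /Defs.step_pe (nilP (hc i)).
Qed.

Lemma bounded_halted s j c b :
  halted c -> final (memories c) -> makespan c <= b -> bounded s j c b.
Proof.
elim: s j b => [|s IH] j b hc fc cb; split=> //; rewrite ?hc //.
exists (fun=> b) => [w|]; last by rewrite avg_cst ?card_rnd.
by rewrite step_halted //; apply: IH.
Qed.

(** * Expected time and almost sure halting from step-indexed bounds *)

Lemma bounded_final s j c b (w : seq rnd) : (size w <= s)%N ->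
  bounded s j c b -> halted (run alpha beta c w) ->
  final (memories (run alpha beta c w)).
Proof.
elim: w s j c b => [|r w IH] s j c b /=; first by case: s => [|s] _ [].
by case: s => // s sw [_ _ [g gw _]]; apply: IH sw (gw r).
Qed.

Lemma expectE (c : cfg) s f :
  expect M alpha beta c s f =
  avg (fun w : s.-tuple rnd => f (run alpha beta c w)).
Proof. by []. Qed.

Lemma bounded_expect s j c b :
  bounded s j c b -> expect M alpha beta c s (@makespan R d T p) <= b.
Proof.
elim: s j c b => [|s IH] j c b.
  by case=> _ _; rewrite expectE avg_tuple0.
case=> _ _ [g gw gb]; rewrite expectE avg_tupleS; apply: le_trans gb.
by apply: avg_le => r; apply: IH (gw r).
Qed.

Lemma makespan_ge0 (c : cfg) : 0 <= makespan c.
Proof.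
by rewrite /makespan; elim/big_rec: _ => // i x _ x0; rewrite le_max x0 orbT.
Qed.

(** Markov's inequality in disguise: a run that has not halted has by then a makespan of at least
    [s + j], whose mean is at most [b]. *)
Lemma bounded_not_halted s j c b : bounded s j c b ->
  (s + j)%:R * expect M alpha beta c s (fun c' : cfg => (~~ halted c')%:R) <= b.
Proof.
elim: s j c b => [|s IH] j c b.
  case=> _ jc cb; rewrite expectE avg_tuple0 /=; apply: le_trans cb.
  case: (halted c) jc => /=; first by rewrite mulr0 makespan_ge0.
  by rewrite mulr1 add0n; apply.
case=> _ _ [g gw gb]; rewrite expectE avg_tupleS -avgZ; apply: le_trans gb.
by apply: avg_le => r; rewrite addSnnS; apply: IH (gw r).
Qed.

Lemma expect_halted (c : cfg) s :
  expect M alpha beta c s (fun c' : cfg => (halted c')%:R) =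
  1 - expect M alpha beta c s (fun c' : cfg => (~~ halted c')%:R).
Proof.
apply/eqP; rewrite -subr_eq opprK !expectE -avgD.
rewrite (@eq_avg _ _ _ (fun=> 1)) ?avg_cst // => [|w].
  by rewrite card_tuple expn_gt0 card_rnd.
by case: halted; rewrite /= ?addr0 ?add0r.
Qed.

(** As [b] does not depend on [s], the probability of not having halted after [s] steps is at most
    [b / s]. *)
Lemma bounded_halts c b : (forall s, bounded s 0 c b) ->
  halts_almost_surely M alpha beta c.
Proof.
move=> bc; have b0 : 0 <= b.
  by case: (bc 0%N) => _ _; apply: le_trans (makespan_ge0 _).
apply/cvgrPdist_le => e e0; near=> s.
have s0 : (0 < s)%N by near: s; exists 1%N.
rewrite expect_halted opprB addrC subrK ger0_norm; last first.
  by rewrite expectE avg_ge0 // => w; rewrite ler0n.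
have := bounded_not_halted (bc s); rewrite addn0 => /= le_b.
rewrite -(@ler_pM2l _ s%:R) ?ltr0n //; apply: le_trans le_b _.
rewrite -ler_pdivrMr //; near: s; exact: nbhs_infty_ger.
Unshelve. all: by end_near.
Qed.

(* All PEs have taken [j] steps, none is inside a communication; PE [i] is left
   with the code [cd i]. *)
Definition aligned (cd : 'I_p -> program) (sg : mem) (j : nat) (t : R)
    (c : cfg) : Prop :=
  forall i, [/\ code (c i) = cd i, memory (c i) = sg i,
                j%:R <= clock (c i) <= t, sent (c i) = None & got (c i) = None].

(* With credit [x], the expected makespan after [s] more steps exceeds the
   present clocks by at most [x]. *)
Definition safe (s : nat) (cd : 'I_p -> program) (sg : mem) (x : R) : Prop :=
  forall j t c, aligned cd sg j t c -> bounded s j c (t + x).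

Lemma aligned_makespan cd sg j t c :
  aligned cd sg j t c -> j%:R <= makespan c <= t.
Proof.
move=> cc; have /andP[jc ct] : j%:R <= clock (c (Ordinal p0)) <= t.
  by case: (cc (Ordinal p0)).
apply/andP; split.
  by rewrite /makespan (bigD1 (Ordinal p0)) //= le_max jc.
rewrite /makespan; elim/big_ind: _ => [|x y xt yt|i _].
- exact: le_trans (le_trans (ler0n _ j) jc) ct.
- by rewrite ge_max xt.
by case: (cc i) => _ _ /andP[].
Qed.

Lemma safe_nil s sg x : 0 <= x -> final sg -> safe s (fun=> [::]) sg x.
Proof.
move=> x0 fsg j t c cc; apply: bounded_halted.
- by apply/forallP => i; case: (cc i) => ->.
- suff -> : memories c = sg by [].
  by apply: funext => i; case: (cc i).
by have /andP[_ ct] := aligned_makespan cc; rewrite (le_trans ct) ?lerDl.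
Qed.

(** The common form of all steps. [y] is the time that the step adds to the clocks and [g w] the
    credit handed to outcome [w]. Unlucky outcomes may receive more than lucky ones, as only the
    mean of [g] is paid for. *)
Lemma safe_step s (cd : 'I_p -> program) sg x (cd' : rnd -> 'I_p -> program) (sg' : rnd -> mem) y
    (g : rnd -> R) :
  (forall i, ~~ nilp (cd i)) -> 0 <= x -> y + avg g <= x ->
  (forall w j t c, aligned cd sg j t c ->
     aligned (cd' w) (sg' w) j.+1 (t + y) (step c w)) ->
  (forall s' w, s = s'.+1 -> safe s' (cd' w) (sg' w) (g w)) ->
  safe s cd sg x.
Proof.
move=> cdn x0 ygx al sf j t c cc.
have nh : ~~ halted c.
  apply/negP => /forallP /(_ (Ordinal p0)); case: (cc (Ordinal p0)) => -> _ _ _ _.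
  by rewrite (negPf (cdn _)).
have /andP[jc ct] := aligned_makespan cc.
case: s sf => [|s] sf; split => //; rewrite ?(negPf nh) //.
  by rewrite (le_trans ct) ?lerDl.
exists (fun w => t + y + g w) => [w|].
  by apply: sf => //; apply: al.
by rewrite avgD avg_cst ?card_rnd // -addrA lerD2l.
Qed.

(* [W] bounds the internal work of each instruction of the program. *)
Definition unit_work : nat := 200.
Definition bounds_work (w : R) : Prop := unit_work%:R <= w.
Variable W : R.
Hypothesis unit_workW : bounds_work W.

Lemma W_ge0 : 0 <= W.
Proof. exact: le_trans (ler0n _ _) unit_workW. Qed.

Lemma work_le n : (n <= unit_work)%N -> n%:R <= W.
Proof. by move=> nu; apply: le_trans unit_workW; rewrite ler_nat. Qed.

Definition is_local (cd : program) : bool :=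
  match cd with
  | [::] | Comm _ _ :: _ => false
  | ins :: _ => (work ins <= unit_work)%N
  end.

Definition local_step (cd : program) (m : store T) (r : nat) :
    program * store T :=
  match cd with
  | Write a x e :: k => (k, write_block m a (evaln M m x) [:: eval M m e])
  | Draw a x e :: k =>
      (k, write_block m a (evaln M m x)
                      [:: Int (r %% maxn 1 (evaln M m e))%N])
  | If e k1 k2 :: k => ((if evaln M m e != 0%N then k1 else k2) ++ k, m)
  | While e body :: k =>
      (if evaln M m e != 0%N then body ++ cd else k, m)
  | _ => (cd, m)
  end.

Lemma aligned_local cd sg j t c (w : rnd) :
  (forall i, is_local (cd i)) -> aligned cd sg j t c ->
  aligned (fun i => (local_step (cd i) (sg i) (w i)).1)
          (fun i => (local_step (cd i) (sg i) (w i)).2) j.+1 (t + W) (step c w).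
Proof.
move=> lc cc i; case: (cc i) => cE mE /andP[jc ct] sE gE.
have clk n : (0 < n <= unit_work)%N ->
    j.+1%:R <= clock (c i) + n%:R <= t + W.
  by move=> /andP[n0 nW]; rewrite -natr1 !lerD // ?ler1n // work_le.
move: (lc i); rewrite /Defs.step /Defs.step_pe cE.
by case: (cd i) => [|[a x e|a x e|o q|e k1 k2|e b] k] //= wk; split;
  rewrite ?mE // clk.
Qed.

(** * Simultaneous exchange of messages *)

Definition message (o : option (expr * nat * expr * expr)) (m : store T) :
    seq (word T) :=
  if o is Some (dst, a, off, len)
  then read_block m a (evaln M m off) (evaln M m len) else [::].

Section Communication.
Variables (cd : 'I_p -> program) (sg : mem).
Variable o : 'I_p -> option (expr * nat * expr * expr).
Variable q : 'I_p -> option (expr * nat * expr).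
Variables (k : 'I_p -> program) (l : nat).

Definition received : mem := fun j =>
  if q j is Some (src, b, off) then
    if insub (evaln M (sg j) src) is Some i then
      write_block (sg j) b (evaln M (sg j) off) (message (o i) (sg i))
    else sg j
  else sg j.

Hypothesis cdE : forall i, cd i = Comm (o i) (q i) :: k i.
Hypothesis workW : forall i, (work (Comm (o i) (q i)) <= unit_work)%N.
Hypothesis sendP : forall i dst a off len, o i = Some (dst, a, off, len) ->
  (evaln M (sg i) len <= l)%N /\
  exists j : 'I_p, evaln M (sg i) dst = j /\
  exists src b off', q j = Some (src, b, off') /\ evaln M (sg j) src = i.
Hypothesis recvP : forall j src b off', q j = Some (src, b, off') ->
  exists i : 'I_p, evaln M (sg j) src = i /\
  exists dst a off len, o i = Some (dst, a, off, len) /\ evaln M (sg i) dst = j.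

(** By [sendP] and [recvP] each half of a [Comm] meets its counterpart at the partner, so all
    transfers complete within this step and nobody is blocked. A transfer starts at the later of two
    clocks, both at most [t], hence the clocks remain uniformly bounded. *)
Lemma aligned_comm j t c (w : rnd) : aligned cd sg j t c ->
  aligned k received j.+1 (t + (W + (alpha + l%:R * beta))) (step c w).
Proof.
move=> cc.
have psE i : pending_send p M (c i) =
    if o i is Some (dst, _, _, _) then
      omap (fun j' => (j', message (o i) (sg i))) (insub (evaln M (sg i) dst))
    else None.
  case: (cc i) => cE mE _ sE _; rewrite /pending_send cE cdE sE mE.
  by case: (o i) => [[[[dst a] off] len]|].
have prE i : pending_recv p M (c i) =
    if q i is Some (src, _, _) then insub (evaln M (sg i) src) else None.
  case: (cc i) => cE mE _ _ gE; rewrite /pending_recv cE cdE gE mE.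
  by case: (q i) => [[[src a] off]|].
have teP i i' : (exists dst a off len, o i = Some (dst, a, off, len)) ->
    Num.max (clock (c i)) (clock (c i')) <=
    transfer_end alpha beta c i i' (message (o i) (sg i)) <=
    t + (alpha + l%:R * beta).
  move=> [dst [a [off [len oE]]]].
  have [le_l _] := sendP oE.
  rewrite /transfer_end lerDl addr_ge0 ?mulr_ge0 //=.
  rewrite lerD //.
    by case: (cc i) (cc i') => _ _ /andP[_ ti] _ _ [_ _ /andP[_ ti'] _ _]; rewrite ge_max ti.
  by rewrite oE /message size_map size_iota lerD2l ler_wpM2r // ler_nat.
have shP i : if o i is Some _ then
    exists2 te, send_half M alpha beta c i = Some te
    & clock (c i) <= te <= t + (alpha + l%:R * beta)
  else send_half M alpha beta c i = None.
  case oE: (o i) => [[[[dst a] off] len]|]; last first.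
    by rewrite /send_half psE oE; case: (cc i) => _ _ _ -> _.
  have [_ [i' [dE [src [b [off' [qE sE]]]]]]] := sendP oE.
  exists (transfer_end alpha beta c i i' (message (o i) (sg i))).
    rewrite /send_half psE oE dE valK /= prE qE sE valK eqxx.
    by case: (cc i) => _ _ _ -> _.
  have /andP[te1 ->] : Num.max (clock (c i)) (clock (c i')) <=
      transfer_end alpha beta c i i' (message (o i) (sg i)) <=
      t + (alpha + l%:R * beta) by apply: teP; exists dst, a, off, len.
  by rewrite andbT; apply: le_trans te1; rewrite le_max lexx.
have rhP i : if q i is Some (src, b, off') then
    exists i', [/\ insub (evaln M (sg i) src) = Some i' ,
    exists2 te, recv_half M alpha beta c i = Some (message (o i') (sg i'), te)
    & clock (c i) <= te <= t + (alpha + l%:R * beta) & true]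
  else recv_half M alpha beta c i = None.
  case qE: (q i) => [[[src b] off']|]; last first.
    by rewrite /recv_half prE qE; case: (cc i) => _ _ _ _ ->.
  have [i' [sE [dst [a [off [len [oE dE]]]]]]] := recvP qE.
  exists i'; split => //; first by rewrite sE valK.
  exists (transfer_end alpha beta c i' i (message (o i') (sg i'))).
    rewrite /recv_half prE qE sE valK psE oE dE valK /= eqxx.
    by case: (cc i) => _ _ _ _ ->.
  have /andP[te1 ->] : Num.max (clock (c i')) (clock (c i)) <=
      transfer_end alpha beta c i' i (message (o i') (sg i')) <=
      t + (alpha + l%:R * beta) by apply: teP; exists dst, a, off, len.
  by rewrite andbT; apply: le_trans te1; rewrite le_max lexx orbT.
move=> i; case: (cc i) => cE mE /andP[jc ct] sE gE.
have abl : 0 <= alpha + l%:R * beta by rewrite addr_ge0 ?mulr_ge0.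
have clk t1 : clock (c i) <= t1 <= t + (alpha + l%:R * beta) ->
    j.+1%:R <= t1 + (work (Comm (o i) (q i)))%:R <=
    t + (W + (alpha + l%:R * beta)).
  move=> /andP[ct1 t1t]; apply/andP; split.
    by rewrite -natr1 lerD ?(le_trans jc ct1) // ler1n /work addn1.
  by rewrite [W + _]addrC addrA lerD // work_le.
have tt : clock (c i) <= t + (alpha + l%:R * beta).
  by apply: le_trans ct _; rewrite lerDl.
rewrite /Defs.step /Defs.step_pe cE cdE mE /received.
have := shP i; have := rhP i.
move: (clk); case: (o i) => [[[[dst a] off] len]|];
  case: (q i) => [[[src b] off']|] {}clk.
- move=> [i' [-> [te -> te1] _]] [te' -> te2] /=.
  split=> //; apply: clk; case/andP: te1 => te1 te1'.
  by case/andP: te2 => te2 te2'; rewrite le_max te2 ge_max te2'.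
- move=> -> [te' -> te2] /=.
  split=> //; apply: clk; case/andP: te2 => te2 te2'.
  by rewrite le_max te2 ge_max te2'.
- move=> [i' [-> [te -> te1] _]] -> /=.
  split=> //; apply: clk; case/andP: te1 => te1 te1'.
  by rewrite le_max lexx ge_max tt.
by move=> -> -> /=; split=> //; apply: clk; rewrite maxxx lexx.
Qed.

End Communication.

Lemma safe_local s (cd : 'I_p -> program) sg x :
  (forall i, is_local (cd i)) -> (forall i m r r', local_step (cd i) m r = local_step (cd i) m r') ->
  W <= x ->
  (forall s', s = s'.+1 ->
    safe s' (fun i => (local_step (cd i) (sg i) 0).1)
            (fun i => (local_step (cd i) (sg i) 0).2) (x - W)) ->
  safe s cd sg x.
Proof.
move=> lc dc Wx sf; apply: (@safe_step s cd sg x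
  (fun w i => (local_step (cd i) (sg i) (w i)).1)
  (fun w i => (local_step (cd i) (sg i) (w i)).2) W (fun=> x - W)).
- by move=> i; move: (lc i); case: (cd i).
- exact: le_trans W_ge0 Wx.
- by rewrite avg_cst ?card_rnd // addrC subrK.
- by move=> w j t c; apply: aligned_local.
move=> s' w sE; have := sf _ sE.
by congr safe; apply: funext => i; rewrite (dc i _ 0%N (w i)).
Qed.

(* [wp C Q sg x]: credit [x] suffices to run [C] from the memories [sg] and to
   reach memories and a remaining credit satisfying [Q]. *)
Definition wp (C : program) (Q : mem -> R -> Prop) (sg : mem) (x : R) : Prop :=
  0 <= x /\ forall k s,
  (forall s' sg' x', (s' <= s)%N -> 0 <= x' -> Q sg' x' ->
     safe s' (fun=> k) sg' x') ->
  safe s (fun=> C ++ k) sg x.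

Lemma wp_nil Q sg x : 0 <= x -> Q sg x -> wp [::] Q sg x.
Proof. by move=> x0 q; split=> // k s; apply. Qed.

Lemma wp_cat C1 C2 Q sg x : wp C1 (wp C2 Q) sg x -> wp (C1 ++ C2) Q sg x.
Proof.
case=> x0 h1; split=> // k s hk; rewrite -catA; apply: h1 => s' sg' x' s's _.
by case=> _; apply => s'' sg'' x'' s''s'; apply: hk; apply: leq_trans s''s' s's.
Qed.

Lemma wp_write a i e C Q sg x : (work (Write a i e) <= unit_work)%N ->
  wp C Q (fun j => write_block (sg j) a (evaln M (sg j) i) [:: eval M (sg j) e])
    (x - W) ->
  wp (Write a i e :: C) Q sg x.
Proof.
move=> wk [x0 h]; split; first by rewrite (le_trans W_ge0) // -subr_ge0.
move=> k s hk; apply: safe_local => // [|s' sE]; first by rewrite -subr_ge0.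
apply: h => s'' sg' x' s's; apply: hk; rewrite sE.
exact: leq_trans s's _.
Qed.

Lemma wp_draw a i e C Q sg x (g : rnd -> R) :
  (work (Draw a i e) <= unit_work)%N ->
  (forall w, wp C Q (fun j => write_block (sg j) a (evaln M (sg j) i)
               [:: Int ((w : rnd) j %% maxn 1 (evaln M (sg j) e))%N]) (g w)) ->
  W + avg g <= x -> wp (Draw a i e :: C) Q sg x.
Proof.
move=> wk h gx; have x0 : 0 <= x.
  by apply: le_trans gx; rewrite addr_ge0 ?W_ge0 ?avg_ge0 // => w; case: (h w).
split=> // k s hk; apply: safe_step gx _ _ => //.
- by move=> w j t c; apply: aligned_local.
move=> s' w sE /=; case: (h w) => _; apply => s'' sg' x' s's; apply: hk.
by rewrite sE; apply: leq_trans s's _.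
Qed.

(** The guard has to agree on all PEs: they continue with a common code, as [wp] requires. *)
Lemma wp_if (b : bool) e C1 C2 C Q sg x : (work (If e C1 C2) <= unit_work)%N ->
  (forall i, (evaln M (sg i) e != 0%N) = b) ->
  wp ((if b then C1 else C2) ++ C) Q sg (x - W) -> wp (If e C1 C2 :: C) Q sg x.
Proof.
move=> wk bE [x0 h]; split; first by rewrite (le_trans W_ge0) // -subr_ge0.
move=> k s hk; apply: safe_local => // [|s' sE]; first by rewrite -subr_ge0.
rewrite [X in safe _ X](_ : _ = fun=> ((if b then C1 else C2) ++ C) ++ k); last first.
  by apply: funext => i /=; rewrite bE catA.
apply: h => s'' sg' x' s's; apply: hk; rewrite sE.
exact: leq_trans s's _.
Qed.

Lemma wp_while (I : mem -> R -> Prop) e C Q : (work (While e C) <= unit_work)%N ->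
  (forall sg x, I sg x -> exists2 b : bool,
     forall i, (evaln M (sg i) e != 0%N) = b &
     if b then wp C I sg (x - W) else 0 <= x - W /\ Q sg (x - W)) ->
  forall sg x, I sg x -> wp [:: While e C] Q sg x.
Proof.
move=> wk h sg x Ix.
have ge0 sg' x' : I sg' x' -> 0 <= x' - W.
  by move=> /h [[] _ []].
split; first by rewrite (le_trans W_ge0) // -subr_ge0 (ge0 _ _ Ix).
move=> k s; elim: s {-2}s (leqnn s) sg x Ix => [|m IH] s sm sg x Ix hk;
  (apply: safe_local => // [|s' sE]; first by rewrite -subr_ge0; apply: ge0 Ix).
  by move: sm; rewrite sE.
have [b bE hb] := h _ _ Ix.
rewrite [X in safe _ X](_ : _ =
    fun=> if b then C ++ [:: While e C] ++ k else k); last first.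
  by apply: funext => i /=; rewrite bE; case: b {bE hb}; rewrite ?catA.
have s'm : (s' <= m)%N by rewrite -ltnS -sE.
case: b {bE} hb => [[_ hC]|[x'0 q]]; last by apply: hk => //; rewrite sE.
apply: hC => s'' sg' x' s''s' _ I'.
apply: IH => //; first exact: leq_trans s''s' s'm.
move=> s3 sg3 x3 s3s''; apply: hk; rewrite sE.
by apply: leq_trans s3s'' (leq_trans s''s' _).
Qed.

(** * Deterministic code *)

(** For code without random choices the cost is a fixed [c], separate from the credit of the
    context: whatever exceeds [c] survives. Thus costs add up along a program without reference to
    later averages. *)
Definition dt (C : program) (sg : mem) (P : mem -> Prop) (c : R) : Prop :=
  0 <= c /\ forall (Q : mem -> R -> Prop) x, c <= x ->
    (forall sg' x', P sg' -> x - c <= x' -> Q sg' x') -> wp C Q sg x.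

Lemma dt_nil sg (P : mem -> Prop) : P sg -> dt [::] sg P 0.
Proof.
by move=> Psg; split=> // Q x x0 h; apply: wp_nil => //; apply: h; rewrite ?subr0.
Qed.

Lemma dt_cat C1 C2 sg P1 P2 c1 c2 : dt C1 sg P1 c1 ->
  (forall sg1, P1 sg1 -> dt C2 sg1 P2 c2) -> 0 <= c2 ->
  dt (C1 ++ C2) sg P2 (c1 + c2).
Proof.
move=> [c10 h1] h2 c20; split; first exact: addr_ge0.
move=> Q x cx hQ; apply/wp_cat/h1; first by apply: le_trans cx; rewrite lerDl.
move=> sg1 x1 /h2 [_ h] x1c; apply: h; first by apply: le_trans x1c; rewrite lerBrDl.
by move=> sg' x' Psg' x'c; apply: hQ => //; lra.
Qed.

Lemma dt_le C sg (P P' : mem -> Prop) c c' : dt C sg P c -> c <= c' ->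
  (forall sg', P sg' -> P' sg') -> dt C sg P' c'.
Proof.
move=> [c0 h] cc' PP'; split; first exact: le_trans cc'.
move=> Q x c'x hQ; apply: h => [|sg' x' /PP' P's xx']; first exact: le_trans c'x.
by apply: hQ => //; lra.
Qed.

Fixpoint exec (C : program) (m : store T) : store T :=
  if C is Write a i e :: C' then
    exec C' (write_block m a (evaln M m i) [:: eval M m e])
  else m.

Definition is_write (c : instr) : bool :=
  if c is Write _ _ _ then (work c <= unit_work)%N else false.

Lemma dt_block C sg : all is_write C ->
  dt C sg (fun sg' => sg' = fun i => exec C (sg i)) ((size C)%:R * W).
Proof.
elim: C sg => [|c C IH] sg /=; first by rewrite mul0r => _; apply: dt_nil.
case/andP => wc /IH hC.
case: c wc => // a i e wc; split; first by rewrite mulr_ge0 ?W_ge0.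
move=> Q x cx hQ; apply: wp_write => //; have [_ h] := hC (fun j =>
  write_block (sg j) a (evaln M (sg j) i) [:: eval M (sg j) e]).
move: cx hQ; rewrite -natr1 mulrDl mul1r => cx hQ.
apply: h => [|sg' x' sgE xx']; first by rewrite lerBrDr.
by apply: hQ => //; lra.
Qed.

Lemma dt_if (b : bool) e C1 C2 sg P c : (work (If e C1 C2) <= unit_work)%N ->
  (forall i, (evaln M (sg i) e != 0%N) = b) ->
  dt (if b then C1 else C2) sg P c -> dt [:: If e C1 C2] sg P (W + c).
Proof.
move=> wk bE [c0 h]; split; first by rewrite addr_ge0 ?W_ge0.
move=> Q x cx hQ; apply: wp_if bE _ => //; rewrite cats0; apply: h.
  by rewrite lerBrDl.
by move=> sg' x' Psg xx'; apply: hQ => //; lra.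
Qed.

(** Unlike in [wp_while], the invariant counts the iterations, which makes the cost a sum over
    levels. The last [W] pays for the guard that ends the loop. *)
Lemma dt_while (J : nat -> mem -> Prop) m (c : nat -> R) e C sg P :
  (work (While e C) <= unit_work)%N -> (forall l, 0 <= c l) ->
  (forall l sg, J l sg -> exists2 b : bool,
     forall i, (evaln M (sg i) e != 0%N) = b &
     if b then (l < m)%N /\ dt C sg (J l.+1) (c l) else P sg) ->
  J 0 sg -> dt [:: While e C] sg P (\sum_(0 <= l < m) (W + c l) + W).
Proof.
move=> wk c0 hJ J0; have W0 := W_ge0.
have s0 l : 0 <= \sum_(l <= l' < m) (W + c l').
  by rewrite sumr_ge0 // => i _; rewrite addr_ge0.
split; first by rewrite addr_ge0.
move=> Q x cx hQ; set S := _ + W in cx hQ *.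
(* The surplus [x - S] is carried through the loop unspent. *)
pose I sg' y := exists2 l, J l sg' &
  (l <= m)%N /\ \sum_(l <= l' < m) (W + c l') + W + (x - S) <= y.
apply: (@wp_while I) => //; last first.
  by exists 0%N => //; split=> //; rewrite /S; lra.
move=> sg' y [l Jl [lm yE]]; have [b bE hb] := hJ _ _ Jl; exists b => //.
have l0 := s0 l.
case: b {bE} hb => [[{}lm [_ hC]]|Psg]; last first.
  by split; [|apply: hQ => //]; lra.
move: yE l0; rewrite (big_ltn lm) /= => yE _; have l0 := s0 l.+1; have cl := c0 l.
apply: hC; first lra.
by move=> sg1 y1 J1 y1E; exists l.+1 => //; split=> //; lra.
Qed.

Definition comm (dst : expr) a off len src b off' :=
  Comm (Some (dst, a, off, len)) (Some (src, b, off')).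

(** Mutually inverse [f] and [g] describe a permutation of the PEs: each sends one message and
    receives one, as full-duplex single-ported communication permits. *)
Lemma dt_comm (f g : 'I_p -> 'I_p) dst a off len src b off' sg l :
  (work (comm dst a off len src b off') <= unit_work)%N ->
  (forall i, evaln M (sg i) dst = f i) -> (forall i, evaln M (sg i) src = g i) ->
  cancel f g -> cancel g f -> (forall i, (evaln M (sg i) len <= l)%N) ->
  dt [:: comm dst a off len src b off'] sg
    (fun sg' => sg' = fun j => write_block (sg j) b (evaln M (sg j) off')
       (read_block (sg (g j)) a (evaln M (sg (g j)) off)
                                (evaln M (sg (g j)) len)))
    (W + (alpha + l%:R * beta)).
Proof.
move=> wk fE gE fK gK ll; have W0 := W_ge0.
have c0 : 0 <= alpha + l%:R * beta by rewrite addr_ge0 ?mulr_ge0.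
split; first by rewrite addr_ge0.
move=> Q x cx hQ; set sg' := fun j => _ in hQ; set c := W + _ in cx hQ.
have rE : received sg (fun=> Some (dst, a, off, len)) (fun=> Some (src, b, off')) = sg'.
  by apply: funext => j; rewrite /received gE valK.
split; first by apply: le_trans cx; rewrite addr_ge0.
move=> k s hk; apply: (@safe_step s _ sg x (fun=> fun=> k) (fun=> sg') c (fun=> x - c)).
- by [].
- by apply: le_trans cx; rewrite addr_ge0.
- by rewrite avg_cst ?card_rnd // addrC subrK.
- move=> w j t cf cc; rewrite -rE; apply: (aligned_comm (l := l)) cc => //.
    move=> i dst' a' off1 len' [<- _ _ <-]; split=> //; exists (f i); split=> //.
    by exists src, b, off'; rewrite gE fK.
  move=> i src' b' off1 [<- _ _]; exists (g i); split=> //.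
  by exists dst, a, off, len; rewrite fE gK.
move=> s' w sE; apply: hk; rewrite ?sE ?subr_ge0 //; exact: hQ.
Qed.

(* PE [i] sends only if [snd] holds there and receives only if [rcv] does. *)
Definition partial_comm (snd rcv dst : expr) a off len src b off' :=
  let o := Some (dst, a, off, len) in let q := Some (src, b, off') in
  If snd [:: If rcv [:: Comm o q] [:: Comm o None]]
         [:: If rcv [:: Comm None q] [:: Comm None None]].

(** The guards may differ among the PEs here. All four branches consist of two tests and one [Comm],
    an empty one if need be, so the PEs hold different code for a while but meet again after the
    same number of steps. *)
Lemma dt_partial_comm (sb rb : 'I_p -> bool) (f g : 'I_p -> 'I_p)
    snd rcv dst a off len src b off' sg l :
  [&& work (If snd [::] [::]) <= unit_work, work (If rcv [::] [::]) <= unit_work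
    & work (comm dst a off len src b off') <= unit_work]%N ->
  (forall i, (evaln M (sg i) snd != 0%N) = sb i) ->
  (forall i, (evaln M (sg i) rcv != 0%N) = rb i) ->
  (forall i, sb i -> evaln M (sg i) dst = f i /\ (evaln M (sg i) len <= l)%N) ->
  (forall i, rb i -> evaln M (sg i) src = g i) ->
  (forall i, sb i -> rb (f i) /\ g (f i) = i) ->
  (forall i, rb i -> sb (g i) /\ f (g i) = i) ->
  dt [:: partial_comm snd rcv dst a off len src b off'] sg
    (fun sg' => sg' = fun j => if rb j then
       write_block (sg j) b (evaln M (sg j) off')
       (read_block (sg (g j)) a (evaln M (sg (g j)) off)
                                (evaln M (sg (g j)) len)) else sg j)
    (W + W + (W + (alpha + l%:R * beta))).
Proof.
move=> /and3P[wk1 wk2 wk3] sbE rbE fE gE fK gK; have W0 := W_ge0.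
have c0 : 0 <= alpha + l%:R * beta by rewrite addr_ge0 ?mulr_ge0.
split; first lra.
move=> Q x cx hQ; set sg' := fun j => _ in hQ; set c := _ + _ in cx hQ.
pose o i := if sb i then Some (dst, a, off, len) else None.
pose q i := if rb i then Some (src, b, off') else None.
have rE : received sg o q = sg'.
  apply: funext => j; rewrite /received /q /sg'; case: ifP => // rj.
  by rewrite gE // valK /o; have [-> _] := gK _ rj.
have xc : c <= x by [].
split; first by rewrite /c in cx; lra.
move=> k s hk; apply: safe_local => //; first by rewrite /c in cx; lra.
move=> s1 s1E; apply: safe_local; rewrite /=.
- by move=> i; case: ifP.
- by move=> i; case: ifP.
- by rewrite /c in cx; lra.
move=> s2 s2E.
suff : safe s2 (fun i => Comm (o i) (q i) :: k) sg (x - W - W).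
  congr safe; apply: funext => i; rewrite /o /q -?sbE -?rbE;
    by case: (evaln M (sg i) snd != 0%N) => /=; case: (evaln M (sg i) rcv != 0%N).
apply: (@safe_step s2 _ sg _ (fun=> fun=> k) (fun=> sg')
          (W + (alpha + l%:R * beta)) (fun=> x - c)).
- by [].
- by rewrite /c in cx; lra.
- by rewrite avg_cst ?card_rnd // /c; lra.
- move=> w j t cf cc; rewrite -rE; apply: (aligned_comm (l := l)) cc => //.
  + move=> i; apply: leq_trans wk3; rewrite /o /q; do 2!case: ifP => _ //=; lia.
  + move=> i dst' a' off1 len'; rewrite /o; case: ifP => // si [<- _ _ <-].
    have [fi ->] := fE _ si; split=> //; exists (f i); split=> //.
    by have [rfi gfi] := fK _ si; exists src, b, off'; rewrite /q rfi gE // gfi.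
  move=> i src' b' off1; rewrite /q; case: ifP => // ri [<- _ _].
  exists (g i); rewrite gE //; split=> //; have [sgi fgi] := gK _ ri.
  by exists dst, a, off, len; rewrite /o sgi; have [-> _] := fE _ sgi; rewrite fgi.
move=> s' w sE; apply: hk; rewrite ?subr_ge0 //; last exact: hQ.
by rewrite s1E s2E sE; lia.
Qed.

End Logic.


(** * Independent samples *)

Lemma avg_reindex (R : realType) (V V' : finType) (h : V' -> V) (f : V -> R) :
  bijective h -> avg f = avg (fun v => f (h v)).
Proof. by move=> bh; rewrite /avg (reindex h) ?(bij_eq_card bh) //; apply: onW_bij. Qed.

Lemma markov_avg (R : realType) (V : finType) (X : V -> R) (dl : R) : 0 < dl ->
  avg (fun v => (dl <= `|X v|)%R%:R) <= avg (fun v => X v ^+ 2) / dl ^+ 2.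
Proof.
move=> dl0; rewrite mulrC -avgZ; apply: avg_le => v.
have d2 : 0 < dl ^+ 2 by rewrite exprn_gt0.
rewrite mulrC ler_pdivlMr //; case: (leP dl `|X v|) => h; last by rewrite mul0r sqr_ge0.
by rewrite mul1r -[X v ^+ 2]real_normK ?num_real // ler_pXn2r // nnegrE // ltW.
Qed.

Section Independence.
Variables (R : realType) (J V : finType).
Hypothesis V0 : (0 < #|V|)%N.

(** Independence of the coordinates of a uniformly random function; the moments below are instances
    with at most two nontrivial factors. *)
Lemma avg_prod (F : J -> V -> R) :
  avg (fun f : {ffun J -> V} => \prod_e F e (f e)) = \prod_e avg (F e).
Proof.
rewrite /avg -(bigA_distr_bigA F) card_ffun natrX.
by rewrite big_split /= prodr_const -exprVn.
Qed.

Lemma avg_coord (g : V -> R) e : avg (fun f : {ffun J -> V} => g (f e)) = avg g.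
Proof.
have := avg_prod (fun e' v => if e' == e then g v else 1).
rewrite (bigD1 e) //= eqxx [X in _ * X]big1 ?mulr1 => [<-|e' /negPf ->]; last first.
  by rewrite avg_cst.
apply: eq_avg => f; rewrite (bigD1 e) //= eqxx big1 ?mulr1 // => e' /negPf -> //.
Qed.

Lemma avg_coord2 (g h : V -> R) e e' : e != e' ->
  avg (fun f : {ffun J -> V} => g (f e) * h (f e')) = avg g * avg h.
Proof.
move=> ee'; have := avg_prod (fun i v => if i == e then g v else if i == e' then h v else 1).
have e'e : (e' == e) = false by rewrite eq_sym (negPf ee').
rewrite (bigD1 e) //= eqxx (bigD1 e') /=; last by rewrite eq_sym.
rewrite eqxx e'e [X in _ * (_ * X)]big1 ?mulr1 => [<-|i /andP[/negPf -> /negPf ->]]; last first.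
  by rewrite avg_cst.
apply: eq_avg => f; rewrite (bigD1 e) //= eqxx (bigD1 e') /=; last by rewrite eq_sym.
by rewrite eqxx e'e big1 ?mulr1 // => i /andP[/negPf -> /negPf ->].
Qed.

Variable b : pred V.
Let rho : R := avg (fun v => (b v)%:R).

Definition hits (A : pred J) (f : {ffun J -> V}) : R := \sum_(e | A e) (b (f e))%:R.

Lemma rho_bounds : 0 <= rho <= 1.
Proof.
rewrite avg_ge0 /= => [|v]; last exact: ler0n.
rewrite -[X in _ <= X](avg_cst (1 : R) V0); apply: avg_le => v.
by rewrite lern1 leq_b1.
Qed.

Lemma avg_hits A : avg (hits A) = #|A|%:R * rho.
Proof.
rewrite avg_sum (eq_bigr (fun=> rho)) => [|e _].
  by rewrite sumr_const mulr_natl.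
by rewrite (avg_coord (fun v => (b v)%:R)).
Qed.

(** When the square is expanded, distinct positions contribute covariances, which vanish by
    independence; each diagonal term is [rho - rho ^+ 2]. *)
Lemma variance_hits A :
  avg (fun f => (hits A f - #|A|%:R * rho) ^+ 2) <= #|A|%:R * rho.
Proof.
pose g v := (b v)%:R - rho.
have g0 : avg g = 0.
  by rewrite /g (avgD (fun v => (b v)%:R) (fun=> - rho)) avg_cst // subrr.
have g2 : avg (fun v => g v * g v) <= rho.
  have -> : avg (fun v => g v * g v) = rho - rho ^+ 2.
    rewrite (eq_avg (g := fun v => (1 - 2 * rho) * (b v)%:R + rho ^+ 2)) => [|v].
      by rewrite avgD avgZ avg_cst // -/rho; ring.
    by rewrite /g; case: (b v) => /=; ring.
  by have := sqr_ge0 rho; lra.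
rewrite (eq_avg (g := fun f : {ffun J -> V} => \sum_(e | A e) \sum_(e' | A e') g (f e) * g (f e'))) => [|f].
  rewrite avg_sum mulr_natl -sumr_const; apply: ler_sum => e Ae.
  rewrite avg_sum (bigD1 e) //= (avg_coord (fun v => g v * g v)).
  rewrite big1 ?addr0 // => e' /andP[_ e'e].
  by rewrite avg_coord2 1?eq_sym // g0 mul0r.
have -> : hits A f - #|A|%:R * rho = \sum_(e | A e) g (f e).
  by rewrite /g /hits sumrB sumr_const mulr_natl.
by rewrite expr2 big_distrlr.
Qed.

Lemma chebyshev_hits A (dl : R) : 0 < dl ->
  avg (fun f => (dl <= `|hits A f - #|A|%:R * rho|)%R%:R) <= #|A|%:R * rho / dl ^+ 2.
Proof.
move=> dl0; apply: le_trans (markov_avg _ dl0) _.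
by rewrite ler_pM2r ?invr_gt0 ?exprn_gt0 // variance_hits.
Qed.

Lemma avg_hitsM (A A' : pred J) : {subset A <= A'} ->
  avg (fun f => hits A f * hits A' f) = #|A|%:R * (rho + (#|A'|%:R - 1) * rho ^+ 2).
Proof.
move=> sA; rewrite (eq_avg (g := fun f : {ffun J -> V} =>
    \sum_(e | A e) \sum_(e' | A' e') (b (f e))%:R * (b (f e'))%:R)); last first.
  by move=> f; rewrite big_distrlr.
rewrite avg_sum mulr_natl -sumr_const; apply: eq_bigr => e Ae.
rewrite avg_sum (bigD1 e) /=; last exact: sA.
rewrite (eq_avg (g := fun f : {ffun J -> V} => (b (f e))%:R)) => [|f]; last first.
  by case: (b _); rewrite /= ?mulr1 ?mulr0.
rewrite (avg_coord (fun v => (b v)%:R)) -/rho; congr (_ + _).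
rewrite (eq_bigr (fun=> rho ^+ 2)) => [|e' /andP[_ e'e]]; last first.
  by rewrite (avg_coord2 (fun v => (b v)%:R) (fun v => (b v)%:R)) 1?eq_sym.
have eA' : e \in A' by apply: sA.
rewrite sumr_const (cardD1x eA').
rewrite natrD [X in (X - 1) * _]addrC addrK mulr_natl; congr (_ *+ _).
Qed.

(* Bounds the indicator from below by [hits A * (2 - hits A')]. *)
Lemma single_hit (A A' : pred J) : {subset A <= A'} ->
  #|A|%:R * rho * (1 - #|A'|%:R * rho) <=
  avg (fun f => ((hits A f == 1) && (hits A' f == 1))%R%:R).
Proof.
move=> sA; apply: (@le_trans _ _ (avg (fun f => 2 * hits A f + -1 * (hits A f * hits A' f)))).
  rewrite avgD !avgZ avg_hits avg_hitsM //.
  have /andP[r0 _] := rho_bounds.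
  have : 0 <= #|A|%:R * rho ^+ 2 by rewrite mulr_ge0 ?sqr_ge0.
  by nra.
apply: avg_le => f.
have hN (X : pred J) : hits X f = (\sum_(e | X e) b (f e))%:R by rewrite natr_sum.
have le : (\sum_(e | A e) b (f e) <= \sum_(e | A' e) b (f e))%N.
  rewrite [X in (_ <= X)%N](bigID A) /=.
  rewrite (eq_bigl (fun e => A' e && A e)) ?leq_addr // => e.
  by case Ae: (A e); rewrite ?andbF // andbT; symmetry; apply: (sA e).
rewrite !hN; move: le; move: (\sum_(e | A e) _)%N => x; move: (\sum_(e | A' e) _)%N => y.
case: y => [|[|y]] xy.
- have -> : x = 0%N by apply/eqP; rewrite -leqn0.
  by rewrite !mulr0 addr0 ler0n.
- case: x xy => [|[|x]] // _; rewrite ?mulr0 ?mul0r ?mulr0 ?addr0 ?ler0n //.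
  by rewrite eqxx /=; lra.
have y0 : 0 <= (x%:R : R) * y%:R by rewrite mulr_ge0.
apply: (@le_trans _ _ 0); last exact: ler0n.
by rewrite -!natr1; lra.
Qed.

End Independence.

Lemma sum_modn q u a : (0 < q)%N ->
  (\sum_(0 <= v < a * q) (v %% q < u))%N = (a * minn u q)%N.
Proof.
move=> q0; elim: a => [|a IH]; first by rewrite !mul0n big_geq.
have e : (\sum_(0 <= v < q) (v < u : nat))%N = minn u q.
  elim: (q) => [|n IHn]; first by rewrite big_geq ?minn0.
  rewrite big_nat_recr //= IHn; case: (ltnP n u) => h; clear -h; lia.
rewrite mulSn addnC (big_cat_nat _ (n := (a * q)%N)) ?leq_addr //= IH mulSn addnC.
congr (_ + _)%N; rewrite -{1}[(a * q)%N]add0n big_addn addKn -e.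
by apply: eq_big_nat => v /andP[_ vq]; rewrite addnC modnMDl modn_small.
Qed.

(** [q] divides the factorial of [m], so the residues modulo [q] are exactly uniform. *)
Lemma avg_modn (R : realType) q u m : (0 < q <= m)%N ->
  avg (fun v : 'I_(m`!) => (v %% q < u)%N%:R) = (minn u q)%:R / q%:R :> R.
Proof.
move=> /andP[q0 qm]; have /dvdnP[a aE] : (q %| m`!)%N by rewrite dvdn_fact // q0.
have a0 : (0 < a)%N by have := fact_gt0 m; rewrite aE muln_gt0 => /andP[].
rewrite /avg card_ord -natr_sum.
rewrite -(big_mkord xpredT (fun v => (v %% q < u : nat)%N)) aE sum_modn //.
rewrite !natrM -mulf_div divff ?mul1r // pnatr_eq0 -lt0n //.
Qed.

(** The summation range [n] may exceed the length of the list, so that lists of different lengths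
    can share one range. *)
Lemma count_mask (T : Type) (x0 : T) (P : pred T) (m : bitseq) (s : seq T) n :
  (size s <= n)%N ->
  count P (mask m s) = (\sum_(0 <= j < n) ((j < size s) && P (nth x0 s j) && nth false m j))%N.
Proof.
elim: s m n => [|x s IH] m n.
  by move=> _; rewrite mask0 big1.
case: n => // n; rewrite ltnS => sn; rewrite big_nat_recl //.
case: m => [|b m] /=.
  by rewrite big1 ?addn0 ?andbF // => j _; rewrite andbF.
rewrite -IH //; case: b => /=; rewrite ?andbT ?andbF //.
Qed.

Lemma count_nth (T : Type) (x0 : T) (P : pred T) (s : seq T) n : (size s <= n)%N ->
  count P s = (\sum_(0 <= j < n) ((j < size s) && P (nth x0 s j)))%N.
Proof.
move=> sn; rewrite -{1}(mask_true sn) (count_mask x0 _ _ sn).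
by apply: eq_big_nat => j /andP[_ jn]; rewrite nth_nseq jn andbT.
Qed.

(* Rows of random numbers of [p] PEs, as one family of random numbers. *)
Definition rows (p n : nat) (V : finType) (f : {ffun 'I_p * 'I_n -> V}) :
    n.-tuple {ffun 'I_p -> V} :=
  [tuple [ffun i => f (i, j)] | j < n].

Lemma rows_bij p n V : bijective (@rows p n V).
Proof.
exists (fun w : n.-tuple {ffun 'I_p -> V} => [ffun e => tnth w e.2 e.1]).
  by move=> f; apply/ffunP => -[i j]; rewrite !ffunE tnth_mktuple ffunE.
by move=> w; apply: eq_from_tnth => j; rewrite tnth_mktuple; apply/ffunP => i; rewrite !ffunE.
Qed.


(** * The potential *)

Section Potential.
Variables (R : realType) (m0 : nat) (A w G : R).
Hypotheses (m00 : (0 < m0)%N) (A0 : 0 <= A) (w0 : 0 <= w) (G43 : 4 / 3 <= G).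

Lemma lnG_gt0 : 0 < ln G.
Proof. by have hG := G43; apply: ln_gt0; lra. Qed.
Let Lg := lnG_gt0.

(* Bounds the work of the rounds from [x] elements on, if no PE has more than
   [m0] elements and the number of elements shrinks by the factor [G]. *)
Definition work_left (x : R) : R :=
  Num.min x m0%:R + m0%:R * (Num.max 0 (ln (x / m0%:R)) / ln G).

Lemma work_left_mono x y : 0 < x -> x <= y -> work_left x <= work_left y.
Proof.
move=> x0 xy; have m0R : 0 < m0%:R :> R by rewrite ltr0n.
apply: lerD; first by rewrite le_min !ge_min xy lexx orbT.
rewrite ler_wpM2l ?ler0n // ler_pM2r ?invr_gt0 // ge_max le_max lexx /=.
rewrite le_max ler_ln ?posrE ?divr_gt0 //; last exact: lt_le_trans xy.
by rewrite ler_pM2r ?invr_gt0 // xy orbT.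
Qed.

(** If [x <= m], the minimum drops by a quarter of [x], since [y <= 3/4 x]. If [m <= y], the
    logarithmic part drops by at least [m]. In between, the two parts share the drop. *)
Lemma work_left_drop x y : 0 < y -> y * G <= x ->
  Num.min x m0%:R / 8 <= work_left x - work_left y.
Proof.
move=> y0 yG; have hG43 := G43; have Lg0 := Lg; have m0R : 0 < m0%:R :> R by rewrite ltr0n.
have x0 : 0 < x by apply: lt_le_trans yG; rewrite mulr_gt0 //; lra.
have yx : y * (4 / 3) <= x by apply: le_trans yG; rewrite ler_pM2l.
rewrite /work_left; set m := m0%:R in m0R *.
have [xm|mx] := leP x m.
  have ym : y <= m by lra.
  have lnx : ln (x / m) <= 0 by apply: ln_le0; rewrite ler_pdivrMr // mul1r.
  have lny : ln (y / m) <= 0 by apply: ln_le0; rewrite ler_pdivrMr // mul1r.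
  rewrite !(max_idPl _) // mul0r mulr0 (min_idPl ym); lra.
have lnx : 0 <= ln (x / m) by apply: ln_ge0; rewrite ler_pdivlMr // mul1r ltW.
rewrite (max_idPr lnx).
have [my|ym] := leP m y.
  have lny : 0 <= ln (y / m) by apply: ln_ge0; rewrite ler_pdivlMr // mul1r.
  rewrite (max_idPr lny) opprD addrACA subrr add0r -mulrBr -mulrBl.
  have h : ln G <= ln (x / m) - ln (y / m).
    rewrite -ln_div ?posrE ?divr_gt0 // ler_ln ?posrE; [|lra|by rewrite !divr_gt0].
    by rewrite invfM invrK mulrACA mulVf ?gt_eqF // mulr1 ler_pdivlMr // mulrC.
  have : 1 <= (ln (x / m) - ln (y / m)) / ln G by rewrite ler_pdivlMr // mul1r.
  by nra.
have lny : ln (y / m) <= 0 by apply: ln_le0; rewrite ler_pdivrMr // mul1r ltW.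
rewrite (max_idPl lny) mul0r mulr0 addr0.
(* Either [y] is at most [7/8 m] and the minimum drops by [m / 8], or [x / m] exceeds [7/8 G]; then
   the logarithmic part drops, because [(8/7)^2 <= 4/3 <= G] makes [ln (8/7)] at most half of
   [ln G]. *)
have [h|h] := leP (y * (8 / 7)) m.
  have : 0 <= m * (ln (x / m) / ln G) by rewrite mulr_ge0 ?divr_ge0 ?(ltW Lg0) ?(ltW m0R).
  by lra.
have hG : ln (8 / 7 : R) *+ 2 <= ln G.
  rewrite -lnXn; last by lra.
  by rewrite ler_ln ?posrE; lra.
have h2 : ln G - ln (8 / 7) <= ln (x / m).
  rewrite -ln_div ?posrE; [|lra|lra].
  rewrite ler_ln ?posrE ?divr_gt0 //; [|lra].
  rewrite ler_pdivlMr // mulrAC ler_pdivrMr //.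
  by apply: (@le_trans _ _ (G * (y * (8 / 7)))); [rewrite ler_wpM2l ?(ltW h) //; lra|lra].
rewrite mulr2n in hG.
have : 1 / 8 <= ln (x / m) / ln G by rewrite ler_pdivlMr //; lra.
by nra.
Qed.

(** [A] is the fixed cost of a round and [w] its cost per element of the longest list. 16 is the
    inverse of the probability of success in [potential_drift], 8 makes up for the loss in
    [work_left_drop], and the summand 1 pays for a round that leaves at most one element. *)
Definition potential (N : nat) : R :=
  if (N <= 1)%N then 0 else 16 * (A * (1 + ln N%:R / ln G) + 8 * w * work_left N%:R).

Lemma ln_nat_ge0 N : 0 <= ln N%:R :> R.
Proof. by case: N => [|N]; [rewrite ln0|apply: ln_ge0; rewrite ler1n]. Qed.

Lemma work_left_ge0 N : 0 <= work_left N%:R.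
Proof.
rewrite /work_left addr_ge0 ?le_min ?ler0n // mulr_ge0 // divr_ge0 //.
  by rewrite le_max lexx.
exact: ltW.
Qed.

Lemma potential_ge0 N : 0 <= potential N.
Proof.
rewrite /potential; case: ifP => // _; have h := work_left_ge0 N.
rewrite mulr_ge0 // addr_ge0 // mulr_ge0 // ?mulr_ge0 // addr_ge0 //.
by rewrite divr_ge0 ?ln_nat_ge0 // ltW.
Qed.

Lemma potential_mono N N' : (N <= N')%N -> potential N <= potential N'.
Proof.
have [N1 _|N2 NN] := leqP N 1; first by rewrite {1}/potential N1 potential_ge0.
rewrite /potential (leqNgt N 1) (leqNgt N' 1) N2 (leq_trans N2 NN) /=.
have N0 : 0 < N%:R :> R by rewrite ltr0n ltnW.
have NNR : N%:R <= N'%:R :> R by rewrite ler_nat.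
have h := work_left_mono N0 NNR.
rewrite ler_pM2l // lerD //; last by rewrite ler_wpM2l // mulr_ge0.
rewrite ler_wpM2l // lerD2l ler_pM2r ?invr_gt0 // ler_ln ?posrE //.
exact: lt_le_trans NNR.
Qed.

Lemma potential_drop N N1 : (2 <= N)%N -> ((N1 <= 1)%N \/ N1%:R * G <= N%:R) ->
  16 * (A + w * Num.min N%:R m0%:R) <= potential N - potential N1.
Proof.
move=> N2 hN1; have hG43 := G43; have Lg0 := Lg; have hA := A0; have hw := w0; have N0 : 0 < N%:R :> R by rewrite ltr0n ltnW.
have mn0 : 0 <= Num.min N%:R m0%:R :> R by rewrite le_min !ler0n.
have lnN := ln_nat_ge0 N; have lnNG : 0 <= A * (ln N%:R / ln G) by rewrite mulr_ge0 ?divr_ge0 // ltW.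
rewrite {1}/potential (leqNgt N 1) N2 /=.
case: (leqP N1 1) hN1 => [N1le _|N12 [//|hG]].
  rewrite /potential N1le subr0 ler_pM2l // mulrDr mulr1.
  have : Num.min N%:R m0%:R <= work_left N%:R.
    rewrite /work_left lerDl mulr_ge0 ?ler0n // divr_ge0 //.
      by rewrite le_max lexx.
    exact: ltW.
  have := work_left_ge0 N; move: (work_left _) lnNG (Num.min _ _) mn0 => a b c c0 a0 ca.
  have : w * c <= w * a by rewrite ler_wpM2l.
  have : 0 <= w * a by rewrite mulr_ge0.
  by lra.
have N10 : 0 < N1%:R :> R by rewrite ltr0n ltnW.
rewrite /potential (leqNgt N1 1) N12 /= -mulrBr ler_pM2l //.
have h := work_left_drop N10 hG.
have h1 : A <= A * (ln N%:R / ln G) - A * (ln N1%:R / ln G).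
  rewrite -mulrBr -mulrBl -[X in X <= _]mulr1 ler_wpM2l // ler_pdivlMr // mul1r.
  have := hG; rewrite -(ler_ln (x := N1%:R * G)) ?posrE ?mulr_gt0 //; last by lra.
  by rewrite lnM ?posrE //; lra.
have : w * (Num.min N%:R m0%:R / 8) <= w * (work_left N%:R - work_left N1%:R) by rewrite ler_wpM2l.
by lra.
Qed.

(** With probability at least 1/16 the potential falls by 16 times the cost of the round, by
    [potential_drop]; otherwise it does not rise, by monotonicity. *)
Lemma potential_drift (V : finType) (X : V -> nat) N N1 : (0 < #|V|)%N -> (2 <= N)%N ->
  ((N1 <= 1)%N \/ N1%:R * G <= N%:R) -> (forall v, (X v <= N)%N) ->
  1 / 16 <= avg (fun v => (X v <= N1)%N%:R) :> R ->
  A + w * Num.min N%:R m0%:R + avg (fun v => potential (X v)) <= potential N.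
Proof.
move=> V0 N2 hN1 XN hX; have hd := potential_drop N2 hN1.
set dr := potential N - potential N1 in hd.
have mn0 : 0 <= Num.min N%:R m0%:R :> R by rewrite le_min !ler0n.
have b0 : 0 <= A + w * Num.min N%:R m0%:R by rewrite addr_ge0 // mulr_ge0.
have : avg (fun v => potential (X v)) <= avg (fun v => potential N + - dr * (X v <= N1)%N%:R).
  apply: avg_le => v; case: leqP => h; last by rewrite mulr0 addr0 potential_mono.
  by rewrite mulr1 /dr opprB addrC subrK potential_mono.
rewrite avgD avgZ avg_cst // => h.
have : dr * (1 / 16) <= dr * avg (fun v => (X v <= N1)%N%:R) by rewrite ler_wpM2l //; lra.
by lra.
Qed.

End Potential.


(** * Symbolic evaluation *)

Section Evaluation.
Variables (d : Order.disp_t) (T : orderType d) (M : nat).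
Implicit Types (m : store T) (e : expr).

Definition ev m e (v : nat) : Prop := eval M m e = Int v.

Lemma ev_eq m e v v' : ev m e v' -> v' = v -> ev m e v.
Proof. by move=> h <-. Qed.

Lemma evn m e v : ev m e v -> evaln M m e = v.
Proof. by rewrite /evaln => ->. Qed.

Lemma ev_lit m x : (x < M)%N -> ev m (Lit x) x.
Proof. by move=> xM; rewrite /ev /= modn_small. Qed.

Lemma evaln_lit m x : (x < M)%N -> evaln M m (Lit x) = x.
Proof. by move=> xM; apply/evn/ev_lit. Qed.

Lemma ev_read m a e x v : ev m e x -> m a x = Int v -> ev m (Read a e) v.
Proof. by move=> h; rewrite /ev /= h. Qed.

Lemma eval_read m a e x w : ev m e x -> m a x = w -> eval M m (Read a e) = w.
Proof. by move=> h /= <-; rewrite h. Qed.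

Lemma eval_readl m a x : (x < M)%N -> eval M m (Read a (Lit x)) = m a x.
Proof. by move=> xM /=; rewrite modn_small. Qed.

Lemma ev_readl m a x v : (x < M)%N -> m a x = Int v -> ev m (Read a (Lit x)) v.
Proof. by move=> xM; apply: ev_read; apply: ev_lit. Qed.

Lemma ev_add m e1 e2 x y : ev m e1 x -> ev m e2 y -> (x + y < M)%N ->
  ev m (Op Add e1 e2) (x + y).
Proof. by rewrite /ev /= => -> -> /= h; rewrite modn_small. Qed.

Lemma ev_sub m e1 e2 x y : ev m e1 x -> ev m e2 y -> (x < M)%N ->
  ev m (Op Sub e1 e2) (x - y).
Proof.
by rewrite /ev /= => -> -> /= h; rewrite modn_small // (leq_ltn_trans _ h) ?leq_subr.
Qed.

Lemma ev_mul m e1 e2 x y : ev m e1 x -> ev m e2 y -> (x * y < M)%N ->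
  ev m (Op Mul e1 e2) (x * y).
Proof. by rewrite /ev /= => -> -> /= h; rewrite modn_small. Qed.

Lemma ev_div m e1 e2 x y : ev m e1 x -> ev m e2 y -> (x < M)%N ->
  ev m (Op Div e1 e2) (x %/ y).
Proof.
by rewrite /ev /= => -> -> /= h; rewrite modn_small // (leq_ltn_trans (leq_div _ _) h).
Qed.

Lemma ev_leq m e1 e2 x y : ev m e1 x -> ev m e2 y -> (1 < M)%N ->
  ev m (Op Leq e1 e2) (x <= y)%N.
Proof. by rewrite /ev /= => -> -> /= h; rewrite modn_small // (leq_ltn_trans (leq_b1 _) h). Qed.

Lemma ev_leq_word m e1 e2 w1 w2 : eval M m e1 = w1 -> eval M m e2 = w2 ->
  (1 < M)%N -> ev m (Op Leq e1 e2) (leq_word w1 w2).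
Proof. by rewrite /ev /= => -> -> /= h; rewrite modn_small // (leq_ltn_trans (leq_b1 _) h). Qed.

Definition emod e1 e2 := Op Sub e1 (Op Mul (Op Div e1 e2) e2).

Lemma ev_mod m e1 e2 x y : ev m e1 x -> ev m e2 y -> (x < M)%N ->
  ev m (emod e1 e2) (x %% y).
Proof.
move=> h1 h2 xM; apply: (@ev_eq _ _ _ (x - x %/ y * y)); last first.
  by rewrite {1}(divn_eq x y) addKn.
apply: ev_sub => //; apply: ev_mul => //; first exact: ev_div.
exact: leq_ltn_trans (leq_trunc_div _ _) xM.
Qed.

Definition emin e1 e2 := Op Sub e1 (Op Sub e1 e2).

Lemma ev_min m e1 e2 x y : ev m e1 x -> ev m e2 y -> (x < M)%N ->
  ev m (emin e1 e2) (minn x y).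
Proof.
move=> h1 h2 xM; apply: (@ev_eq _ _ _ (x - (x - y))); last by rewrite minnE.
by do 2?apply: ev_sub.
Qed.

(** * Updates of the memory *)

Definition upd m a x (w : word T) : store T :=
  fun b y => if (b == a) && (y == x) then w else m b y.

Lemma write_blockE m a x w : write_block m a x [:: w] = upd m a x w.
Proof.
apply: funext => b; apply: funext => y; rewrite /write_block /upd /= addn1 ltnS.
rewrite andbC [(b == a) && _]andbC -eqn_leq.
by rewrite eq_sym; case: eqP => [->|] //; rewrite subnn.
Qed.

Lemma write_block_cons m a x w ws :
  write_block m a x (w :: ws) = upd (write_block m a x.+1 ws) a x w.
Proof.
apply: funext => b; apply: funext => y; rewrite /write_block /upd /=.
case: (b == a) => //=; case: (ltngtP x y) => [xy|xy|->] /=.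
- by rewrite addSnnS; case: leqP => // _; rewrite subnS -[(y - x)%N]prednK ?subn_gt0.
- by [].
by rewrite subnn addnS ltnS leq_addr.
Qed.

Lemma write_block_nil m a x : write_block m a x [::] = m.
Proof.
apply: funext => b; apply: funext => y; rewrite /write_block /= addn0.
by rewrite leqNgt andNb andbF.
Qed.

Lemma exec_set m a x e w C : (x < M)%N -> eval M m e = w ->
  exec M (Write a (Lit x) e :: C) m = exec M C (upd m a x w).
Proof. by move=> xM ew; rewrite /= evaln_lit // ew write_blockE. Qed.

Lemma exec_write m a i e x w C : ev m i x -> eval M m e = w ->
  exec M (Write a i e :: C) m = exec M C (upd m a x w).
Proof. by move=> /evn xM ew; rewrite /= xM ew write_blockE. Qed.

End Evaluation.

(* [evs r] evaluates an expression, looking variables up with the rules [r]. *)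
Ltac evs r :=
  lazymatch goal with
  | |- ev _ _ (emod _ _) _ => eapply ev_mod; [evs r | evs r | ]
  | |- ev _ _ (emin _ _) _ => eapply ev_min; [evs r | evs r | ]
  | |- ev _ _ (Lit _) _ => apply: ev_lit
  | |- ev _ _ (Read _ (Lit _)) _ =>
      eapply ev_readl; [ | rewrite /upd /= ?r; reflexivity]
  | |- ev _ _ (Read _ _) _ =>
      eapply ev_read; [evs r | rewrite /upd /= ?r; reflexivity]
  | |- ev _ _ (Op Add _ _) _ => eapply ev_add; [evs r | evs r | ]
  | |- ev _ _ (Op Sub _ _) _ => eapply ev_sub; [evs r | evs r | ]
  | |- ev _ _ (Op Mul _ _) _ => eapply ev_mul; [evs r | evs r | ]
  | |- ev _ _ (Op Div _ _) _ => eapply ev_div; [evs r | evs r | ]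
  | |- ev _ _ (Op Leq _ _) _ => eapply ev_leq; [evs r | evs r | ]
  end.

Tactic Notation "ev_by" constr(r) := eapply ev_eq; [evs r | ].

(** * Communication primitives *)

Notation var a := (Read a (Lit 0)).
Notation asg a e := (Write a (Lit 0) e).
Notation me := (Read 0 (Lit 0)).
Notation np := (Read 0 (Lit 1)).

(* Variables are arrays used at index 0 only. *)
Notation vD := 10%N.
Notation aG := 11%N.
Notation vAcc := 12%N.
Notation vRcv := 13%N.

(** A cyclic shift to the right. [np] is added before [sh] is subtracted because subtraction
    truncates at 0. *)
Definition shift sh a off len b off' :=
  comm (emod (Op Add me sh) np) a off len
       (emod (Op Sub (Op Add me np) sh) np) b off'.

Definition doubling (body : program) : instr :=
  While (Op Leq (Op Add (var vD) (Lit 1)) np)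
    (body ++ [:: asg vD (Op Add (var vD) (var vD))]).

(* Inclusive prefix combination over the PEs of the values of [vAcc]. *)
Definition scan (op : expr -> expr -> expr) : program :=
  [:: asg vD (Lit 1);
      doubling [:: shift (var vD) vAcc (Lit 0) (Lit 1) vRcv (Lit 0);
        asg vAcc (op (var vAcc) (Op Mul (Op Leq (var vD) me) (var vRcv)))]].

(* Slot [aG] holds a flag and, if the flag is set, a payload.  A PE without
   payload obtains the one of the nearest PE that has one, among those at
   distances [d0], [2 * d0], [3 * d0]... to its left, cyclically. *)
Definition flood (d0 : expr) : program :=
  let sel j := Read aG (Op Add (Lit j) (Op Mul (Lit 2) (Op Sub (Lit 1) (var aG)))) in
  [:: asg vD d0;
      doubling [:: shift (var vD) aG (Lit 0) (Lit 2) aG (Lit 2);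
        Write aG (Lit 1) (sel 1%N); Write aG (Lit 0) (sel 0%N)]].

Definition halving (body : program) : instr :=
  While (Op Leq (Lit 2) (var vD)) (asg vD (Op Div (var vD) (Lit 2)) :: body).

Section Selection.
Variables (R : realType) (d : Order.disp_t) (T : orderType d).
Variables (p M : nat) (alpha beta : R).
Hypotheses (p0 : (0 < p)%N) (al0 : 0 <= alpha) (be0 : 0 <= beta).
Variable final : mem T p -> Prop.
Variable W : R.
Hypothesis unit_workW : bounds_work W.
Variable B : nat.
Hypotheses (pB : (p <= B)%N) (BM : (1000 * B <= M)%N).

Notation mem := (mem T p).
Notation dt := (@dt R d T p M alpha beta final).

Let W0 : 0 <= W. Proof. exact: W_ge0 unit_workW. Qed.

Lemma M_gt1000 : (1000 <= M)%N.
Proof. by apply: leq_trans BM; rewrite leq_pmulr //; apply: leq_trans pB. Qed.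
Let M1 := M_gt1000.

Lemma ltM x : (x < 1000)%N -> (x < M)%N.
Proof. by move=> x1; apply: leq_trans M1. Qed.

(* One level of a primitive: at most ten instructions, one of which
   communicates at most five words. *)
Definition level : R := 10%:R * W + alpha + 5%:R * beta.
Definition logcost : R := level *+ (up_log 2 p).+1.

Lemma level_ge0 : 0 <= level.
Proof. by rewrite /level !addr_ge0 ?mulr_ge0. Qed.

Lemma logcost_ge0 : 0 <= logcost.
Proof. by rewrite mulrn_wge0 ?level_ge0. Qed.

Lemma level_le k n : (k <= 5)%N -> (n <= 7)%N ->
  (W + (alpha + k%:R * beta)) + n%:R * W + 2%:R * W <= level.
Proof.
move=> k5 n7; have : k%:R * beta <= 5%:R * beta by rewrite ler_wpM2r // ler_nat.
have : n%:R * W <= 7%:R * W by rewrite ler_wpM2r // ler_nat.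
by rewrite /level; lra.
Qed.

Ltac costs := repeat first [done | exact: logcost_ge0 | exact: level_ge0
  | apply: addr_ge0 | apply: mulr_ge0 | apply: mulrn_wge0
  | apply: sumr_ge0 => ? _].

Lemma logcost_level : level <= logcost.
Proof. have h0 := level_ge0; by rewrite /logcost mulrS lerDl mulrn_wge0. Qed.

Lemma logcost_W : 10%:R * W <= logcost.
Proof.
have h0 := level_ge0; apply: le_trans (_ : level <= _); last by rewrite /logcost mulrS lerDl mulrn_wge0.
by have h1 := W0; have h2 := al0; have h3 := be0; rewrite /level; lra.
Qed.

Lemma loop_cost : W + (level *+ up_log 2 p + W) <= logcost.
Proof. by have h1 := W0; have h2 := al0; have h3 := be0; rewrite /logcost mulrS /level; lra. Qed.

(** * Frame conditions and loops over powers of two *)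

Definition frame (l : seq nat) (sg sg' : mem) : Prop :=
  forall i a x, a \notin l -> sg' i a x = sg i a x.

Definition env (sg : mem) : Prop :=
  (forall i, sg i 0%N 0%N = Int i) /\ (forall i, sg i 0%N 1%N = Int p).

Lemma frame_trans l l' l'' sg sg' sg'' : frame l sg sg' -> frame l' sg' sg'' ->
  all [in l''] (l ++ l') -> frame l'' sg sg''.
Proof.
rewrite all_cat => h h' /andP[/allP s /allP s'] i a x al.
by rewrite h' ?h //; apply: contra al; [apply: s | apply: s'].
Qed.

Lemma frame_cat l l' sg sg' sg'' : frame l sg sg' -> frame l' sg' sg'' ->
  frame (l ++ l') sg sg''.
Proof.
by move=> h h' i a x; rewrite mem_cat negb_or => /andP[al al']; rewrite h' ?h.
Qed.

Lemma frame_sub l l' sg sg' : frame l sg sg' -> all [in l'] l -> frame l' sg sg'.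
Proof. by move=> h /allP s i a x al; rewrite h //; apply: contra al; apply: s. Qed.

Lemma frame_upd l sg sg' a x w : frame l sg sg' -> a \in l ->
  frame l sg (fun i => upd (sg' i) a (x i) (w i)).
Proof.
move=> h al i b y bl; rewrite /upd; case: eqP => [ba|_] /=; last exact: h.
by rewrite ba al in bl.
Qed.

Definition targets (C : program) : seq nat :=
  [seq if c is Write a _ _ then a else 0%N | c <- C].

Lemma frame_exec C sg : frame (targets C) sg (fun i => exec M C (sg i)).
Proof.
move=> i a x; elim: C (sg i) => //= c C IH m; rewrite inE negb_or => /andP[ac aC].
case: c ac => // b e1 e2 ac; rewrite IH // /write_block (negPf ac) //.
Qed.

Lemma frame_block l sg sg' a x ws : frame l sg sg' -> a \in l ->
  frame l sg (fun i => write_block (sg' i) a (x i) (ws i)).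
Proof.
move=> h al i b y bl; rewrite /write_block; case: eqP => [ba|_] /=; last exact: h.
by rewrite ba al in bl.
Qed.

Lemma env_frame l sg sg' : frame l sg sg' -> 0%N \notin l -> env sg -> env sg'.
Proof. by move=> h l0 [e1 e2]; split=> i; rewrite h. Qed.

Lemma ev_me sg i : env sg -> ev M (sg i) me i.
Proof. by case=> h _; apply: ev_readl; rewrite ?h //; have := M_gt1000; lia. Qed.

Lemma ev_np sg i : env sg -> ev M (sg i) np p.
Proof. by case=> _ h; apply: ev_readl; rewrite ?h //; have := M_gt1000; lia. Qed.

Definition left_of (s : nat) (i : 'I_p) : 'I_p :=
  Ordinal (ltn_pmod (i + p - s) p0).
Definition right_of (s : nat) (i : 'I_p) : 'I_p :=
  Ordinal (ltn_pmod (i + s) p0).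

Lemma left_ofK s : (s <= p)%N -> cancel (left_of s) (right_of s).
Proof.
move=> sp i; apply: val_inj => /=; rewrite modnDml.
by rewrite -addnBA // -addnA subnK // modnDr modn_small.
Qed.

Lemma right_ofK s : (s <= p)%N -> cancel (right_of s) (left_of s).
Proof.
move=> sp i; apply: val_inj => /=.
rewrite -addnBA // modnDml -addnA subnKC // modnDr modn_small //.
Qed.

Lemma dt_writes C sg : all is_write C ->
  dt C sg (fun sg' => (forall i, sg' i = exec M C (sg i)) /\
                      frame (targets C) sg sg') ((size C)%:R * W).
Proof.
move=> wC; apply: dt_le (dt_block M alpha beta p0 final unit_workW sg wC) _ _ => // sg' ->.
by split=> //; apply: frame_exec.
Qed.

Lemma dt_shift sg sh a off len b off' s l :
  (work (shift sh a off len b off') <= unit_work)%N -> env sg ->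
  (forall i, ev M (sg i) sh s) -> (s <= p)%N ->
  (forall i, (evaln M (sg i) len <= l)%N) ->
  dt [:: shift sh a off len b off'] sg
    (fun sg' => sg' = fun j => write_block (sg j) b (evaln M (sg j) off')
       (read_block (sg (left_of s j)) a (evaln M (sg (left_of s j)) off)
                                (evaln M (sg (left_of s j)) len)))
    (W + (alpha + l%:R * beta)).
Proof.
move=> wk en shE sp ll; have M1' := M1.
apply: (dt_comm p0 al0 be0 final unit_workW (f := right_of s) (g := left_of s)) => //.
- move=> i; apply: evn; apply: ev_mod (ev_np _ en) _ => [|/=].
    by apply: ev_add (ev_me _ en) (shE i) _; have := ltn_ord i; lia.
  by have := ltn_ord i; lia.
- move=> i; apply: evn; apply: ev_mod (ev_np _ en) _; last by have := ltn_ord i; lia.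
  apply: ev_sub (shE i) _; last by have := ltn_ord i; lia.
  by apply: ev_add (ev_me _ en) (ev_np _ en) _; have := ltn_ord i; lia.
- exact: right_ofK.
exact: left_ofK.
Qed.

Lemma dt_shift_words sg sh a k b off s :
  (work (shift sh a (Lit 0) (Lit k) b (Lit off)) <= unit_work)%N -> env sg ->
  (forall i, ev M (sg i) sh s) -> (s <= p)%N -> (maxn k off < 1000)%N ->
  dt [:: shift sh a (Lit 0) (Lit k) b (Lit off)] sg
    (fun sg' => sg' = fun j => write_block (sg j) b off
       [seq sg (left_of s j) a x | x <- iota 0 k])
    (W + (alpha + k%:R * beta)).
Proof.
move=> wk en shE sp ko; have M1' := M1.
apply: dt_le (dt_shift (s := s) (l := k) wk en shE sp _) _ _ => //.
  by move=> i; rewrite evaln_lit //; lia.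
move=> _ ->; apply: funext => j; rewrite !evaln_lit //; lia.
Qed.

Lemma dt_set a e sg (w : 'I_p -> word T) :
  (work (asg a e) <= unit_work)%N -> (forall i, eval M (sg i) e = w i) ->
  dt [:: asg a e] sg (fun sg' => sg' = fun i => upd (sg i) a 0 (w i)) W.
Proof.
move=> wk ew; have M1' := M1.
apply: dt_le (dt_block M alpha beta p0 final unit_workW (C := [:: asg a e]) sg _) _ _.
- by rewrite /= wk.
- by rewrite mul1r.
move=> _ ->; apply: funext => i.
by rewrite (@exec_set _ _ _ _ _ _ _ (w i)) //; lia.
Qed.

Lemma lt_up_log d0 l : (0 < d0)%N -> (d0 * 2 ^ l < p)%N -> (l < up_log 2 p)%N.
Proof.
move=> d00 lp; rewrite -(ltn_exp2l (m := 2)) //.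
apply: leq_ltn_trans (leq_trans lp (up_logP _ _)) => //.
by rewrite leq_pmull.
Qed.

Lemma exp_lt_up_log l : (l < up_log 2 p)%N -> (2 ^ l < p)%N.
Proof. by rewrite !ltnNge; apply: contra => /(up_log_min (isT : 1 < 2)%N). Qed.

Lemma exp_up_log : (2 ^ up_log 2 p <= 2 * p)%N.
Proof.
case E: (up_log 2 p) => [|l]; first by rewrite expn0 muln_gt0.
by rewrite expnS leq_mul2l ltnW // exp_lt_up_log // E.
Qed.

Lemma const_loop_cost (c : R) L : 0 <= c -> 2%:R * W + c <= level -> (L <= up_log 2 p)%N ->
  \sum_(0 <= l < L) (2%:R * W + c) + W <= logcost.
Proof.
move=> c0 cl LL; rewrite sumr_const_nat subn0 /logcost [level *+ _]mulrSr lerD //; last first.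
  by have h1 := W0; have h2 := al0; have h3 := be0; rewrite /level; lra.
by apply: (le_trans (ler_wMn2r L cl)); apply: ler_wpMn2l => //; exact: level_ge0.
Qed.

(** The body has to ensure [J l.+1] for all memories that differ from its own at most in [vD],
    because [vD] is doubled only after it. *)
Lemma dt_doubling d0 body (J : nat -> mem -> Prop) (cb : R) sg (P : mem -> Prop) :
  (0 < d0 <= p)%N -> 0 <= cb -> cb + 2%:R * W <= level ->
  (forall l sg, J l sg -> env sg /\ forall i, sg i vD 0 = Int (d0 * 2 ^ l)%N) ->
  (forall l sg, J l sg -> (d0 * 2 ^ l < p)%N -> dt body sg (fun sg' =>
     [/\ forall i, sg' i vD 0 = Int (d0 * 2 ^ l)%N &
      forall sg'', frame [:: vD] sg' sg'' ->
      (forall i, sg'' i vD 0 = Int (d0 * 2 ^ l.+1)%N) -> J l.+1 sg'']) cb) ->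
  (forall l sg, J l sg -> (p <= d0 * 2 ^ l)%N -> P sg) ->
  J 0 sg -> dt [:: doubling body] sg P (level *+ up_log 2 p + W).
Proof.
move=> /andP[d00 d0p] cb0 cbl JD Jb JP J0; have M1' := M1.
(* The bound [2 * p] keeps [vD] below the word capacity. *)
pose J' l sg := J l sg /\ (d0 * 2 ^ l <= 2 * p)%N.
have : dt [:: doubling body] sg P
    (\sum_(0 <= l < up_log 2 p) (W + (cb + W)) + W).
  apply: (dt_while p0 unit_workW (J := J')) => //; first by move=> _; rewrite addr_ge0.
    move=> l sg1 [J1 l2p]; have [en DE] := JD _ _ J1.
    exists (d0 * 2 ^ l < p)%N.
      move=> i; have -> : evaln M (sg1 i) (Op Leq (Op Add (var vD) (Lit 1)) np) =
          (d0 * 2 ^ l + 1 <= p)%N.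
        by apply: evn; apply: ev_leq (ev_np _ en) _; [evs DE| ]; lia.
      by rewrite addn1; case: leq.
    case: ltnP => [lp|]; last exact: JP J1.
    split; first exact: lt_up_log lp.
    apply: dt_cat => //; first exact: Jb J1 lp.
    move=> sg2 [DE2 JS]; apply: dt_le (dt_set (w := fun=> Int (d0 * 2 ^ l.+1)%N) _ _) _ _ => //.
      move=> i; have := @ev_eq _ _ M (sg2 i) (Op Add (var vD) (var vD)) (d0 * 2 ^ l.+1) (d0 * 2 ^ l + d0 * 2 ^ l).
      apply; last by rewrite expnS; lia.
      by evs DE2; lia.
    move=> sg3 ->; split; last by rewrite expnS; lia.
    by apply: JS => //; apply: frame_upd.
  by split=> //; rewrite expn0; lia.
move=> h; apply: dt_le h _ _ => //; rewrite lerD2r sumr_const_nat subn0.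
by rewrite lerMn2r; apply/orP; right; apply: le_trans cbl; lra.
Qed.

(** The level counts down, and its cost may depend on it: the messages of [spread] have about the
    length [vD]. *)
Lemma dt_halving (J : nat -> mem -> Prop) (c : nat -> R) L body sg
    (P : mem -> Prop) : (forall l, 0 <= c l) -> (2 ^ L < M)%N ->
  (forall l sg, J l sg -> env sg /\ forall i, sg i vD 0 = Int (2 ^ l)%N) ->
  (forall l sg sg', J l.+1 sg -> (l < L)%N -> frame [:: vD] sg sg' ->
     (forall i, sg' i vD 0 = Int (2 ^ l)%N) -> dt body sg' (J l) (c l)) ->
  (forall sg, J 0 sg -> P sg) ->
  J L sg -> dt [:: halving body] sg P (\sum_(0 <= l < L) (2%:R * W + c l) + W).
Proof.
move=> c0 LM JD Jb JP JL; have M1' := M1.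
have : dt [:: halving body] sg P
    (\sum_(0 <= l < L) (W + (W + c (L - l.+1)%N)) + W).
  apply: (dt_while p0 unit_workW (J := fun l sg => (l <= L)%N /\ J (L - l)%N sg)) => //.
  - by move=> l; rewrite addr_ge0.
  - move=> l sg1 [lL J1]; have [en DE] := JD _ _ J1.
    have lM : (2 ^ (L - l) < M)%N by apply: leq_ltn_trans LM; rewrite leq_exp2l // leq_subr.
    exists (l < L)%N.
      move=> i; have -> : evaln M (sg1 i) (Op Leq (Lit 2) (var vD)) = (2 <= 2 ^ (L - l))%N.
        by apply: evn; ev_by DE; lia.
      by rewrite -{1}(expn1 2) leq_exp2l // subn_gt0; case: ltnP.
    case: ltnP => [lL'|Ll]; last first.
      by apply: JP; have e : (L - l = 0)%N; [lia|rewrite e in J1].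
    split=> //; apply: (dt_cat (C1 := [:: _])) => //.
      apply: (dt_set (w := fun=> Int (2 ^ (L - l.+1))%N)) => // i.
      apply: (@ev_eq _ _ _ _ _ _ (2 ^ (L - l) %/ 2)); first by evs DE; lia.
      by rewrite -(subnSK lL') expnS mulKn.
    move=> sg2 sg2E; have J1' : J (L - l.+1).+1 sg1 by rewrite subnSK.
    apply: dt_le (Jb (L - l.+1)%N sg1 sg2 J1' _ _ _) _ _ => //.
    + lia.
    + by rewrite sg2E; apply: frame_upd.
    + by move=> i; rewrite sg2E /upd.
  - by rewrite subn0.
move=> h; apply: dt_le h _ _ => //; rewrite lerD2r.
rewrite [X in _ <= X]big_nat_rev /= add0n; apply: ler_sum => l _.
by rewrite addrA mulr_natl mulr2n.
Qed.

(* Leaves in [vD] the least power of two that is at least [p]. *)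
Definition top_power : program := [:: asg vD (Lit 1); doubling [::]].

Lemma dt_top_power sg : env sg ->
  dt top_power sg (fun sg' => frame [:: vD] sg sg' /\
    exists l, [/\ (l <= up_log 2 p)%N, (p <= 2 ^ l)%N &
      forall i, sg' i vD 0 = Int (2 ^ l)%N]) logcost.
Proof.
move=> en; have M1' := M1.
pose J l sg' := [/\ forall i, sg' i vD 0 = Int (1 * 2 ^ l)%N,
  frame [:: vD] sg sg' & (l <= up_log 2 p)%N].
apply: dt_le (dt_cat (C1 := [:: _]) _ _ _) _ (fun _ => id).
- by apply: (dt_set (w := fun=> Int 1)) => // i; apply: ev_lit; lia.
- move=> _ ->; apply: (dt_doubling (d0 := 1) (J := J) (cb := 0)) => //.
  + by have h1 := W0; have h2 := al0; have h3 := be0; rewrite /level; lra.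
  + by move=> l sg1 [DE fr _]; split=> //; apply: env_frame fr _ en.
  + move=> l sg1 [DE fr _] lp; apply: dt_nil; split=> // sg2 fr2 DE2; split=> //.
      exact: frame_trans fr fr2 _.
    exact: lt_up_log lp.
  + move=> l sg1 [DE fr lL]; rewrite mul1n => pl; split=> //.
    by exists l; split=> // i; rewrite DE mul1n.
  by split=> //; apply: frame_upd.
- by rewrite addr_ge0 // mulrn_wge0 // level_ge0.
exact: loop_cost.
Qed.

(** ** Prefix combination *)

(** 0 has to be the unit of [op]: a message that has wrapped around the cyclic shift is multiplied
    by a false comparison and must then have no effect. *)
Lemma dt_scan (op : Monoid.com_law 0%N) c (v : nat -> nat) sg :
  (work (asg vAcc (c (var vAcc) (Op Mul (Op Leq (var vD) me) (var vRcv)))) <= unit_work)%N ->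
  (forall (m : store T) e1 e2 x y, ev M m e1 x -> ev M m e2 y ->
     (x < M)%N -> (op x y < M)%N -> ev M m (c e1 e2) (op x y)) ->
  (forall a b, (b <= p)%N -> (\big[op/0%N]_(a <= j < b) v j < M)%N) ->
  env sg -> (forall i : 'I_p, sg i vAcc 0 = Int (v i)) ->
  dt (scan c) sg (fun sg' =>
    (forall i : 'I_p, sg' i vAcc 0 = Int (\big[op/0%N]_(0 <= j < i.+1) v j)) /\
    frame [:: vAcc; vRcv; vD] sg sg') logcost.
Proof.
move=> wk cE vM en vE; have M1' := M1.
(* PE [i] has combined the [2 ^ l] values that end with its own; truncated subtraction clips the
   window at PE 0. *)
pose J l sg' := [/\ forall i, sg' i vD 0 = Int (1 * 2 ^ l)%N,
  frame [:: vAcc; vRcv; vD] sg sg' & forall i : 'I_p,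
  sg' i vAcc 0 = Int (\big[op/0%N]_(i.+1 - 2 ^ l <= j < i.+1) v j)].
apply: dt_le (dt_cat (C1 := [:: _]) _ _ _) _ (fun _ => id).
- by apply: (dt_set (w := fun=> Int 1)) => // i; apply: ev_lit; lia.
- move=> _ ->; apply: (dt_doubling (d0 := 1) (J := J)
     (cb := (W + (alpha + 1%:R * beta)) + 1%:R * W)) => //.
  + by rewrite !addr_ge0 // mulr_ge0.
  + exact: level_le.
  + by move=> l sg1 [DE fr _]; split=> //; apply: env_frame fr _ en.
  + move=> l sg1 [DE fr AE] lp; rewrite mul1n in lp.
    have en1 : env sg1 by apply: env_frame fr _ en.
    apply: (dt_cat (C1 := [:: _])) => //; last by rewrite mulr_ge0.
      apply: (dt_shift_words (s := 2 ^ l)) => //; last exact: ltnW.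
      by move=> i; ev_by DE; lia.
    move=> _ ->; rewrite /= mul1n; apply: dt_le (dt_set
      (w := fun i : 'I_p => Int (\big[op/0%N]_(i.+1 - 2 ^ l.+1 <= j < i.+1) v j)) _ _) _ _ => //.
      move=> i; have ip := ltn_ord i; rewrite write_block_cons write_block_nil AE.
      pose acc := \big[op/0%N]_(i.+1 - 2 ^ l <= j < i.+1) v j.
      set r := \big[_/_]_((left_of _ i).+1 - 2 ^ l <= j < _) v j.
      have accM : (acc < M)%N by apply: vM.
      have rM : (r < M)%N by apply: vM; apply: ltn_ord.
      have E : op acc ((2 ^ l <= i) * r)%N =
               \big[op/0%N]_(i.+1 - 2 ^ l.+1 <= j < i.+1) v j.
        have [li|il] := leqP (2 ^ l) i; last first.
          by rewrite mul0n Monoid.mulm1 /acc expnS; congr bigop; congr index_iota; lia.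
        have lE : left_of (2 ^ l) i = (i - 2 ^ l)%N :> nat.
          by rewrite /= -addnBAC // modnDr modn_small //; lia.
        rewrite mul1n Monoid.mulmC /r lE /acc.
        rewrite [RHS](big_cat_nat _ (n := (i.+1 - 2 ^ l)%N)) /=; rewrite ?expnS; try lia.
        by congr (op _ _); congr bigop; congr index_iota; lia.
      apply: (@ev_eq _ _ _ _ _ _ (op acc ((2 ^ l <= i) * r)%N)); last exact: E.
      apply: cE => //; last by rewrite E vM.
        by ev_by AE; [lia|].
      have rM' : ((2 ^ l <= i) * r < M)%N by case: (2 ^ l <= i)%N; rewrite ?mul1n ?mul0n; lia.
      apply: ev_mul => //; last by ev_by AE; [lia|].
      apply: ev_leq; [by ev_by DE; lia| |lia].
      by apply: ev_readl => //; [lia|rewrite /upd /=; case: en1].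
      by rewrite mul1r.
    move=> sg2 sg2E; split=> [i|sg3 fr3 DE3].
      by rewrite sg2E /upd /write_block /= DE mul1n.
    have fr2 : frame [:: vAcc; vRcv; vD] sg sg2.
      by rewrite sg2E; apply: frame_upd => //; apply: frame_block.
    split=> // [|i]; first exact: frame_trans fr2 fr3 _.
    by rewrite fr3 // sg2E.
  + move=> l sg1 [_ fr AE]; rewrite mul1n => pl; split=> // i; rewrite AE.
    by congr (Int _); congr bigop; congr index_iota; have := ltn_ord i; lia.
  split=> //; first by apply: frame_upd.
  by move=> i; rewrite /upd /= vE expn0 subSS subn0 big_nat1.
- by rewrite addr_ge0 // mulrn_wge0 // level_ge0.
exact: loop_cost.
Qed.

(** ** Flooding *)

Definition first_some (V : Type) (a b : option V) := if a is Some _ then a else b.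

(* The value found by probing [k] places, the [x]-th one being [x * d0] to the
   left of [i], cyclically. *)
Definition nearest (V : Type) (s : nat -> option V) (d0 k i : nat) : option V :=
  foldr (@first_some V) None
    [seq s ((i + x * (p - d0)) %% p)%N | x <- iota 0 k].

Lemma nearestP (V : Type) (s : nat -> option V) d0 k i x v : (x < k)%N ->
  s ((i + x * (p - d0)) %% p)%N = Some v ->
  (forall y, (y < x)%N -> s ((i + y * (p - d0)) %% p)%N = None) ->
  nearest s d0 k i = Some v.
Proof.
move=> xk sx sy; rewrite /nearest -(subnKC xk) addSnnS iotaD map_cat foldr_cat /= add0n sx /=.
have : {in iota 0 x, forall y, s ((i + y * (p - d0)) %% p)%N = None}.
  by move=> y; rewrite mem_iota => /andP[_]; apply: sy.
elim: (iota 0 x) => //= y l IH h; rewrite h ?inE ?eqxx //= IH // => z zl.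
by rewrite h // inE zl orbT.
Qed.

Lemma nearest_none (V : Type) (s : nat -> option V) d0 k i :
  (forall j, (j < p)%N -> s j = None) -> nearest s d0 k i = None.
Proof.
by move=> sN; rewrite /nearest; elim: (iota _ _) => //= x l ->; rewrite sN // ltn_pmod.
Qed.

(** One level of [flood]: after [k] probes from [i], the next [k'] ones are those of the PE that
    lies [k * d0] to the left. *)
Lemma nearestD (V : Type) (s : nat -> option V) d0 k k' i :
  nearest s d0 (k + k') i =
  first_some (nearest s d0 k i) (nearest s d0 k' ((i + k * (p - d0)) %% p)).
Proof.
rewrite /nearest iotaD map_cat foldr_cat add0n -[k in iota k k']addn0 iotaDl -map_comp.
rewrite (eq_map (g := fun x => s (((i + k * (p - d0)) %% p + x * (p - d0)) %% p)%N)).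
  by elim: (iota 0 k) => //= x l ->; case: (s _).
by move=> x /=; rewrite modnDml mulnDl addnA.
Qed.

Lemma pos_left d0 t y : (t < p)%N -> (d0 <= p)%N -> (y * d0 <= t)%N ->
  ((t + y * (p - d0)) %% p = t - y * d0)%N.
Proof.
move=> tp dp yt; rewrite mulnBr.
have yp : (y * d0 <= y * p)%N by rewrite leq_mul2l dp orbT.
have -> : (t + (y * p - y * d0) = y * p + (t - y * d0))%N by lia.
by rewrite modnMDl modn_small // (leq_ltn_trans (leq_subr _ _)).
Qed.

Definition slots (sg : mem) (s : nat -> option (word T)) : Prop :=
  forall i : 'I_p, sg i aG 0 = Int (s i) /\
  forall w, s i = Some w -> sg i aG 1 = w.

(** Of the number [k] of probes only [p <= d0 * k] is retained: together they go all the way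
    round. *)
Lemma dt_flood d0 e (s : nat -> option (word T)) sg : (0 < d0 <= p)%N ->
  (work (asg vD e) <= unit_work)%N -> env sg ->
  (forall i, ev M (sg i) e d0) -> slots sg s ->
  dt (flood e) sg (fun sg' => frame [:: aG; vD] sg sg' /\
     exists2 k, (p <= d0 * k)%N & slots sg' (nearest s d0 k)) logcost.
Proof.
move=> d0p wk en eE sE; have M1' := M1.
pose J l sg' := [/\ forall i, sg' i vD 0 = Int (d0 * 2 ^ l)%N,
  frame [:: aG; vD] sg sg' & slots sg' (nearest s d0 (2 ^ l))].
apply: dt_le (dt_cat (C1 := [:: _]) _ _ _) _ (fun _ => id).
- by apply: (dt_set (w := fun=> Int d0)).
- move=> _ ->; apply: (dt_doubling (d0 := d0) (J := J)
     (cb := (W + (alpha + 2%:R * beta)) + 2%:R * W)) => //.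
  + by rewrite !addr_ge0 // mulr_ge0.
  + exact: level_le.
  + by move=> l sg1 [DE fr _]; split=> //; apply: env_frame fr _ en.
  + move=> l sg1 [DE fr sE1] lp.
    have en1 : env sg1 by apply: env_frame fr _ en.
    apply: (dt_cat (C1 := [:: _])) => //; last by rewrite mulr_ge0.
      apply: (dt_shift_words (s := d0 * 2 ^ l)) => //; last exact: ltnW.
      by move=> i; ev_by DE; lia.
    move=> _ ->; apply: dt_le (dt_block M alpha beta p0 final unit_workW _ _) _ _ => //.
    move=> sg2 sg2E.
    have E2 (i : 'I_p) : exists m : store T,
        [/\ forall a x, a \notin [:: aG; vD] -> m a x = sg1 i a x,
            m vD 0 = Int (d0 * 2 ^ l)%N,
            m aG 0 = Int (nearest s d0 (2 ^ l.+1) i),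
            forall w, nearest s d0 (2 ^ l.+1) i = Some w -> m aG 1 = w &
            sg2 i = m].
      have [si0 si1] := sE1 i; have [sl0 sl1] := sE1 (left_of (d0 * 2 ^ l) i).
      pose il := left_of (d0 * 2 ^ l) i.
      pose m := upd (upd (sg1 i) aG 3 (sg1 il aG 1%N)) aG 2 (sg1 il aG 0%N).
      have mE : write_block (sg1 i) aG 2 [seq sg1 il aG x | x <- iota 0 2] = m.
        by rewrite /= !write_block_cons write_block_nil.
      rewrite sg2E mE.
      have m0 : m aG 0 = Int (nearest s d0 (2 ^ l) i) by rewrite /m /upd /= si0.
      have m1 : m aG 1 = sg1 i aG 1 by [].
      have m2 : m aG 2 = Int (nearest s d0 (2 ^ l) (left_of (d0 * 2 ^ l) i)).
        by rewrite /m /upd /= sl0.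
      have m3 : m aG 3 = sg1 (left_of (d0 * 2 ^ l) i) aG 1 by [].
      have nE : nearest s d0 (2 ^ l.+1) i = first_some (nearest s d0 (2 ^ l) i)
           (nearest s d0 (2 ^ l) (left_of (d0 * 2 ^ l) i)).
        rewrite expnS mul2n -addnn nearestD; congr (first_some _ (nearest _ _ _ _)) => /=.
        have -> : (i + 2 ^ l * (p - d0) = i + p - d0 * 2 ^ l + (2 ^ l).-1 * p)%N.
          have l1 : (0 < 2 ^ l)%N by rewrite expn_gt0.
          move: (2 ^ l)%N l1 lp => c c0 cp.
          have cE : (c * p = p + c.-1 * p)%N by rewrite -{1}(prednK c0) mulSn.
          by rewrite mulnBr [(c * d0)%N]mulnC cE; move: (c.-1 * p)%N (d0 * c)%N cp => x y; lia.
        by rewrite addnC modnMDl.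
      pose n0 := nearest s d0 (2 ^ l) i.
      pose nl := nearest s d0 (2 ^ l) (left_of (d0 * 2 ^ l) i).
      pose sel : nat := (2 * (1 - nat_of_bool n0))%N.
      have msel j : m aG (j + sel)%N = if n0 then m aG j else m aG j.+2.
        by rewrite /sel; case: (n0) => [?|] /=; rewrite ?addn0 ?addn2.
      exists (upd (upd m aG 1 (m aG (1 + sel)%N)) aG 0 (m aG (0 + sel)%N)).
      split.
      - move=> a x al; rewrite /upd /m /upd.
        by move: al; rewrite !inE negb_or => /andP[/negPf -> /negPf _].
      - by rewrite /upd /m /= /upd /= DE.
      - rewrite /upd /= msel nE /first_some -/n0 -/nl m0 m2 -/n0 -/nl.
        by case: (n0).
      - move=> w; rewrite nE -/n0 -/nl /upd /= msel m1 m3 /first_some.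
        have := si1 w; have := sl1 w; rewrite -/n0 -/nl.
        by case: (n0) => //= u; case: (nl).
      have selE (m' : store T) : m' aG 0 = Int n0 -> ev M m' (Op Mul (Lit 2) (Op Sub (Lit 1) (var aG))) sel.
        by move=> h; rewrite /sel; ev_by h; lia.
      (* The payload is written before the flag, since both selections depend on the old flag. *)
      rewrite (@exec_write _ _ _ _ _ _ _ 1 (m aG (1 + sel)%N)); first last.
      - by apply: (@eval_read _ _ _ _ _ _ (1 + sel)) => //; apply: ev_add (selE m m0) _; [apply: ev_lit|rewrite /sel]; lia.
      - by apply: ev_lit; lia.
      rewrite (@exec_write _ _ _ _ _ _ _ 0 (m aG (0 + sel)%N)) //; first last.
      - apply: (@eval_read _ _ _ _ _ _ (0 + sel)).
          apply: ev_add (selE _ _) _; first by apply: ev_lit; lia.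
            by rewrite /upd /= m0.
          have : (sel <= 2)%N by rewrite /sel; case: (n0).
          by lia.
        by rewrite /upd /= /sel; case: (n0).
      by apply: ev_lit; lia.
    split=> [i|sg3 fr3 DE3]; first by have [m [_ h _ _ ->]] := E2 i.
    split=> //.
    + refine (frame_trans (frame_trans (l'' := [:: aG; vD]) fr (_ : frame [:: aG; vD] _ sg2) _) fr3 _) => //.
      by move=> i a x ax; have [m [h _ _ _ ->]] := E2 i; apply: h.
    move=> i; rewrite !fr3 //; have [m [_ _ h1 h2 ->]] := E2 i.
    by split.
  + by move=> l sg1 [_ fr sE1] pl; split=> //; exists (2 ^ l)%N.
  split=> [i||]; [by rewrite /upd /= muln1|exact: frame_upd|].
  move=> i; rewrite /upd /=; have -> : nearest s d0 (2 ^ 0) i = s i; last exact: sE.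
  by rewrite expn0 /nearest /= mul0n addn0 modn_small //; case: (s i).
- by rewrite addr_ge0 // mulrn_wge0 // level_ge0.
exact: loop_cost.
Qed.

(** * Monotone routing *)

Notation aH := 14%N.
Notation vC1 := 15%N.
Notation vC2 := 16%N.

Definition bit e := emod (Op Div e (var vD)) (Lit 2).

(* Slot [aH] holds a flag, a displacement and two more words.  A token moves by
   [sh] if the bit of its displacement of weight [vD] is set. *)
Definition route_step sh : program :=
  let sel j := Read aH (Op Add (Lit j) (Op Mul (Lit 4) (var vC2))) in
  [:: shift sh aH (Lit 0) (Lit 4) aH (Lit 4);
      asg vC2 (Op Mul (Read aH (Lit 4)) (bit (Read aH (Lit 5))));
      asg vC1 (Op Mul (var aH) (Op Sub (Lit 1) (bit (Read aH (Lit 1)))));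
      Write aH (Lit 1) (sel 1%N); Write aH (Lit 2) (sel 2%N);
      Write aH (Lit 3) (sel 3%N); asg aH (Op Add (var vC1) (var vC2))].

Definition route_left : program :=
  [:: asg vD (Lit 1); doubling (route_step (Op Sub np (var vD)))].

Definition route_right : program :=
  top_power ++ [:: halving (route_step (var vD))].

Section Routing.
Variable X : pred 'I_p.

(** The token of PE [i] is at PE [f i] and carries its displacement [dsp i] and two words. Where
    there is no token only the flag is specified. *)
Definition tokens (sg : mem) (f dsp a b : 'I_p -> nat) : Prop :=
  forall t : 'I_p,
  (forall i, X i -> f i = t -> [/\ sg t aH 0%N = Int 1, sg t aH 1%N = Int (dsp i),
     sg t aH 2%N = Int (a i) & sg t aH 3%N = Int (b i)]) /\
  ((forall i, X i -> f i <> t) -> sg t aH 0%N = Int 0).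

(** The other factor may be anything, such as the bit of an unspecified displacement behind a flag
    0. *)
Lemma ev_mul0 (m : store T) e1 e2 : ev M m e1 0 -> ev M m (Op Mul e1 e2) 0.
Proof. by rewrite /ev /= => -> /=; rewrite mul0n mod0n. Qed.

Definition bitn x D : nat := ((x %/ D) %% 2)%N.

Lemma bitn_le1 x D : (bitn x D <= 1)%N.
Proof. by rewrite /bitn -ltnS ltn_mod. Qed.

Lemma ev_bit (m : store T) e x D : m vD 0%N = Int D -> ev M m e x -> (x < M)%N ->
  ev M m (bit e) (bitn x D).
Proof.
move=> DE ex xM; apply: ev_mod; last exact: leq_ltn_trans (leq_div _ _) xM.
  by apply: ev_div => //; ev_by DE; lia.
by apply: ev_lit; lia.
Qed.

Lemma dt_route_step sh s D (f dsp a b : 'I_p -> nat) sg :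
  (work (shift sh aH (Lit 0) (Lit 4) aH (Lit 4)) <= unit_work)%N ->
  env sg -> (forall i, ev M (sg i) sh s) -> (s <= p)%N ->
  (forall i, sg i vD 0%N = Int D) ->
  tokens sg f dsp a b -> (forall i, X i -> (dsp i < M)%N /\ (f i < p)%N) ->
  let f' i := ((f i + bitn (dsp i) D * s) %% p)%N in
  {in X &, injective f} -> {in X &, injective f'} ->
  dt (route_step sh) sg (fun sg' => frame [:: aH; vC1; vC2] sg sg' /\
    tokens sg' f' dsp a b) (W + (alpha + 4%:R * beta) + 6%:R * W).
Proof.
move=> wk en she sp DE tk fp f' finj f'inj.
apply: (dt_cat (C1 := [:: _])); last by rewrite mulr_ge0.
  exact: (dt_shift_words wk en she sp).
move=> sg1 sg1E.
apply: dt_le (dt_block M alpha beta p0 final unit_workW _ _) _ _ => // sg2 sg2E.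
suff h (t : 'I_p) : exists m : store T, [/\ sg2 t = m,
    forall a x, a \notin [:: aH; vC1; vC2] -> m a x = sg t a x &
    (forall i, X i -> f' i = t -> [/\ m aH 0%N = Int 1, m aH 1%N = Int (dsp i),
       m aH 2%N = Int (a i) & m aH 3%N = Int (b i)]) /\
    ((forall i, X i -> f' i <> t) -> m aH 0%N = Int 0)].
  split=> [i c x cl|t].
    by have [m [-> + _]] := h i; apply.
  by have [m [-> _]] := h t.
pose u := left_of s t.
have f'u i : X i -> (f' i == t :> nat) = if bitn (dsp i) D == 1%N then f i == u
                                  else f i == t.
  move=> Xi; have [_ fi] := fp i Xi; rewrite /f'.
  have := bitn_le1 (dsp i) D; case: (bitn _ _) => [|[|//]] _ /=.
    by rewrite mul0n addn0 modn_small.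
  rewrite mul1n; pose i' := Ordinal fi; apply/eqP/eqP => e.
    have tE : right_of s i' = t by apply: val_inj.
    by have := right_ofK sp i'; rewrite tE => /(congr1 val) /= <-.
  by rewrite e; exact: (congr1 val (left_ofK sp t)).
pose m0 : store T := upd (upd (upd (upd (sg t) aH 7 (sg u aH 3)) aH 6 (sg u aH 2))
   aH 5 (sg u aH 1)) aH 4 (sg u aH 0).
have m0E : sg1 t = m0.
  by rewrite sg1E /= !write_block_cons write_block_nil.
have m0D : m0 vD 0%N = Int D by rewrite /m0 /upd /= DE.
have m00 : m0 aH 0%N = sg t aH 0%N by [].
have m01 : m0 aH 1%N = sg t aH 1%N by [].
have m04 : m0 aH 4%N = sg u aH 0%N by [].
have m05 : m0 aH 5%N = sg u aH 1%N by [].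
have [tkt tktN] := tk t; have [tku tkuN] := tk u.
(* [c2]: a token arrives; [c1]: a token stays *)
pose c2 := [exists i, [&& X i, f i == u & bitn (dsp i) D == 1%N]].
pose c1 := [exists i, [&& X i, f i == t & bitn (dsp i) D == 0%N]].
have c2E : ev M m0 (Op Mul (Read aH (Lit 4)) (bit (Read aH (Lit 5)))) c2.
  have [/existsP[i /andP[Xi fi]]|nx] := boolP [exists i, X i && (f i == u)].
    have [h0 h1 _ _] := tku i Xi (eqP fi).
    have -> : c2 = (bitn (dsp i) D == 1%N).
      apply/existsP/idP => [[j /and3P[Xj fj]]|bi]; last by exists i; rewrite Xi fi.
      by rewrite (finj i j) // (eqP fi) (eqP fj).
    apply: (@ev_eq _ _ _ _ _ _ (1 * bitn (dsp i) D)); last first.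
      by have := bitn_le1 (dsp i) D; case: (bitn _ _) => [|[|]].
    apply: ev_mul; [by ev_by (m04, h0) => //; apply: ltM| |].
      by apply: ev_bit => //; [ev_by (m05, h1) => //; apply: ltM|have [] := fp i Xi].
    by rewrite mul1n (leq_ltn_trans (bitn_le1 _ _)) // ltM.
  have -> : c2 = false.
    apply/existsP => -[i /and3P[Xi fi _]].
    by move/existsP: nx; apply; exists i; rewrite Xi.
  apply: ev_mul0; apply: ev_readl; [exact: ltM|rewrite m04; apply: tkuN].
  by move=> i Xi fi; move/existsP: nx; apply; exists i; rewrite Xi fi /=.
have c1E : ev M m0 (Op Mul (var aH) (Op Sub (Lit 1) (bit (Read aH (Lit 1))))) c1.
  have [/existsP[i /andP[Xi fi]]|nx] := boolP [exists i, X i && (f i == t)].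
    have [h0 h1 _ _] := tkt i Xi (eqP fi).
    have -> : c1 = (bitn (dsp i) D == 0%N).
      apply/existsP/idP => [[j /and3P[Xj fj]]|bi]; last by exists i; rewrite Xi fi.
      by rewrite (finj i j) // (eqP fi) (eqP fj).
    apply: (@ev_eq _ _ _ _ _ _ (1 * (1 - bitn (dsp i) D))); last first.
      by have := bitn_le1 (dsp i) D; case: (bitn _ _) => [|[|]].
    apply: ev_mul; [by ev_by (m00, h0) => //; apply: ltM| |].
      apply: ev_sub; [by apply/ev_lit/ltM| |exact: ltM].
      by apply: ev_bit => //; [ev_by (m01, h1) => //; apply: ltM|have [] := fp i Xi].
    by rewrite mul1n (leq_ltn_trans (leq_subr _ _)) // ltM.
  have -> : c1 = false.
    apply/existsP => -[i /and3P[Xi fi _]].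
    by move/existsP: nx; apply; exists i; rewrite Xi.
  apply: ev_mul0; apply: ev_readl; [exact: ltM|rewrite m00; apply: tktN].
  by move=> i Xi fi; move/existsP: nx; apply; exists i; rewrite Xi fi /=.
(* A token that stays and one that arrives would get the same new position, against the injectivity
   of [f']. *)
have Nc12 : ~~ (c1 && c2).
  apply/negP => /andP[/existsP[i /and3P[Xi fi bi]] /existsP[j /and3P[Xj fj bj]]].
  have ti : f' i == t :> nat by rewrite f'u // (eqP bi).
  have tj : f' j == t :> nat by rewrite f'u // bj.
  by have ij := f'inj i j Xi Xj (etrans (eqP ti) (esym (eqP tj))); move: bi; rewrite ij (eqP bj).
pose sel j : word T := m0 aH (j + 4 * c2)%N.
pose m1 := upd (upd (upd (upd (upd (upd m0 vC2 0 (Int c2)) vC1 0 (Int c1)) aH 1 (sel 1%N))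
   aH 2 (sel 2%N)) aH 3 (sel 3%N)) aH 0 (Int (c1 + c2)).
have m1E : sg2 t = m1.
  have c2M : (c2 <= 1)%N by case: (c2).
  have c1M : (c1 <= 1)%N by case: (c1).
  have evsel (m : store T) j : m vC2 0%N = Int c2 -> (j <= 3)%N ->
      ev M m (Op Add (Lit j) (Op Mul (Lit 4) (var vC2))) (j + 4 * c2).
    move=> h j3; have j4 : (j + 4 * c2 <= 7)%N by case: (c2) {c2M Nc12 c2E h} => /=; lia.
    by ev_by h => //; apply: ltM; clear -j3 j4 c2M; lia.
  rewrite sg2E m0E.
  rewrite (exec_set _ (w := Int c2)); [|exact: ltM|exact: c2E].
  rewrite (exec_set _ (w := Int c1)); [|exact: ltM|exact: c1E].
  have rd (m : store T) j : m vC2 0%N = Int c2 -> (j <= 3)%N ->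
      eval M m (Read aH (Op Add (Lit j) (Op Mul (Lit 4) (var vC2)))) =
      m aH (j + 4 * c2)%N.
    by move=> h j3; apply: eval_read (evsel _ _ h j3) _.
  rewrite (exec_set _ (w := sel 1%N)); [|exact: ltM|
    by rewrite rd // /sel /upd /=; case: (c2)].
  rewrite (exec_set _ (w := sel 2%N)); [|exact: ltM|
    by rewrite rd // /sel /upd /=; case: (c2)].
  rewrite (exec_set _ (w := sel 3%N)); [|exact: ltM|
    by rewrite rd // /sel /upd /=; case: (c2)].
  rewrite (exec_set _ (w := Int (c1 + c2))) //; [exact: ltM|].
  by apply: ev_add; [ev_by m0D => //; exact: ltM..|apply: ltM; clear -c1M c2M; lia].
exists m1; split=> // [a' x al|].
  by move: al; rewrite !inE !negb_or /m1 /m0 /upd => /and3P[/negPf -> /negPf -> /negPf ->].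
have mH j : (0 < j <= 3)%N -> m1 aH j = sel j.
  by case: j => [|[|[|[|j]]]].
have m10 : m1 aH 0%N = Int (c1 + c2) by [].
split=> [i Xi /eqP|noi].
  rewrite f'u //; case: eqP => [b1 fiu|b1 fit].
    have c2T : c2 by apply/existsP; exists i; rewrite Xi fiu b1 eqxx.
    have c1F : c1 = false by move: Nc12; rewrite c2T andbT => /negPf.
    have [h0 h1 h2 h3] := tku i Xi (eqP fiu).
    by split; [rewrite m10 c1F c2T|rewrite mH // /sel c2T..].
  have b0 : bitn (dsp i) D == 0%N.
    by have := bitn_le1 (dsp i) D; case: (bitn _ _) b1 => [|[|]].
  have c1T : c1 by apply/existsP; exists i; rewrite Xi fit b0.
  have c2F : c2 = false by move: Nc12; rewrite c1T => /negPf.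
  have [h0 h1 h2 h3] := tkt i Xi (eqP fit).
  by split; [rewrite m10 c1T c2F|rewrite mH // /sel c2F..].
rewrite m10; have -> : c1 = false.
  apply/existsP => -[i /and3P[Xi fi bi]]; apply: (noi i Xi); apply/eqP.
  by rewrite f'u // (eqP bi).
have -> : c2 = false.
  apply/existsP => -[i /and3P[Xi fi bi]]; apply: (noi i Xi); apply/eqP.
  by rewrite f'u // bi.
by [].
Qed.

(* After the bits of weight less than [2 ^ l] have been treated. *)
Definition pos (low dsp : 'I_p -> nat) l (i : 'I_p) : nat :=
  (low i + 2 ^ l * (dsp i %/ 2 ^ l))%N.

Lemma posS low dsp l i :
  pos low dsp l i = (pos low dsp l.+1 i + bitn (dsp i) (2 ^ l) * 2 ^ l)%N.
Proof.
rewrite /pos /bitn -addnA; congr addn.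
rewrite {1}(divn_eq (dsp i %/ 2 ^ l) 2) -divnMA mulnDr -expnSr.
by congr addn; rewrite [RHS]mulnC ?[(_ * 2 ^ l)%N]mulnC // expnSr [(_ * 2)%N]mulnC mulnA mulnC.
Qed.

Variables (low dsp : 'I_p -> nat).
Hypothesis low_dsp : forall i, X i -> (low i + dsp i < p)%N.
Hypothesis mono : forall i j : 'I_p, X i -> X j -> (i < j)%N ->
  (low i < low j)%N /\ (dsp i <= dsp j)%N.

(** The reason for routing monotonically: [low] is strictly increasing, and displacements with their
    low bits cut off are still nondecreasing, so tokens never collide on the way. *)
Lemma pos_inj l : {in X &, injective (pos low dsp l)}.
Proof.
have lt (i j : 'I_p) : X i -> X j -> (i < j)%N -> (pos low dsp l i < pos low dsp l j)%N.
  move=> Xi Xj ij; have [lij dij] := mono Xi Xj ij.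
  by rewrite /pos -addSn leq_add // leq_mul // leq_div2r.
move=> i j Xi Xj e; apply: val_inj; case: (ltngtP i j) => // ij.
  by have := lt _ _ Xi Xj ij; rewrite e ltnn.
by have := lt _ _ Xj Xi ij; rewrite e ltnn.
Qed.

Lemma pos_lt l i : X i -> (pos low dsp l i < p)%N.
Proof.
move=> Xi; apply: leq_ltn_trans (low_dsp Xi); rewrite /pos leq_add2l.
by rewrite mulnC leq_trunc_div.
Qed.

Lemma pos_top l i : X i -> (p <= 2 ^ l)%N -> pos low dsp l i = low i.
Proof.
move=> Xi pl; rewrite /pos divn_small ?muln0 ?addn0 //.
by apply: leq_trans pl; have := low_dsp Xi; lia.
Qed.

Lemma pos0 i : pos low dsp 0 i = (low i + dsp i)%N.
Proof. by rewrite /pos expn0 mul1n divn1. Qed.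

Lemma dt_route_left a b sg : env sg ->
  tokens sg (fun i => (low i + dsp i)%N) dsp a b ->
  dt route_left sg (fun sg' => frame [:: aH; vC1; vC2; vD] sg sg' /\
    tokens sg' low dsp a b) logcost.
Proof.
move=> en tk.
pose J l sg' := [/\ forall i, sg' i vD 0%N = Int (1 * 2 ^ l)%N,
  frame [:: aH; vC1; vC2; vD] sg sg' & tokens sg' (pos low dsp l) dsp a b].
apply: dt_le (dt_cat (C1 := [:: _]) _ _ _) _ (fun _ => id).
- by apply: (dt_set (w := fun=> Int 1)) => // i; apply: ev_lit; lia.
- move=> _ ->; apply: (dt_doubling (d0 := 1) (J := J)
     (cb := (W + (alpha + 4%:R * beta)) + 6%:R * W)) => //.
  + by rewrite !addr_ge0 // mulr_ge0.
  + by apply: level_le => //.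
  + by move=> l sg1 [DE fr _]; split=> //; apply: env_frame fr _ en.
  + move=> l sg1 [DE fr tk1] lp; rewrite mul1n in lp.
    have en1 : env sg1 by apply: env_frame fr _ en.
    have f'E i : X i -> ((pos low dsp l i + bitn (dsp i) (2 ^ l) * (p - 2 ^ l)) %% p)%N =
        pos low dsp l.+1 i.
      move=> Xi; rewrite posS; have := pos_lt l.+1 Xi.
      have := bitn_le1 (dsp i) (2 ^ l); case: (bitn _ _) => [|[|//]] _ lt.
        by rewrite !mul0n !addn0 modn_small.
      rewrite !mul1n -addnA subnKC 1?ltnW //.
      by rewrite modnDr modn_small.
    apply: dt_le (dt_route_step (s := p - 2 ^ l) (D := 2 ^ l) _ en1 _ _ _ tk1 _ _ _) _ _ => //.
    + move=> i; apply: (ev_sub (ev_np _ en1)); last by move: BM pB; lia.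
      by ev_by DE; lia.
    + exact: leq_subr.
    + by move=> i; rewrite DE mul1n.
    + by move=> i Xi; split; [have := low_dsp Xi; move: BM pB; lia|exact: pos_lt].
    + exact: pos_inj.
    + by move=> i j Xi Xj; rewrite !f'E //; apply: pos_inj.
    move=> sg2 [fr2 tk2]; split=> [i|sg3 fr3 DE3]; first by rewrite fr2 // DE mul1n.
    split=> //; first by apply: (frame_sub (frame_cat (frame_cat fr fr2) fr3)).
    move=> t; rewrite !fr3 //; have [h1 h2] := tk2 t; split=> [i Xi|noi].
      by rewrite -f'E //; apply: h1.
    by apply: h2 => i Xi; rewrite f'E //; apply: noi.
  + move=> l sg1 [_ fr tk1]; rewrite mul1n => pl; split=> // t; have [h1 h2] := tk1 t.
    split=> [i Xi|noi]; first by rewrite -(pos_top Xi pl); apply: h1.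
    by apply: h2 => i Xi; rewrite (pos_top Xi pl); apply: noi.
  split=> // [|t]; first exact: frame_upd.
  have [h1 h2] := tk t; rewrite /upd /=; split=> [i Xi|noi]; first by rewrite pos0; apply: h1.
  by apply: h2 => i Xi; rewrite -pos0; apply: noi.
- by rewrite addr_ge0 // mulrn_wge0 // level_ge0.
exact: loop_cost.
Qed.

(** Runs through the positions [pos] in the order opposite to [dt_route_left], from the highest bit
    down. Only this order visits the collision-free positions, so a power of two that is at least
    [p] has to be found beforehand. *)
Lemma dt_route_right a b sg : env sg -> tokens sg low dsp a b ->
  dt route_right sg (fun sg' => frame [:: aH; vC1; vC2; vD] sg sg' /\
    tokens sg' (fun i => (low i + dsp i)%N) dsp a b) (logcost *+ 2).
Proof.
move=> en tk; rewrite mulr2n /route_right; apply: (dt_cat (dt_top_power en)) => //; last exact: logcost_ge0.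
move=> sg1 [fr1 [L [LL pL DE1]]].
have L2p : (2 ^ L <= 2 * p)%N.
  by apply: leq_trans exp_up_log; rewrite leq_exp2l.
pose J l sg' := [/\ forall i, sg' i vD 0%N = Int (2 ^ l)%N,
  frame [:: aH; vC1; vC2; vD] sg sg' & tokens sg' (pos low dsp l) dsp a b].
pose c := (W + (alpha + 4%:R * beta)) + 6%:R * W.
have c0 : 0 <= c by rewrite !addr_ge0 // mulr_ge0.
apply: dt_le (dt_halving (J := J) (c := fun=> c) (L := L) _ _ _ _ _ _) _ (fun _ => id) => //.
- by clear -L2p BM pB p0; lia.
- by move=> l sg2 [DE fr _]; split=> //; apply: env_frame fr _ en.
- move=> l sg2 sg2' [DE2 fr2 tk2] lL fr2' DE2'.
  have fr : frame [:: aH; vC1; vC2; vD] sg sg2' by apply: frame_trans fr2 fr2' _.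
  have en2 : env sg2' by apply: env_frame fr _ en.
  have f'E i : X i -> ((pos low dsp l.+1 i + bitn (dsp i) (2 ^ l) * (2 ^ l)) %% p)%N =
        pos low dsp l i.
    by move=> Xi; rewrite -posS modn_small // pos_lt.
  have tk2' : tokens sg2' (pos low dsp l.+1) dsp a b.
    by move=> t; rewrite !fr2' //; apply: tk2.
  apply: dt_le (dt_route_step (s := 2 ^ l) (D := 2 ^ l) _ en2 _ _ _ tk2' _ _ _) _ _ => //.
  + by move=> i; ev_by DE2' => //; apply: ltM.
  + by apply/ltnW/exp_lt_up_log/(leq_trans lL).
  + by move=> i Xi; split; [have := low_dsp Xi; move: BM pB; lia|exact: pos_lt].
  + exact: pos_inj.
  + by move=> i j Xi Xj; rewrite !f'E //; apply: pos_inj.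
  move=> sg3 [fr3 tk3]; split=> [i||t]; first by rewrite fr3.
    by apply: frame_trans fr fr3 _.
  have [h1 h2] := tk3 t; split=> [i Xi|noi]; first by rewrite -f'E //; apply: h1.
  by apply: h2 => i Xi; rewrite f'E //; apply: noi.
- move=> sg2 [_ fr tk2]; split=> // t; have [h1 h2] := tk2 t.
  split=> [i Xi|noi]; first by rewrite -pos0; apply: h1.
  by apply: h2 => i Xi; rewrite pos0; apply: noi.
- split=> // [|t]; first exact: frame_sub fr1 _.
  have [h1 h2] := tk t; rewrite !fr1 //; split=> [i Xi|noi].
    by rewrite (pos_top Xi pL); apply: h1.
  by apply: h2 => i Xi; rewrite -(pos_top Xi pL); apply: noi.
apply: const_loop_cost => //; rewrite addrC; exact: level_le.
Qed.

End Routing.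

(** * Spreading blocks of items *)

Notation aB := 17%N.
Notation vSC := 18%N.
Notation vA := 19%N.
Notation aQ := 20%N.
Notation vL := 21%N.

Definition nonempty := Op Leq (Lit 1) (var vSC).

(** A token should travel from PE [i] to the PE [A i] where the block of [i] is to begin, which may
    lie on either side of [i]. The detour over the number of nonempty PEs before [i] makes both legs
    monotone: the leg to the left is the number of empty PEs before [i], the leg to the right the
    number of items before [i] beyond the first ones of their blocks. *)
Definition route_tokens : program :=
  [:: asg vAcc nonempty] ++ scan (Op Add) ++
  [:: asg aH nonempty;
      Write aH (Lit 1) (Op Sub me (Op Sub (var vAcc) nonempty));
      Write aH (Lit 2) me;
      Write aH (Lit 3) (Op Sub (var vA) (Op Sub (var vAcc) nonempty))] ++
  route_left ++ [:: Write aH (Lit 1) (Read aH (Lit 3))] ++ route_right.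

Section Spreading.
Variable m : nat -> nat.

Definition cum (F : nat -> nat) i : nat := (\sum_(0 <= j < i) F j)%N.

Lemma cumS F i : cum F i.+1 = (cum F i + F i)%N.
Proof. by rewrite /cum big_nat_recr. Qed.

Lemma cum_le F i j : (i <= j)%N -> (cum F i <= cum F j)%N.
Proof. by move=> ij; rewrite /cum [X in (_ <= X)%N](big_cat_nat _ (n := i)) //= leq_addr. Qed.

Lemma cum_lt F i j : (i < j)%N -> (0 < F i)%N -> (cum F i < cum F j)%N.
Proof. by move=> ij Fi; apply: leq_trans (cum_le F ij); rewrite cumS -addn1 leq_add2l. Qed.

Lemma cumD F G i : (cum F i + cum G i)%N = cum (fun j => (F j + G j)%N) i.
Proof. by rewrite /cum big_split. Qed.

Lemma eq_cum F G i : F =1 G -> cum F i = cum G i.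
Proof. by move=> FG; apply: eq_bigr. Qed.

Definition occ j : nat := (0 < m j)%N.
Definition vac j : nat := (m j == 0)%N.
Definition exc j : nat := (m j).-1.

Lemma occ_vac i : (cum occ i + cum vac i)%N = i.
Proof.
rewrite cumD (eq_cum (G := fun=> 1%N)) => [|j]; last by rewrite /occ /vac; case: (m j).
by rewrite /cum sum_nat_const_nat muln1 subn0.
Qed.

Lemma occ_exc i : (cum occ i + cum exc i)%N = cum m i.
Proof. by rewrite cumD; apply: eq_cum => j; rewrite /occ /exc; case: (m j). Qed.

Hypothesis total : (cum m p <= p)%N.

Notation A := (cum m).
Definition owners : pred 'I_p := fun i => (0 < m i)%N.

Lemma cum_ltp (i : 'I_p) : owners i -> (A i < p)%N.
Proof.
move=> mi; apply: leq_trans total; apply: leq_trans (cum_le _ (ltn_ord i)).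
by rewrite cumS -addn1 leq_add2l.
Qed.

Lemma dt_route_tokens sg : env sg ->
  (forall i : 'I_p, sg i vSC 0%N = Int (m i)) ->
  (forall i : 'I_p, sg i vA 0%N = Int (A i)) ->
  dt route_tokens sg (fun sg' =>
    frame [:: vAcc; vRcv; vD; aH; vC1; vC2] sg sg' /\ forall t : 'I_p,
     (forall i : 'I_p, owners i -> A i = t ->
        sg' t aH 0%N = Int 1 /\ sg' t aH 2%N = Int i) /\
     ((forall i : 'I_p, owners i -> A i <> t) -> sg' t aH 0%N = Int 0))
    (logcost *+ 5).
Proof.
move=> en SCE AE.
have mM (i : 'I_p) : (m i < M)%N.
  apply: (@leq_ltn_trans (cum m i.+1)); first by rewrite cumS leq_addl.
  apply: leq_ltn_trans (cum_le _ (ltn_ord i)) _; apply: leq_ltn_trans total _.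
  by clear -BM pB p0; lia.
have AM i : (i <= p)%N -> (A i < M)%N.
  move=> ip; apply: leq_ltn_trans (cum_le _ ip) _; apply: leq_ltn_trans total _.
  by clear -BM pB p0; lia.
have ne (sg' : mem) (i : 'I_p) : sg' i vSC 0%N = Int (m i) -> ev M (sg' i) nonempty (occ i).
  by move=> h; rewrite /nonempty; ev_by h => //; apply: ltM.
have occp i : (i <= p)%N -> (cum occ i < M)%N.
  by move=> ip; apply: leq_ltn_trans (AM i ip); rewrite -occ_exc leq_addr.
have lc0 := logcost_ge0; have lcW := logcost_W.
apply: (dt_le (c := W + (logcost + (4%:R * W + (logcost + (1%:R * W + logcost *+ 2))))) _ _ (fun _ => id)); last first.
  by rewrite -[X in _ <= X]mulr_natl mulr2n; lra.
apply: (dt_cat (C1 := [:: _])).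
- by apply: (dt_set (w := fun i => Int (occ i))) => // i; apply: ne.
- move=> sg1 sg1E; have fr1 : frame [:: vAcc] sg sg1 by rewrite sg1E; apply: frame_upd.
apply: dt_cat.
- apply: (dt_scan (op := addn) (v := occ)) => //.
  + by move=> mm e1 e2 x y h1 h2 _; apply: ev_add.
  + move=> a b bp; apply: leq_ltn_trans (occp _ bp); rewrite /cum.
    have [ab|ba] := leqP a b; last by rewrite big_geq // ltnW.
    by rewrite [X in (_ <= X)%N](big_cat_nat _ (n := a)) //= leq_addl.
  + exact: env_frame fr1 _ en.
  by move=> i; rewrite sg1E.
- move=> sg2 [AccE fr2']; have fr2 := frame_cat fr1 fr2'; have en2 := env_frame fr2 isT en.
apply: (dt_cat (C1 := [:: _; _; _; _]) (C2 := _ ++ _)).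
- exact: (dt_block M alpha beta p0 final unit_workW sg2).
- move=> sg3 sg3E.
have SC2 i : sg2 i vSC 0%N = Int (m i) by rewrite fr2.
have A2 i : sg2 i vA 0%N = Int (A i) by rewrite fr2.
have sg3E' i : sg3 i = upd (upd (upd (upd (sg2 i) aH 0 (Int (occ i))) aH 1 (Int (cum vac i)))
    aH 2 (Int i)) aH 3 (Int (cum exc i)).
  have ip := ltn_ord i; have zi : (cum occ i.+1 - occ i = cum occ i)%N by rewrite cumS addnK.
  have iM : (i < M)%N by clear -ip BM pB; lia.
  have evz (mm : store T) : mm vAcc 0%N = Int (cum occ i.+1) -> mm vSC 0%N = Int (m i) ->
      ev M mm (Op Sub (var vAcc) nonempty) (cum occ i).
    move=> h1 h2; rewrite -zi; apply: ev_sub; [by ev_by h1 => //; apply: ltM| |exact: occp].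
    by rewrite /nonempty; ev_by h2 => //; apply: ltM.
  have evme (mm : store T) : mm 0%N 0%N = Int i -> ev M mm me i.
    by move=> h; ev_by h => //; apply: ltM.
  have [e0 _] := en2.
  rewrite sg3E.
  rewrite (exec_set _ (w := Int (occ i))); [|exact: ltM|exact: ne].
  rewrite (exec_set _ (w := Int (cum vac i))); [|exact: ltM|].
    rewrite (exec_set _ (w := Int i)); [|exact: ltM|exact: (evme _ (e0 i))].
    rewrite (exec_set _ (w := Int (cum exc i))) //; [exact: ltM|].
    apply: (@ev_eq _ _ _ _ _ _ (A i - cum occ i)); last by rewrite -occ_exc addKn.
    apply: ev_sub; [by ev_by A2 => //; apply: ltM|exact: (evz _ (AccE i) (SC2 i))|exact: AM (ltnW ip)].
  apply: (@ev_eq _ _ _ _ _ _ (i - cum occ i)); last by rewrite -{1}(occ_vac i) addKn.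
  by apply: ev_sub; [exact: (evme _ (e0 i))|exact: (evz _ (AccE i) (SC2 i))|].
have fr3' : frame [:: aH] sg2 sg3.
  rewrite sg3E; have fe := frame_exec; by apply: (frame_sub (fe _ sg2)).
have fr3 := frame_cat fr2 fr3'; have en3 := env_frame fr3 isT en.
apply: dt_cat.
- apply: (dt_route_left (X := owners) (low := fun i => cum occ i) (dsp := fun i => cum vac i)
    _ _ (a := fun i => i) (b := fun i => cum exc i)) => //.
  + by move=> i _; rewrite occ_vac.
  + move=> i j oi oj ij; split; first by apply: cum_lt; rewrite ?lt0b.
    exact/cum_le/ltnW.
  move=> t; split=> [i oi it|noi].
    have <- : i = t by apply: val_inj; rewrite /= -it occ_vac.
    have oi' : (0 < m i)%N := oi.
    by rewrite sg3E' /upd /= /occ oi'.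
  rewrite sg3E' /upd /= /occ; case mt: (0 < m t)%N => //; case: (noi t mt); exact: occ_vac.
- move=> sg4 [fr4' tk4]; have fr4 := frame_cat fr3 fr4'; have en4 := env_frame fr4 isT en.
apply: (dt_cat (C1 := [:: _])).
- exact: (dt_block M alpha beta p0 final unit_workW sg4).
- move=> sg5 sg5E.
have sg5E' : sg5 = fun i => upd (sg4 i) aH 1 (sg4 i aH 3%N).
  rewrite sg5E; apply: funext => i; rewrite (exec_set _ (w := sg4 i aH 3%N)) //; first exact: ltM.
  by apply/eval_readl/ltM.
have fr5' : frame [:: aH] sg4 sg5 by rewrite sg5E'; apply: frame_upd.
have fr5 := frame_cat fr4 fr5'; have en5 := env_frame fr5 isT en.
apply: dt_le (dt_route_right (X := owners) (low := fun i => cum occ i) (dsp := fun i => cum exc i)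
    _ _ (a := fun i => i) (b := fun i => cum exc i) en5 _) _ _ => //.
  + by move=> i oi; rewrite occ_exc; apply: cum_ltp.
  + move=> i j oi oj ij; split; first by apply: cum_lt; rewrite ?lt0b.
    exact/cum_le/ltnW.
  + move=> t; have [h1 h2] := tk4 t; rewrite sg5E' /upd /=; split=> // i oi it.
    by have [? ? ? ?] := h1 i oi it.
move=> sg6 [fr6 tk6]; split; first by apply: (frame_sub (frame_cat fr5 fr6)).
move=> t; have [h1 h2] := tk6 t; split=> [i oi it|noi].
  by have [] := h1 i oi; rewrite ?occ_exc.
by apply: h2 => i oi; rewrite occ_exc; apply: noi.
all: by costs.
Qed.

(* The PE whose block contains item [t]. *)
Variable own : 'I_p -> 'I_p.
Hypothesis ownP : forall t : 'I_p, (t < A p)%N ->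
  owners (own t) && (A (own t) <= t < A (own t) + m (own t))%N.

Lemma own_head (i t : 'I_p) : owners i -> A i = t -> own t = i.
Proof.
move=> oi it; have tS : (t < A p)%N.
  by rewrite -it; apply: leq_trans (cum_le _ (ltn_ord i)); rewrite cumS -addn1 leq_add2l.
have /and3P[oo h1 h2] := ownP tS; apply: val_inj; rewrite -cumS in h2.
case: (ltngtP (own t) i) => // lt; last by have := cum_lt lt oi; rewrite it ltnNge h1.
by have := cum_le m lt; rewrite it leqNgt h2.
Qed.

Lemma own_shift (t u : 'I_p) : (t < A p)%N -> (A (own t) <= u <= t)%N -> own u = own t.
Proof.
move=> tS /andP[h1 h2]; have /and3P[oo h3 h4] := ownP tS.
have /and3P[oo' h1' h2'] := ownP (leq_ltn_trans h2 tS).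
rewrite -cumS in h2'; rewrite -cumS in h4; apply: val_inj.
case: (ltngtP (own u) (own t)) => // lt.
  by have := leq_trans h2' (cum_le m lt); rewrite ltnNge h1.
by have := leq_trans h4 (cum_le m lt); rewrite ltnNge (leq_trans h1' h2).
Qed.

(** Once the first PE of a range knows the owner of the block, the block is sent there whole and
    then scattered by halving: a PE whose offset is a multiple of [2 ^ l.+1] holds the next
    [2 ^ l.+1] items and passes the upper half on by [2 ^ l] places. All PEs take part in the shift;
    one whose offset lacks this bit stores the message at index [2 * np], out of the way. *)
Definition spread : program :=
  route_tokens ++
  [:: partial_comm (var vSC) (var aH) (var vA) aB (Lit 0) (var vSC)
        (Read aH (Lit 2)) aQ (Lit 0)] ++
  [:: asg aG (var aH); Write aG (Lit 1) me] ++ flood (Lit 1) ++ top_power ++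
  [:: halving [:: shift (var vD) aQ (var vD) (emin (var vD) (Op Sub (var vL) (var vD)))
        aQ (Op Mul (Op Sub (Lit 1) (bit (Op Sub me (Read aG (Lit 1))))) (Op Add np np))]].

(** The lengths grow geometrically until [L] is used up, so scattering adds no logarithmic factor to
    the volume. *)
Lemma sum_minn_exp L n : (\sum_(0 <= l < n) minn (2 ^ l) (L - 2 ^ l) <= 2 * L)%N.
Proof.
(* The bound [2 ^ n - 1] takes care of the levels before [L] is exhausted and makes the induction go
   through. *)
suff : (\sum_(0 <= l < n) minn (2 ^ l) (L - 2 ^ l) <= minn (2 ^ n - 1) (2 * L))%N.
  by move=> h; apply: leq_trans h (geq_minr _ _).
elim: n => [|n IH]; first by rewrite big_geq.
rewrite big_nat_recr //= expnS; move: IH; set s := (\sum_(_ <= _ < _) _)%N.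
by have : (0 < 2 ^ n)%N; [rewrite expn_gt0|move: (2 ^ n)%N => e; lia].
Qed.

Lemma dt_spread L sg : env sg -> (L <= p)%N ->
  (forall i : 'I_p, (m i <= L)%N) ->
  (forall i : 'I_p, sg i vSC 0%N = Int (m i)) ->
  (forall i : 'I_p, sg i vA 0%N = Int (A i)) ->
  (forall i : 'I_p, sg i vL 0%N = Int L) ->
  dt spread sg (fun sg' =>
    frame [:: vAcc; vRcv; vD; aH; vC1; vC2; aQ; aG] sg sg' /\
    forall t : 'I_p, (t < A p)%N ->
      sg' t aQ 0%N = sg (own t) aB (t - A (own t))%N)
    (logcost *+ 9 + 3%:R * (L%:R * beta)).
Proof.
move=> en Lp mL SCE AE LE; have lc0 := logcost_ge0; have lcW := logcost_W.
have pM x : (x <= 8 * p)%N -> (x < M)%N by clear -BM pB p0; lia.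
pose cS := \sum_(0 <= l < up_log 2 p) (2%:R * W + (W + (alpha + (minn (2 ^ l) (L - 2 ^ l))%:R * beta))).
have cSle : cS + level <= logcost + 2%:R * (L%:R * beta).
  have -> : cS = (3%:R * W + alpha) *+ up_log 2 p +
      (\sum_(0 <= l < up_log 2 p) minn (2 ^ l) (L - 2 ^ l))%:R * beta.
    rewrite natr_sum mulr_suml -[in X in X + _](subn0 (up_log 2 p)) -sumr_const_nat.
    by rewrite -big_split /=; apply: eq_bigr => l _; ring.
  have h1 : (\sum_(0 <= l < up_log 2 p) minn (2 ^ l) (L - 2 ^ l))%:R * beta <=
      (2 * L)%:R * beta by rewrite ler_wpM2r // ler_nat sum_minn_exp.
  have h2 : (3%:R * W + alpha) *+ up_log 2 p <= level *+ up_log 2 p.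
    by apply: ler_wMn2r; have h3 := W0; have h4 := al0; have h5 := be0; rewrite /level; lra.
  by rewrite natrM in h1; rewrite /logcost [level *+ _.+1]mulrSr; lra.
apply: (dt_le (c := logcost *+ 5 + ((W + W + (W + (alpha + L%:R * beta))) +
   (2%:R * W + (logcost + (logcost + (cS + W)))))) _ _ (fun _ => id)); last first.
  have h1 := W0; have h2 := al0; have h3 := be0.
  have h4 : 10%:R * W + alpha <= level by rewrite /level; lra.
  by rewrite -[logcost *+ 9]mulr_natl -[logcost *+ 5]mulr_natl; lra.
apply: dt_cat; first exact: dt_route_tokens.
- move=> sg1 [fr1 tk]; have en1 := env_frame fr1 isT en.
pose hd (t : 'I_p) := [exists i : 'I_p, owners i && (A i == t)].
have hdP (t : 'I_p) : hd t -> owners (own t) /\ A (own t) = t.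
  by move=> /existsP[i /andP[oi /eqP it]]; rewrite (own_head oi it).
have aH0 (t : 'I_p) : sg1 t aH 0%N = Int (hd t).
  have [h1 h2] := tk t; case: (boolP (hd t)) => [/hdP[ot At]|/existsP noi].
    by have [] := h1 _ ot At.
  by apply: h2 => i oi /eqP it; apply: noi; exists i; rewrite oi.
have aH2 (t : 'I_p) : hd t -> sg1 t aH 2%N = Int (own t).
  by move=> /hdP[ot At]; have [h1 _] := tk t; have [] := h1 _ ot At.
have ApM : (A p <= p)%N := total.
have mp (i : 'I_p) : (m i <= p)%N by apply: leq_trans (mL i) Lp.
pose f (i : 'I_p) : 'I_p := insubd i (A i).
have fE (i : 'I_p) : owners i -> A i = f i.
  by move=> oi; rewrite val_insubd cum_ltp.
apply: (dt_cat (C1 := [:: _])).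
- apply: (dt_partial_comm p0 al0 be0 final unit_workW (sb := owners) (rb := hd) (f := f) (g := own) (l := L)) => //.
  + move=> i; have -> : evaln M (sg1 i) (var vSC) = m i.
      by apply: evn; ev_by (fr1, SCE) => //; apply: ltM.
    by rewrite /owners lt0n.
  + move=> i; have -> : evaln M (sg1 i) (var aH) = hd i.
      by apply: evn; ev_by aH0 => //; apply: ltM.
    by case: (hd i).
  + move=> i oi; split.
      by rewrite -fE //; apply: evn; ev_by (fr1, AE) => //; apply: ltM.
    have -> // : evaln M (sg1 i) (var vSC) = m i.
      by apply: evn; ev_by (fr1, SCE) => //; apply: ltM.
  + by move=> i hi; apply: evn; ev_by (aH2 i hi) => //; apply: ltM.
  + move=> i oi; have fi := fE i oi; split; last exact: own_head oi fi.
    by apply/existsP; exists i; rewrite oi fi /=.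
  + by move=> t ht; have [ot At] := hdP t ht; split=> //; apply: val_inj; rewrite /= -fE.
- move=> sg2 sg2E.
have fr2' : frame [:: aQ] sg1 sg2.
  move=> i a x al; rewrite sg2E; case: ifP => // _; rewrite /write_block.
  by move: al; rewrite inE => /negPf ->.
have fr2 := frame_cat fr1 fr2'; have en2 := env_frame fr2 isT en.
have Q2 (t : 'I_p) x : hd t -> (x < m (own t))%N -> sg2 t aQ x = sg (own t) aB x.
  move=> ht xm; rewrite sg2E ht !evaln_lit; [|exact: ltM..].
  have -> : evaln M (sg1 (own t)) (var vSC) = m (own t).
    by apply: evn; ev_by (fr1, SCE) => //; apply: ltM.
  rewrite /write_block /read_block eqxx size_map size_iota /= add0n xm subn0.
  by rewrite (nth_map 0%N) ?size_iota // nth_iota // fr1.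
apply: (dt_cat (C1 := [:: _; _])).
- exact: dt_writes.
- move=> sg3 [sg3E fr3'].
have fr3 := frame_cat fr2 fr3'; have en3 := env_frame fr3 isT en.
have G3 (t : 'I_p) : sg3 t = upd (upd (sg2 t) aG 0 (Int (hd t))) aG 1 (Int t).
  rewrite sg3E (exec_set _ (w := Int (hd t))); [|exact: ltM|].
    rewrite (exec_set _ (w := Int t)) //; first exact: ltM.
    by have [e0 _] := en2; rewrite eval_readl ?ltM // -e0.
  by rewrite eval_readl ?ltM // fr2' // aH0.
(* Only the first PE of each range offers its index, so that every PE learns where its own range
   begins. *)
pose s (t : nat) : option (word T) := if insub t is Some t' then if hd t' then Some (Int t) else None else None.
apply: dt_cat.
- apply: (dt_flood (d0 := 1) (s := s)) => //.
  + by move=> i; apply/ev_lit/ltM.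
  + move=> i; rewrite G3 /upd /= /s valK; split=> [|w]; first by case: (hd i).
    by case: (hd i) => // -[].
- move=> sg4 [fr4' [k pk sl4]].
have fr4 := frame_cat fr3 fr4'; have en4 := env_frame fr4 isT en.
have G4 (t : 'I_p) : (t < A p)%N -> sg4 t aG 1%N = Int (A (own t)).
  move=> tS; have /and3P[oo h1 h2] := ownP tS; have tp := ltn_ord t.
  have [_ h] := sl4 t; apply: h; apply: (nearestP (x := t - A (own t))).
  - by clear -pk tp h1; lia.
  - rewrite pos_left ?leq_subr ?muln1 ?leq_subr // subKn // /s fE // valK.
    by have -> : hd (f (own t)) by apply/existsP; exists (own t); rewrite oo fE /=.
  move=> y yt; rewrite pos_left ?muln1 //; last by clear -yt h1; lia.
  rewrite /s; case: insubP => // u _ ue; case: ifP => // /hdP[_].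
  rewrite (@own_shift t u) //; first by move=> e; move: yt; rewrite e ue; clear -h1; lia.
  by rewrite ue; clear -yt h1; lia.
apply: dt_cat.
- exact: dt_top_power.
- move=> sg5 [fr5' [l0 [ll pl DE5]]].
have fr5 := frame_cat fr4 fr5'; have en5 := env_frame fr5 isT en.
pose o (t : 'I_p) := (t - A (own t))%N.
pose J l sg' := [/\ forall i, sg' i vD 0%N = Int (2 ^ l)%N,
   frame [:: vD; aQ] sg5 sg' &
   forall t : 'I_p, (t < A p)%N -> (2 ^ l %| o t)%N -> forall x, (x < 2 ^ l)%N ->
     (o t + x < m (own t))%N -> sg' t aQ x = sg (own t) aB (o t + x)%N].
pose c l := W + (alpha + (minn (2 ^ l) (L - 2 ^ l))%:R * beta).
have c0 l : 0 <= c l by costs.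
have ll2 : (2 ^ l0 <= 2 * p)%N by apply: leq_trans exp_up_log; rewrite leq_exp2l.
apply: dt_le (dt_halving (J := J) (P := J 0%N) (c := c) (L := l0) _ _ _ _ _ _) _ _ => //.
- by apply: pM; clear -ll2; lia.
- by move=> l sg' [D fr _]; split=> //; apply: env_frame fr _ en5.
- move=> l sg6 sg7 [DE6 fr6 J6] ll0 fr7 DE7.
  have en7 := env_frame (frame_cat fr6 fr7) isT en5.
  have lp : (2 ^ l < p)%N by apply/exp_lt_up_log/(leq_trans ll0).
  have L7 (i : 'I_p) : sg7 i vL 0%N = Int L by rewrite fr7 // fr6 // fr5.
  have evlen (i : 'I_p) : evaln M (sg7 i) (emin (var vD) (Op Sub (var vL) (var vD))) = minn (2 ^ l) (L - 2 ^ l).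
    apply: evn; apply: ev_min; [by ev_by DE7 => //; apply: ltM| |by apply: pM; clear -lp; lia].
    by apply: ev_sub; [ev_by L7 => //; apply: ltM|ev_by DE7 => //; apply: ltM|by apply: pM; clear -Lp; lia].
  have evD (i : 'I_p) : evaln M (sg7 i) (var vD) = (2 ^ l)%N.
    by apply: evn; ev_by DE7 => //; apply: ltM.
  apply: dt_le (dt_shift (s := 2 ^ l) (l := minn (2 ^ l) (L - 2 ^ l)) _ en7 _ _ _) _ _ => //.
  + by move=> i; ev_by DE7 => //; apply: ltM.
  + exact: ltnW.
  + by move=> i; rewrite evlen.
  move=> sg8 sg8E; have fr8 : frame [:: aQ] sg7 sg8.
    move=> i a x al; rewrite sg8E /write_block.
    by move: al; rewrite inE => /negPf ->.
  split=> [i||t tS Dt x xl xm].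
  + by rewrite fr8.
  + by apply: (frame_sub (frame_cat fr6 (frame_cat fr7 fr8))).
  have /and3P[oo h1 h2] := ownP tS; have tp := ltn_ord t.
  have otE : (o t = (o t %/ 2 ^ l) * 2 ^ l)%N by rewrite divnK.
  have bE : evaln M (sg7 t) (Op Mul (Op Sub (Lit 1) (bit (Op Sub me (Read aG (Lit 1))))) (Op Add np np))
     = ((1 - bitn (o t) (2 ^ l)) * (p + p))%N.
    apply: evn; have b1 := bitn_le1 (o t) (2 ^ l); apply: ev_mul.
    - apply: ev_sub; [exact/ev_lit/ltM| |exact: ltM].
      apply: ev_bit => //; last by apply: pM; rewrite /o; clear -tp; lia.
      apply: ev_sub; [exact: ev_me| |by apply: pM; clear -tp; lia].
      apply: ev_readl; first exact: ltM.
      by rewrite fr7 // fr6 // fr5' // G4.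
    - by apply: ev_add; [exact: ev_np|exact: ev_np|apply: pM; lia].
    by apply: pM; clear -b1; case: (bitn _ _) b1 => [|[|]] // _; lia.
  rewrite sg8E bE evlen evD /write_block /read_block eqxx size_map size_iota /=.
  have := bitn_le1 (o t) (2 ^ l); case bt: (bitn (o t) (2 ^ l)) => [|[|//]] _.
    (* The bit is not set: the received words lie from index [p + p] on, beyond the cells that
       matter. *)
    rewrite subn0 mul1n leqNgt (leq_trans xl) ?(leq_trans (ltnW lp)) ?leq_addr //=.
    rewrite fr7 //; apply: J6 => //; last by rewrite expnS; clear -xl; lia.
    rewrite expnS otE dvdn_pmul2r ?expn_gt0 // /dvdn.
    by apply/eqP; exact: bt.
  rewrite subnn mul0n leq0n add0n subn0 /=.
  have ot : (2 ^ l <= o t)%N.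
    rewrite leqNgt; apply/negP => otl; move: bt.
    by rewrite /bitn divn_small // mod0n.
  have xmn : (x < minn (2 ^ l) (L - 2 ^ l))%N.
    by have := mL (own t); rewrite leq_min xl /=; clear -xm ot; lia.
  rewrite xmn (nth_map 0%N) ?size_iota // nth_iota //.
  pose u := left_of (2 ^ l) t.
  have uE : u = (t - 2 ^ l)%N :> nat.
    rewrite /u /= -addnBAC ?modnDr ?modn_small //.
      by apply: leq_ltn_trans (leq_subr _ _) tp.
    by apply: leq_trans ot (leq_subr _ _).
  have ou : own u = own t.
    by apply: own_shift => //; rewrite uE leq_subr andbT; move: ot h1; rewrite /o; clear; lia.
  have oE : o u = (o t - 2 ^ l)%N by rewrite /o ou uE; clear; lia.
  rewrite -/u fr7 // J6.
  - by rewrite ou oE; congr (sg _ _ _); clear -ot; lia.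
  - by rewrite uE; apply: leq_ltn_trans (leq_subr _ _) tS.
  - have -> : o u = ((o t %/ 2 ^ l).-1 * 2 ^ l)%N.
      by rewrite oE {1}otE -subn1 mulnBl mul1n.
    rewrite expnS dvdn_pmul2r ?expn_gt0 // dvdn2.
    by move: bt; rewrite /bitn modn2; case: (o t %/ 2 ^ l)%N => //= q; case: (odd q).
  - by rewrite expnS; clear -xl; lia.
  by rewrite ou oE; move: xm; clear -ot; lia.
- split=> // t tS dt x xl xm.
  have tp := ltn_ord t; have /and3P[oo h1 h2] := ownP tS.
  have ot0 : o t = 0%N.
    apply/eqP; move: dt; apply: contraLR; rewrite -lt0n => ot; apply/negP => /(dvdn_leq ot).
    by rewrite leqNgt (leq_trans _ pl) // /o (leq_ltn_trans (leq_subr _ _)).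
  rewrite ot0 add0n; rewrite ot0 add0n in xm.
  rewrite fr5' // fr4' // fr3' //; apply: Q2 => //.
  apply/existsP; exists (own t); rewrite oo /=; move: ot0; rewrite /o; clear -h1; lia.
- rewrite lerD2r /cS (big_cat_nat _ (n := l0) (p := up_log 2 p)) //= lerDl.
  by costs.
- move=> sg6 [_ fr6 J6]; split; first by apply: (frame_sub (frame_cat fr5 fr6)).
  move=> t tS; have /and3P[oo h1 h2] := ownP tS.
  rewrite J6 ?expn0 ?dvd1n ?addn0 //; rewrite /o; clear -h1 h2; lia.
all: rewrite ?/cS; by costs.
Qed.

End Spreading.

(** * Broadcasting and reducing *)

(** At distance 1, [p] probes visit every place, [t0] among them after the cyclic distance from it;
    as all values present are equal, it does not matter which one is met first. *)
Lemma nearest_const (V : Type) (s : nat -> option V) w k i t0 :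
  (forall t, (t < p)%N -> s t = None \/ s t = Some w) ->
  (t0 < p)%N -> s t0 = Some w -> (p <= k)%N -> (i < p)%N ->
  nearest s 1 k i = Some w.
Proof.
move=> sw t0p st0 pk ip.
pose x := (if t0 <= i then i - t0 else i + p - t0)%N.
have xk : (x < k)%N by rewrite /x; case: ifP => h; clear -t0p ip pk h; lia.
have xE : ((i + x * (p - 1)) %% p = t0)%N.
  rewrite /x; case: leqP => h; first by rewrite pos_left ?muln1 ?leq_subr // subKn.
  have -> : (i + (i + p - t0) * (p - 1) = (i + p - t0).-1 * p + t0)%N.
    have [y yE] : exists y, (i + p - t0)%N = y.+1.
      by exists (i + p - t0).-1; rewrite prednK //; clear -h t0p ip; lia.
    rewrite yE /= mulnBr muln1 mulSn; clear -yE h t0p ip; move: (y * p)%N => z; lia.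
  by rewrite modnMDl modn_small.
rewrite /nearest.
have : {in iota 0 k, forall y, s ((i + y * (p - 1)) %% p)%N = None \/
                               s ((i + y * (p - 1)) %% p)%N = Some w}.
  by move=> y _; apply/sw/ltn_pmod.
have : x \in iota 0 k by rewrite mem_iota.
elim: (iota 0 k) => //= y l IH; rewrite inE => /orP[/eqP <- _|xl h].
  by rewrite xE st0.
case: (h y); rewrite ?inE ?eqxx // => -> //=; apply: IH => // z zl.
by apply: h; rewrite inE zl orbT.
Qed.

(* Floods the value of [e] on the PEs where [c] holds. *)
Definition broadcast (c e : expr) : program :=
  [:: asg aG c; Write aG (Lit 1) e] ++ flood (Lit 1).

Lemma dt_broadcast c e (b : 'I_p -> bool) (u : 'I_p -> word T) sg :
  (work (asg aG c) <= unit_work)%N -> (work (Write aG (Lit 1) e) <= unit_work)%N ->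
  env sg -> (forall i, ev M (sg i) c (b i)) ->
  (forall i, b i -> eval M (upd (sg i) aG 0 (Int 1)) e = u i) ->
  dt (broadcast c e) sg (fun sg' => [/\ frame [:: aG; vD] sg sg',
    (forall i, ~~ b i) -> forall i, sg' i aG 0%N = Int 0 &
    forall t w, b t -> (forall i, b i -> u i = w) ->
      forall i, sg' i aG 0%N = Int 1 /\ sg' i aG 1%N = w]) (2%:R * W + logcost).
Proof.
move=> wc we en cE eE.
apply: (dt_cat (C1 := [:: _; _])); last exact: logcost_ge0.
  by apply: dt_writes => //; apply/andP; split=> //; apply/andP; split.
move=> sg1 [sg1E fr1]; have en1 := env_frame fr1 isT en.
pose s (t : nat) : option (word T) := if insub t is Some t' then
   if b t' then Some (u t') else None else None.
have sE (t : 'I_p) : s t = if b t then Some (u t) else None by rewrite /s valK.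
apply: dt_le (dt_flood (d0 := 1) (s := s) _ _ en1 _ _) _ _ => //.
- by move=> i; apply/ev_lit/ltM.
- move=> i; rewrite sE sg1E (exec_set _ (w := Int (b i))); [|exact: ltM|exact: cE].
  have [bi|bi] := boolP (b i).
    rewrite (exec_set _ (w := u i)); [|exact: ltM|by rewrite eE].
    by split=> [|w [<-]].
  set w := eval M (upd (sg i) aG 0 (Int false)) e.
  by rewrite (exec_set _ (w := w)) //; exact: ltM.
move=> sg2 [fr2 [k]]; rewrite mul1n => pk sl; split.
- by apply: (frame_sub (frame_cat fr1 fr2)).
- move=> nb i; have [-> _] := sl i; rewrite nearest_none // => j jp.
  by rewrite /s insubT (negPf (nb _)).
move=> t w bt uw i; have [h1 h2] := sl i.
have nE : nearest s 1 k i = Some w.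
  apply: (nearest_const (t0 := t)) => //; last by rewrite sE bt uw.
  move=> j jp; rewrite /s insubT; case: ifP => bj; last by left.
  by right; rewrite uw.
by rewrite h1 nE; split=> //; apply: h2.
Qed.

(* Leaves the inclusive prefix in [vAcc] and the total in [r]. *)
Definition allreduce op r : program :=
  scan op ++ broadcast (Op Leq np (Op Add me (Lit 1))) (var vAcc) ++
  [:: asg r (Read aG (Lit 1))].

Lemma dt_allreduce (op : Monoid.com_law 0%N) c r (v : nat -> nat) sg :
  (work (asg vAcc (c (var vAcc) (Op Mul (Op Leq (var vD) me) (var vRcv)))) <= unit_work)%N ->
  (forall (m : store T) e1 e2 x y, ev M m e1 x -> ev M m e2 y ->
     (x < M)%N -> (op x y < M)%N -> ev M m (c e1 e2) (op x y)) ->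
  (forall a b, (b <= p)%N -> (\big[op/0%N]_(a <= j < b) v j < M)%N) ->
  env sg -> (forall i : 'I_p, sg i vAcc 0 = Int (v i)) ->
  dt (allreduce c r) sg (fun sg' =>
    [/\ frame [:: vAcc; vRcv; vD; aG; r] sg sg',
     forall i : 'I_p, r \notin [:: vAcc; aG; vD] ->
       sg' i vAcc 0 = Int (\big[op/0%N]_(0 <= j < i.+1) v j) &
     forall i : 'I_p, sg' i r 0 = Int (\big[op/0%N]_(0 <= j < p) v j)])
   (logcost *+ 3).
Proof.
move=> wk cE vM en vE; have h0 := W0; have lcW := logcost_W.
apply: (dt_le (c := logcost + ((2%:R * W + logcost) + 1%:R * W)) _ _ (fun _ => id)); last first.
  by rewrite -mulr_natl; lra.
apply: dt_cat; [exact: (dt_scan wk cE vM en vE)| |by costs].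
move=> sg1 [AccE fr1]; have en1 := env_frame fr1 isT en.
apply: dt_cat; last by costs.
  apply: (dt_broadcast (b := fun i : 'I_p => (p <= i + 1)%N)
    (u := fun i => Int (\big[op/0%N]_(0 <= j < i.+1) v j))) => //.
    move=> i; apply: ev_leq; [exact: ev_np| |exact: ltM].
    apply: ev_add; [exact: ev_me|exact/ev_lit/ltM|].
    by have := ltn_ord i; clear -BM pB p0; lia.
  by move=> i _; rewrite eval_readl ?ltM // /upd /= AccE.
move=> sg2 [fr2 _ G2].
have pp : (p.-1 < p)%N by rewrite prednK.
have {}G2 := G2 (Ordinal pp) (Int (\big[op/0%N]_(0 <= j < p) v j)).
have bp : (p <= Ordinal pp + 1)%N by rewrite /= addn1 prednK.
have {}G2 := G2 bp; have {}G2 i : sg2 i aG 1%N = Int (\big[op/0%N]_(0 <= j < p) v j).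
  have [|_ ->] // := G2 _ i; move=> j pj; congr (Int (\big[op/0%N]_(0 <= _ < _) _)).
  by have := ltn_ord j; clear -pj; lia.
apply: dt_le (dt_writes (C := [:: _]) _ _) _ _ => // sg3 [sg3E fr3].
have sg3E' i : sg3 i = upd (sg2 i) r 0 (Int (\big[op/0%N]_(0 <= j < p) v j)).
  by rewrite sg3E (exec_set _ (w := Int (\big[op/0%N]_(0 <= j < p) v j))) ?eval_readl ?ltM ?G2.
split.
- apply: (frame_sub (frame_cat fr1 (frame_cat fr2 fr3))).
  by rewrite /= !inE !eqxx !orbT.
- move=> i; rewrite !inE !negb_or => /and3P[rA rG rD].
  by rewrite sg3E' /upd eq_sym (negPf rA) /= fr2.
by move=> i; rewrite sg3E' /upd !eqxx.
Qed.

Lemma ev_opadd (m : store T) e1 e2 x y : ev M m e1 x -> ev M m e2 y ->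
  (x < M)%N -> (x + y < M)%N -> ev M m (Op Add e1 e2) (x + y).
Proof. by move=> h1 h2 _; apply: ev_add. Qed.

Definition emax e1 e2 := Op Add e1 (Op Sub e2 e1).

Lemma ev_opmax (m : store T) e1 e2 x y : ev M m e1 x -> ev M m e2 y ->
  (x < M)%N -> (maxn x y < M)%N -> ev M m (emax e1 e2) (maxn x y).
Proof.
move=> h1 h2 xM xyM; apply: (@ev_eq _ _ _ _ _ _ (x + (y - x))); last by rewrite maxnE.
apply: ev_add => //; last by rewrite -maxnE.
by apply: ev_sub => //; apply: leq_ltn_trans xyM; rewrite leq_maxr.
Qed.

(** * Ranking a sample *)

Notation vS := 22%N.
Notation vY := 23%N.
Notation vRk := 24%N.
Notation vIt := 25%N.

(* With [S] items, the PEs form rows of length [S + 1]; PE [t] compares item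
   [t mod S] with the first item of its row, so that a complete row compares
   the item at its beginning with all items, and with itself twice. *)
Definition rank_items : program :=
  let row := Op Add (var vS) (Lit 1) in
  [:: asg aG (Op Leq (Op Add me (Lit 1)) (var vS)); Write aG (Lit 1) (var aQ)] ++
  flood (Op Add (var vS) (Op Sub (Lit 1) (var vS))) ++
  [:: asg vY (Read aG (Lit 1)); asg aG (Op Leq (emod me row) (Lit 0))] ++
  flood (Lit 1) ++
  [:: asg vAcc (Op Sub (Lit 1) (Op Leq (Read aG (Lit 1)) (var vY)))] ++
  scan (Op Add) ++
  [:: shift row vAcc (Lit 0) (Lit 1) vRcv (Lit 0);
      asg vRk (Op Mul (Op Mul (Op Leq (Lit 1) (var vS)) (Op Leq (var vS) (emod me row)))
        (Op Add (Op Sub (var vAcc) (Op Mul (Op Leq row me) (var vRcv))) (Lit 1)));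
      asg vIt (Read aG (Lit 1))].

Section Ranking.
Variables (S : nat) (g : nat -> T).
Hypothesis SS : (S * S.+1 <= p)%N.

Definition rank (u : nat) : nat := (\sum_(0 <= v < S) (g v < g u)%O)%N.

Lemma sum_shift (F : nat -> nat) a : (0 < S)%N ->
  (\sum_(0 <= b < S) F ((a + b) %% S) = \sum_(0 <= b < S) F b)%N.
Proof.
move=> S0; elim: a => [|a IH].
  by apply: eq_big_nat => b /andP[_ bS]; rewrite modn_small.
have e : (F (a %% S) + \sum_(0 <= b < S) F ((a + b.+1) %% S) =
    \sum_(0 <= b < S) F ((a + b) %% S) + F ((a + S) %% S))%N.
  by rewrite -(@big_nat_recr _ _ _ S 0 (fun b => F ((a + b) %% S)%N)) // big_nat_recl // addn0.
have e' : (\sum_(0 <= b < S) F ((a + b.+1) %% S) = \sum_(0 <= b < S) F b)%N.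
  by apply: (@addnI (F (a %% S)%N)); rewrite e modnDr IH addnC.
by rewrite -e'; apply: eq_bigr => b _; rewrite addSnnS.
Qed.

Lemma dt_rank_items sg : env sg ->
  (forall i, sg i vS 0%N = Int S) ->
  (forall t : 'I_p, (t < S)%N -> sg t aQ 0%N = Elt (g t)) ->
  dt rank_items sg (fun sg' => frame [:: aG; vD; vY; vAcc; vRcv; vRk; vIt] sg sg' /\
    forall t : 'I_p, let u := ((t %/ S.+1) %% S)%N in
      sg' t vRk 0%N = Int (((0 < S) && (S <= t %% S.+1))%N * (rank u).+1) /\
      ((0 < S)%N -> sg' t vIt 0%N = Elt (g u))) (logcost *+ 5).
Proof.
move=> en SE QE; have h0 := W0; have lcW := logcost_W; have h1 := al0; have h2 := be0.
have pM x : (x <= 8 * p)%N -> (x < M)%N by clear -BM pB p0; lia.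
have Sp : (S <= p)%N by apply: leq_trans SS; rewrite leq_pmulr.
have S1p : (0 < S)%N -> (S.+1 <= p)%N by move=> S0; apply: leq_trans SS; rewrite leq_pmull.
apply: (dt_le (c := 2%:R * W + (logcost + (2%:R * W + (logcost + (1%:R * W + (logcost +
   ((W + (alpha + 1%:R * beta)) + 2%:R * W))))))) _ _ (fun _ => id)); last first.
  have := logcost_level; rewrite /level => h3.
  by rewrite -mulr_natl; lra.
apply: dt_cat; [exact: dt_writes| |by costs].
move=> sg1 [sg1E fr1]; have en1 := env_frame fr1 isT en.
pose s1 (t : nat) : option (word T) := if (t < S)%N then Some (Elt (g t)) else None.
apply: dt_cat; last by costs.
  (* The distance has to be positive for an empty sample too. *)
  apply: (dt_flood (d0 := maxn 1 S) (s := s1)) => //.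
  - by rewrite leq_max /= geq_max Sp p0.
  - move=> i; apply: (@ev_eq _ _ _ _ _ _ (S + (1 - S))); last by rewrite -maxnE maxnC.
    have S2 : sg1 i vS 0%N = Int S by rewrite fr1.
    by ev_by S2 => //; try exact: ltM; apply: pM; clear -Sp p0; lia.
  - move=> i; have cE : eval M (sg i) (Op Leq (Op Add me (Lit 1)) (var vS)) = Int (i < S)%N.
      rewrite -[i.+1]addn1; apply: ev_leq; [|by ev_by SE => //; apply: ltM|exact: ltM].
      apply: ev_add; [exact: ev_me|exact/ev_lit/ltM|].
      by apply: pM; have := ltn_ord i; clear; lia.
    rewrite sg1E (exec_set _ (w := Int (i < S)%N)) ?ltM //.
    rewrite (exec_set _ (w := sg i aQ 0%N)) ?ltM ?eval_readl ?ltM //.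
    rewrite /s1 /upd /=; case: ifP => iS; split=> // w [<-]; exact: QE.
move=> sg2 [fr2 [k2 pk2 sl2]]; have en2 := env_frame (frame_cat fr1 fr2) isT en.
have G2 (t : 'I_p) : (0 < S)%N -> sg2 t aG 1%N = Elt (g (t %% S)%N).
  move=> S0; have [_ h] := sl2 t; have tp := ltn_ord t; apply: h.
  have mS : maxn 1 S = S by apply/maxn_idPr.
  rewrite mS; rewrite mS in pk2.
  apply: (nearestP (x := t %/ S)).
  - by rewrite ltn_divLR // mulnC; apply: leq_trans tp pk2.
  - rewrite pos_left ?leq_trunc_div // /s1.
    have -> : (t - t %/ S * S = t %% S)%N by rewrite {1}(divn_eq t S) addKn.
    by rewrite ltn_mod S0.
  move=> y yt; have yS : (y.+1 * S <= t)%N by rewrite -leq_divRL.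
  rewrite mulSn in yS; rewrite pos_left //; last by clear -yS; lia.
  by rewrite /s1 ltnNge; case: leqP => // tS; exfalso; clear -yS tS; lia.
have evrow (m : store T) : m vS 0%N = Int S -> ev M m (Op Add (var vS) (Lit 1)) S.+1.
  by move=> h; rewrite -[S.+1]addn1; ev_by h => //; try exact: ltM; apply: pM; clear -Sp p0; lia.
have evmod (m : store T) (i : 'I_p) : m 0%N 0%N = Int i -> m vS 0%N = Int S ->
    ev M m (emod me (Op Add (var vS) (Lit 1))) (i %% S.+1).
  move=> h h'; apply: ev_mod (evrow _ h') _; first by ev_by h => //; apply: ltM.
  by apply: pM; have := ltn_ord i; clear; lia.
have S2 i : sg2 i vS 0%N = Int S by rewrite fr2 // fr1.
have [e2 _] := en2.
apply: dt_cat; [exact: dt_writes| |by costs].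
move=> sg3 [sg3E fr3]; have en3 := env_frame fr3 isT en2.
have sg3E' i : sg3 i = upd (upd (sg2 i) vY 0 (sg2 i aG 1%N)) aG 0 (Int (i %% S.+1 <= 0)%N).
  rewrite sg3E (exec_set _ (w := sg2 i aG 1%N)) ?ltM ?eval_readl ?ltM //.
  rewrite (exec_set _ (w := Int (i %% S.+1 <= 0)%N)) ?ltM //.
  by apply: ev_leq; [exact: (evmod _ _ (e2 i) (S2 i))|exact/ev_lit/ltM|exact: ltM].
pose s2 (t : nat) : option (word T) := if insub t is Some t' then
   if (t %% S.+1 == 0)%N then Some (sg2 t' aG 1%N) else None else None.
apply: dt_cat; last by costs.
  apply: (dt_flood (d0 := 1) (s := s2)) => //.
  - by move=> i; apply/ev_lit/ltM.
  move=> i; rewrite sg3E' /upd /= /s2 valK leqn0.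
  by case: ifP => _; split=> // w [<-].
move=> sg4 [fr4 [k4 pk4 sl4]]; have en4 := env_frame fr4 isT en3.
rewrite mul1n in pk4.
have G4 (t : 'I_p) : (0 < S)%N -> sg4 t aG 1%N = Elt (g ((t %/ S.+1) %% S)%N).
  move=> S0; have [_ h] := sl4 t; have tp := ltn_ord t; apply: h.
  have tm : (t %% S.+1 <= t)%N by exact: leq_mod.
  have hE : (t - t %% S.+1 = t %/ S.+1 * S.+1)%N by rewrite {1}(divn_eq t S.+1) addnK.
  apply: (nearestP (x := t %% S.+1)).
  - by apply: leq_trans pk4; apply: leq_ltn_trans tp.
  - rewrite pos_left ?muln1 // hE /s2 modnMl eqxx insubT.
      by rewrite -hE; apply: leq_ltn_trans (leq_subr _ _) tp.
    by move=> hp; rewrite G2 //= mulnS addnC modnMDl.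
  move=> y yt; rewrite pos_left ?muln1 //; last by apply: ltnW; apply: leq_trans yt tm.
  rewrite /s2; case: (insub (t - y)%N) => // ?; case: eqP => // e0; exfalso; move: e0.
  have -> : (t - y = t %/ S.+1 * S.+1 + (t %% S.+1 - y))%N.
    by rewrite {1}(divn_eq t S.+1) addnBA // ltnW.
  rewrite modnMDl modn_small; first by clear -yt; lia.
  by apply: leq_ltn_trans (leq_subr _ _) _; rewrite ltn_mod.
have Y4 (t : 'I_p) : (0 < S)%N -> sg4 t vY 0%N = Elt (g (t %% S)%N).
  by move=> S0; rewrite fr4 // sg3E' /upd /= G2.
pose v (j : nat) : nat := if insub j is Some j' then
  (1 - leq_word (sg4 j' aG 1%N) (sg4 j' vY 0%N))%N else 0%N.
have v1 j : (v j <= 1)%N by rewrite /v; case: insub => // j'; exact: leq_subr.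
have vE j : (0 < S)%N -> (j < p)%N -> v j = (g (j %% S)%N < g ((j %/ S.+1) %% S)%N)%O.
  by move=> S0 jp; rewrite /v insubT G4 // Y4 //= ltNge; case: (_ <= _)%O.
have S4 i : sg4 i vS 0%N = Int S by rewrite fr4 // fr3.
apply: dt_cat; [exact: dt_writes| |by costs].
move=> sg5 [sg5E fr5]; have en5 := env_frame fr5 isT en4.
have vsum a b : (b <= p)%N -> (\sum_(a <= j < b) v j <= p)%N.
  move=> bp; apply: leq_trans (_ : \sum_(a <= j < b) 1 <= p)%N.
    by apply: leq_sum => j _; apply: v1.
  by rewrite sum_nat_const_nat muln1; clear -bp; lia.
apply: dt_cat; last by costs.
  apply: (dt_scan (op := addn) (v := v)) => //.
  - exact: ev_opadd.
  - by move=> a b bp; apply: pM; apply: leq_trans (vsum a b bp) _; clear; lia.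
  move=> i; rewrite sg5E (exec_set _ (w := Int (v i))) ?ltM //.
  rewrite -/(ev _ _ _ _) /v valK; apply: ev_sub; [exact/ev_lit/ltM| |exact: ltM].
  by apply: ev_leq_word; rewrite ?eval_readl ?ltM.
move=> sg6 [Acc6 fr6]; have en6 := env_frame fr6 isT en5.
have S6 i : sg6 i vS 0%N = Int S by rewrite fr6 // fr5.
have S1p' : (S.+1 <= p)%N by case: (posnP S) => [->|/S1p].
apply: (dt_cat (C1 := [:: _])); last by costs.
  by apply: (dt_shift_words (s := S.+1)) => // i; apply: evrow.
move=> sg7 sg7E; have fr7 : frame [:: vRcv] sg6 sg7.
  by rewrite sg7E; apply: frame_block.
have en7 := env_frame fr7 isT en6; have [e7 _] := en7.
have S7 i : sg7 i vS 0%N = Int S by rewrite fr7.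
have Acc7 (i : 'I_p) : sg7 i vAcc 0%N = Int (cum v i.+1) by rewrite fr7 // Acc6.
have Rcv7 (i : 'I_p) : sg7 i vRcv 0%N = Int (cum v (left_of S.+1 i).+1).
  by rewrite sg7E /= write_block_cons write_block_nil /upd /= Acc6.
apply: dt_le (dt_writes _ _) _ _ => //.
move=> sg8 [sg8E fr8]; split.
  by apply: (frame_sub (frame_cat fr1 (frame_cat fr2 (frame_cat fr3 (frame_cat fr4
    (frame_cat fr5 (frame_cat fr6 (frame_cat fr7 fr8)))))))).
move=> t; have tp := ltn_ord t.
set f := ((0 < S) && (S <= t %% S.+1))%N.
have cvp i : (i <= p)%N -> (cum v i <= p)%N by exact: vsum.
pose acc := (cum v t.+1 - (S.+1 <= t)%N * cum v (left_of S.+1 t).+1)%N.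
have evrk : ev M (sg7 t) (Op Mul (Op Mul (Op Leq (Lit 1) (var vS))
      (Op Leq (var vS) (emod me (Op Add (var vS) (Lit 1)))))
    (Op Add (Op Sub (var vAcc) (Op Mul (Op Leq (Op Add (var vS) (Lit 1)) me) (var vRcv)))
       (Lit 1))) (f * (acc + 1)).
  have accp : (acc <= p)%N by apply: leq_trans (leq_subr _ _) (cvp _ tp).
  apply: ev_mul.
  - apply: (@ev_eq _ _ _ _ _ _ ((1 <= S)%N * (S <= t %% S.+1)%N)); last first.
      by rewrite /f; case: (0 < S)%N; case: (S <= _)%N.
    apply: ev_mul; [|apply: ev_leq|by case: (0 < S)%N; case: (S <= _)%N; apply: ltM].
    + by apply: ev_leq; [exact/ev_lit/ltM|ev_by S7 => //; exact: ltM|exact: ltM].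
    + by ev_by S7 => //; exact: ltM.
    + exact: (evmod _ _ (e7 t) (S7 t)).
    exact: ltM.
  - apply: ev_add; [|exact/ev_lit/ltM|by apply: pM; clear -accp p0; lia].
    apply: ev_sub; [by ev_by Acc7 => //; apply: ltM| |by apply: pM; have := cvp _ tp; clear; lia].
    apply: ev_mul; [|by ev_by Rcv7 => //; apply: ltM|].
      by apply: ev_leq; [exact: evrow|exact: ev_me|exact: ltM].
    by apply: pM; have := cvp _ (ltn_ord (left_of S.+1 t)); clear; case: (_ <= t)%N; lia.
  by apply: pM; clear -accp p0; case: (f); lia.
have I7 : (0 < S)%N -> sg7 t aG 1%N = Elt (g ((t %/ S.+1) %% S)%N).
  by move=> S0; rewrite fr7 // fr6 // fr5 // G4.
have rkE : (f * (acc + 1) = f * (rank ((t %/ S.+1) %% S)).+1)%N.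
  rewrite /f; case: (posnP S) => [//|S0]; case: leqP => //= St.
  congr (_ * _)%N; rewrite addn1; congr _.+1.
  set q := (t %/ S.+1)%N.
  have tE : t = (q * S.+1 + S)%N :> nat.
    rewrite (divn_eq t S.+1); congr (_ + _)%N; apply/eqP; rewrite eqn_leq St andbT.
    by rewrite -ltnS ltn_mod.
  have -> : acc = (cum v (q * S.+1 + S.+1) - cum v (q * S.+1))%N.
    rewrite /acc tE -addnS; congr (_ - _)%N; case: ltnP => tS.
      rewrite mul1n; congr cum; rewrite /= -addnBAC ?modnDr ?modn_small //.
      - rewrite tE; have : (0 < q)%N by move: tS; case: (q) => //; rewrite mul0n add0n ltnn.
        by case: (q) => // q' _; rewrite mulSn; clear; lia.
      - by apply: leq_ltn_trans (leq_subr _ _) tp.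
      by rewrite tE.
    have q0 : q = 0%N by rewrite /q divn_small // ltnS; rewrite -tE in tS.
    by rewrite mul0n q0 mul0n /cum big_geq.
  rewrite /cum (big_cat_nat _ (n := (q * S.+1)%N)) ?leq_addr //= addKn.
  rewrite -{1}[(q * S.+1)%N]add0n big_addn addKn big_nat_recr //=.
  have qb b : (b <= S)%N -> v (b + q * S.+1)%N = (g ((q + b) %% S)%N < g (q %% S)%N)%O.
    move=> bS; rewrite vE //; last by apply: leq_ltn_trans tp; rewrite tE addnC leq_add2l.
    rewrite divnDMl // divn_small ?ltnS // add0n; congr (nat_of_bool (g _ < _)%O).
    by rewrite mulnS addnA addnC modnMDl [(b + q)%N]addnC.
  rewrite qb // modnDr ltxx addn0.
  rewrite /rank -(sum_shift (fun u => (g u < g (q %% S)%N)%O) q S0).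
  by apply: eq_big_nat => b /andP[_ bS]; rewrite qb // ltnW.
rewrite sg8E (exec_set _ (w := Int (f * (rank ((t %/ S.+1) %% S)).+1))) ?ltM //; last first.
  by rewrite -rkE.
rewrite (exec_set _ (w := sg7 t aG 1%N)) ?ltM ?eval_readl ?ltM //.
Qed.

End Ranking.

(** * Splitting the remaining elements *)

Notation vN := 26%N.
Notation vR := 27%N.
Notation vCNT := 28%N.
Notation vU := 30%N.
Notation vJ := 31%N.
Notation vMM := 32%N.
Notation vX := 33%N.
Notation vV := 34%N.
Notation vPv := 35%N.
Notation vC := 36%N.
Notation vKp := 37%N.
Notation vK := 38%N.
Notation aA := 41%N.

Definition ext (f : 'I_p -> nat) (j : nat) : nat :=
  if insub j is Some i then f i else 0%N.

Lemma ext_ord f (i : 'I_p) : ext f i = f i.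
Proof. by rewrite /ext valK. Qed.

Lemma sum_ext f : (\sum_(0 <= j < p) ext f j = \sum_i f i)%N.
Proof. by rewrite big_mkord; apply: eq_bigr => i _; rewrite ext_ord. Qed.

Lemma sum_ext_le f a b : (b <= p)%N -> (\sum_(a <= j < b) ext f j <= \sum_i f i)%N.
Proof.
move=> bp; rewrite -sum_ext; case: (leqP a b) => ab; last by rewrite big_geq // ltnW.
rewrite [X in (_ <= X)%N](big_cat_nat _ (n := b)) //= [X in (_ <= X + _)%N](big_cat_nat _ (n := a)) //=.
by rewrite -addnA addnCA leq_addr.
Qed.

Definition next : expr := Op Add (var vJ) (Lit 1).
Definition for_loop (C : program) : instr := While (Op Leq next (var vMM)) C.

Lemma dt_for (J : nat -> mem -> Prop) m (c : R) C sg P : 0 <= c -> (m.+1 < M)%N ->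
  (forall l sg, J l sg -> forall i, sg i vJ 0%N = Int l /\ sg i vMM 0%N = Int m) ->
  (forall l sg, (l < m)%N -> J l sg -> dt C sg (J l.+1) c) ->
  J 0 sg -> (forall sg, J m sg -> P sg) ->
  dt [:: for_loop C] sg P (m%:R * (W + c) + W).
Proof.
move=> c0 mM JE hC J0 hP.
have -> : m%:R * (W + c) = \sum_(0 <= l < m) (W + c).
  by rewrite sumr_const_nat subn0 mulr_natl.
apply: (dt_while p0 unit_workW (J := fun l sg => J l sg /\ (l <= m)%N) (c := fun=> c)) => //.
move=> l sg' [Jl lm]; have h := JE _ _ Jl; exists (l < m)%N.
  move=> i; have [h1 h2] := h i.
  have -> : evaln M (sg' i) (Op Leq next (var vMM)) = (l + 1 <= m)%N.
    apply: evn; rewrite /next; ev_by (h1, h2) => //; try exact: ltM.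
    by apply: leq_ltn_trans mM; rewrite addn1 ltnS.
  by rewrite addn1; case: (l < m)%N.
case: ltnP => ml; last by apply: hP; have -> : m = l by apply/eqP; rewrite eqn_leq ml.
by split=> //; apply: dt_le (hC _ _ ml Jl) _ _.
Qed.

Definition pass : expr := Op Mul (var vV) (Op Leq (Read aA (var vJ)) (var vPv)).
Definition live : expr := Op Leq next (var vCNT).

(** [vR] counts the remaining elements below [xs], so [xs] passes exactly if more than [vR] elements
    do. Without a pivot, [vV] is 0, nothing passes and everything is kept. The compaction works in
    place since [vK] never overtakes [vJ]; an iteration past the end of a list also writes at [vK],
    but does not advance it. *)
Definition split : program :=
  [:: asg vAcc (Lit 0); asg vJ (Lit 0)] ++
  [:: for_loop [:: asg vAcc (Op Add (var vAcc) (Op Mul live pass)); asg vJ next]] ++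
  allreduce (Op Add) vC ++
  [:: asg vKp (Op Leq (Op Add (var vR) (Lit 1)) (var vC)); asg vK (Lit 0); asg vJ (Lit 0)] ++
  [:: for_loop [:: asg vX pass; Write aA (var vK) (Read aA (var vJ));
        asg vK (Op Add (var vK) (Op Mul live
          (Op Mul (Op Leq (var vX) (var vKp)) (Op Leq (var vKp) (var vX)))));
        asg vJ next]] ++
  [:: asg vCNT (var vK);
      asg vN (Op Add (Op Mul (var vKp) (var vC))
                (Op Mul (Op Sub (Lit 1) (var vKp)) (Op Sub (var vN) (var vC))));
      asg vR (Op Sub (var vR) (Op Mul (Op Sub (Lit 1) (var vKp)) (var vC)))].

Section Rounds.
Hypothesis BBM : (1000 * B * B <= M)%N.
Variable xs : T.

Let BMx x : (x <= 20 * B)%N -> (x < M)%N.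
Proof. by clear -BM pB p0; lia. Qed.

(* The local elements that may still be the [k]-th smallest one, which is [xs]. *)
Definition state (loc : 'I_p -> seq T) (sg : mem) : Prop :=
  [/\ env sg, (forall i, sg i vCNT 0%N = Int (size (loc i))),
      (forall i j, (j < size (loc i))%N -> sg i aA j = Elt (nth xs (loc i) j)),
      (forall i, sg i vN 0%N = Int (\sum_i size (loc i))%N) &
      (forall i, sg i vR 0%N = Int (\sum_i count (fun y => (y < xs)%O) (loc i))%N)].

Definition restrict (f : pred T) (loc : 'I_p -> seq T) (i : 'I_p) : seq T :=
  [seq y <- loc i | f y == f xs].

Lemma state_frame l loc sg sg' : frame l sg sg' ->
  all (fun a => a \notin l) [:: 0; vCNT; aA; vN; vR]%N -> state loc sg -> state loc sg'.
Proof.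
move=> fr /= /and5P[l0 l1 l2 l3 /andP[l4 _]] [s0 s1 s2 s3 s4]; split.
- exact: env_frame fr l0 s0.
- by move=> i; rewrite fr.
- by move=> i j /s2 h; rewrite fr.
- by move=> i; rewrite fr.
by move=> i; rewrite fr.
Qed.

Definition downset (f : pred T) := forall y z, (y <= z)%O -> f z -> f y.

(** If [f xs] holds, the elements below [xs] and [xs] itself satisfy [f], one more than the left
    side counts; otherwise only elements below [xs] can satisfy [f]. *)
Lemma downset_count (f : pred T) loc : downset f -> (exists i, xs \in loc i) ->
  (\sum_i count (fun y => (y < xs)%O) (loc i) < \sum_(i < p) count f (loc i))%N = f xs.
Proof.
move=> df [i0 xi0]; case: (boolP (f xs)) => fxs; last first.
  rewrite ltnNge leq_sum // => i _; apply: sub_count => y fy.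
  by rewrite ltNge; apply: contra fxs => h; apply: df fy.
rewrite (bigD1 i0) //= [X in (_ < X)%N](bigD1 i0) //= -addSn.
apply: leq_add; last first.
  apply: leq_sum => i _; apply: sub_count => y yx; exact: df (ltW yx) fxs.
apply: leq_trans (_ : count (fun y => (y <= xs)%O) (loc i0) <= _)%N; last first.
  by apply: sub_count => y yx; apply: df yx fxs.
rewrite [X in (_ <= X)%N](eq_count (a2 := predU (pred1 xs) (fun y => (y < xs)%O))); last first.
  by move=> y; rewrite /= le_eqVlt.
have e0 : count (predI (pred1 xs) (fun y => (y < xs)%O)) (loc i0) = 0%N.
  apply/eqP; rewrite eqn0Ngt -has_count; apply/hasPn => y _ /=.
  by case: eqP => // ->; rewrite ltxx.
have := count_predUI (pred1 xs) (fun y => (y < xs)%O) (loc i0); rewrite e0 addn0 => ->.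
by rewrite -add1n leq_add2r -has_count has_pred1.
Qed.

Lemma take_count (f : pred T) (s : seq T) l : count f (take l.+1 s) =
  (count f (take l s) + ((l < size s) && f (nth xs s l)))%N.
Proof.
case: ltnP => h; last by rewrite !take_oversize // ?addn0 // ltnW.
by rewrite (take_nth xs) // -cats1 count_cat /= addn0.
Qed.

Lemma take_filter (f : pred T) (s : seq T) l : [seq y <- take l.+1 s | f y] =
  [seq y <- take l s | f y] ++ (if ((l < size s)%N && f (nth xs s l)) then [:: nth xs s l] else [::]).
Proof.
case: ltnP => h /=; last by rewrite !take_oversize // ?cats0 // ltnW.
by rewrite (take_nth xs) // filter_rcons; case: (f _); rewrite ?cats1 ?cats0.
Qed.

Lemma ev_next (m : store T) l : m vJ 0%N = Int l -> (l.+1 < M)%N -> ev M m next l.+1.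
Proof. by move=> h lM; rewrite /next; ev_by h; rewrite ?addn1 //; apply: ltM. Qed.

Lemma ev_live (m : store T) l c : m vJ 0%N = Int l -> m vCNT 0%N = Int c ->
  (l.+1 < M)%N -> ev M m live (l < c)%N.
Proof.
by move=> h h' lM; apply: ev_leq; [exact: ev_next|ev_by h' => //; exact: ltM|exact: ltM].
Qed.

Definition passes (b : bool) (w : word T) (y : T) : bool := b && leq_word (Elt y) w.

Lemma passes_down b w : downset (passes b w).
Proof.
by move=> y z yz /andP[-> /=]; case: w => //= x; rewrite /passes /=; apply: le_trans.
Qed.

Lemma ev_pass (m : store T) l (b : bool) w y : m vJ 0%N = Int l -> m vV 0%N = Int b ->
  (b -> m vPv 0%N = w) -> m aA l = y -> ev M m pass (b && leq_word y w).
Proof.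
move=> h1 h2 h3' h4; have [w' h3] : exists w', m vPv 0%N = w' by exists (m vPv 0%N).
have -> : b && leq_word y w = b && leq_word y w'.
  by rewrite -h3; case: (b) h3' => // ->.
rewrite -mulnb.
have ltbM (b' : bool) : (b' < M)%N by apply/ltM; case: b'.
apply: ev_mul; [by ev_by h2 => //; apply: ltM| |by rewrite mulnb].
apply: ev_leq_word; [|by rewrite eval_readl ?ltM|exact: ltM].
by apply: eval_read h4; ev_by h1 => //; apply: ltM.
Qed.

Lemma sum_size_restrict f loc :
  (\sum_i size (restrict f loc i) = \sum_i count (fun y => f y == f xs) (loc i))%N.
Proof. by apply: eq_bigr => i _; rewrite size_filter. Qed.

Lemma dt_split loc mm (b : bool) (w : word T) sg :
  state loc sg -> (exists i, xs \in loc i) -> (\sum_i size (loc i) <= B)%N ->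
  (forall i, sg i vMM 0%N = Int mm) -> (forall i, (size (loc i) <= mm)%N) -> (mm <= B)%N ->
  (forall i, sg i vV 0%N = Int b) -> (forall i, b -> sg i vPv 0%N = w) ->
  dt split sg (fun sg' =>
    frame [:: vAcc; vJ; vRcv; vD; aG; vC; vKp; vK; vX; aA; vCNT; vN; vR] sg sg' /\
    state (restrict (passes b w) loc) sg') (mm%:R * (8%:R * W) + logcost *+ 5).
Proof.
move=> st hx totB MME szmm mmB VE PE; set f := passes b w.
have fd : downset f := @passes_down b w.
have h0 := W0; have lcW := logcost_W; have lc0 := logcost_ge0.
have [en CE AE NE RE] := st.
have szB i : (size (loc i) <= B)%N by apply: leq_trans (szmm i) mmB.
have totf (P : pred T) : (\sum_i count P (loc i) <= B)%N.
  by apply: leq_trans totB; apply: leq_sum => i _; apply: count_size.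
have mm0 : 0 <= (mm%:R : R) by [].
have B0 : (0 < B)%N by apply: leq_trans pB.
apply: (dt_le (c := 2%:R * W + ((mm%:R * (W + 2%:R * W) + W) + (logcost *+ 3 + (3%:R * W +
   ((mm%:R * (W + 4%:R * W) + W) + 3%:R * W))))) _ _ (fun _ => id)); last first.
  by rewrite -[logcost *+ 5]mulr_natl -[logcost *+ 3]mulr_natl; lra.
have mmM : (mm.+1 < M)%N by apply: BMx; clear -mmB B0; lia.
have c00 n : 0 <= (n%:R * W) by rewrite mulr_ge0.
have forc0 n : 0 <= mm%:R * (W + n%:R * W) + W by costs.
apply: dt_cat; [exact: dt_writes| |by costs].
move=> sg1 [sg1E fr1]; have en1 := env_frame fr1 isT en.
have sg1E' i : sg1 i = upd (upd (sg i) vAcc 0 (Int 0)) vJ 0 (Int 0).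
  by rewrite sg1E !(exec_set _ (w := Int 0)) ?ltM //; apply/ev_lit/ltM.
pose J1 l sg' := [/\ forall i, sg' i vJ 0%N = Int l, frame [:: vAcc; vJ] sg sg' &
  forall i, sg' i vAcc 0%N = Int (count f (take l (loc i)))].
apply: (dt_cat (P1 := J1 mm)); last by costs.
  apply: (dt_for (J := J1)) => //.
  - by move=> l sg' [h1 h2 _] i; rewrite h1 h2.
  - move=> l sg2 lm [JE2 fr2 Acc2].
    have lM : (l.+1 < M)%N by apply: leq_ltn_trans mmM; rewrite leqW.
    apply: dt_le (dt_writes (C := [:: _; _]) _ _) _ _ => //.
    move=> sg3 [sg3E fr3].
    have sg3E' i : sg3 i = upd (upd (sg2 i) vAcc 0 (Int (count f (take l.+1 (loc i))))) vJ 0 (Int l.+1).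
      rewrite sg3E (exec_set _ (w := Int (count f (take l.+1 (loc i))))) ?ltM //.
        by rewrite (exec_set _ (w := Int l.+1)) ?ltM //; apply: ev_next; rewrite // /upd /= JE2.
      have cM : (count f (take l.+1 (loc i)) < M)%N.
        apply: BMx; apply: leq_trans (count_size _ _) _; rewrite size_take_min.
        by apply: leq_trans (geq_minr _ _) _; have := szB i; clear; lia.
      rewrite -/(ev _ _ _ _) take_count; rewrite take_count in cM.
      apply: ev_add; [by ev_by Acc2 => //; apply: ltM| |exact: cM].
      have C2 : sg2 i vCNT 0%N = Int (size (loc i)) by rewrite fr2.
      case: (ltnP l (size (loc i))) => ls; last first.
        rewrite (_ : (false && _) = (l < size (loc i))%N && (b && leq_word (sg2 i aA l) w)); last first.
          by rewrite ltnNge ls.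
        rewrite -mulnb; apply: ev_mul; [exact: ev_live| |by rewrite mulnb; apply: ltM; case: (_ && _)].
        by apply: ev_pass => //; rewrite fr2 //; apply: PE.
      rewrite (_ : (true && _) = (l < size (loc i))%N && (b && leq_word (sg2 i aA l) w)); last first.
        by rewrite ls /= fr2 // AE.
      rewrite -mulnb; apply: ev_mul; [exact: ev_live| |by rewrite mulnb; apply: ltM; case: (_ && _)].
      by apply: ev_pass => //; rewrite fr2 //; apply: PE.
    split=> [i||i].
    + by rewrite sg3E'.
    + by apply: (frame_sub (frame_cat fr2 fr3)).
    by rewrite sg3E'.
  by split=> [i||i]; rewrite ?sg1E' //= take0.
move=> sg2 [JE2 fr2 Acc2]; have en2 := env_frame fr2 isT en.
have {}Acc2 i : sg2 i vAcc 0%N = Int (ext (fun i => count f (loc i)) i).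
  by rewrite Acc2 ext_ord take_oversize.
apply: dt_cat; last by costs.
  apply: (dt_allreduce (op := addn)) Acc2 => //.
  - exact: ev_opadd.
  by move=> a b' bp /=; apply: BMx; apply: leq_trans (sum_ext_le _ _ bp) _;
    apply: leq_trans (totf f) _; clear; lia.
move=> sg3 [fr3 _ C3]; have en3 := env_frame fr3 isT en2.
set C := (\sum_i count f (loc i))%N.
have {}C3 i : sg3 i vC 0%N = Int C by rewrite C3 /= sum_ext.
have CB : (C <= B)%N := totf f.
set r := (\sum_i count (fun y => (y < xs)%O) (loc i))%N.
have rB : (r <= B)%N := totf _.
have R3 i : sg3 i vR 0%N = Int r by rewrite fr3 // fr2.
have KpE : (r < C)%N = f xs by apply: downset_count.
apply: dt_cat; [exact: dt_writes| |by costs].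
move=> sg4 [sg4E fr4].
have sg4E' i : sg4 i = upd (upd (upd (sg3 i) vKp 0 (Int (f xs))) vK 0 (Int 0)) vJ 0 (Int 0).
  rewrite sg4E (exec_set _ (w := Int (f xs))) ?ltM //; last first.
    rewrite -/(ev _ _ _ _) -KpE; ev_by (R3, C3); rewrite ?addn1 //; try exact: ltM.
    by apply: BMx; clear -rB B0; lia.
  by rewrite !(exec_set _ (w := Int 0)) ?ltM //; apply/ev_lit/ltM.
pose g y := f y == f xs.
(* The kept elements come first and the cells from [l] on are untouched; the last branch says
   nothing about the cells in between. *)
pose J2 l sg' := [/\ forall i, sg' i vJ 0%N = Int l, frame [:: vX; aA; vK; vJ] sg4 sg',
  forall i, sg' i vK 0%N = Int (count g (take l (loc i))) &
  forall i j, sg' i aA j = if (j < count g (take l (loc i)))%N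
     then Elt (nth xs (seq.filter g (take l (loc i))) j) else
     if (l <= j < size (loc i))%N then Elt (nth xs (loc i) j) else sg' i aA j].
have fr04 := frame_cat fr2 (frame_cat fr3 fr4).
apply: (dt_cat (P1 := J2 mm)); last by costs.
  apply: (dt_for (J := J2)) => //.
  - by move=> l sg' [h1 h2 _ _] i; rewrite h1 h2 // fr04.
  - move=> l sg5 lm [JE5 fr5 K5 A5].
    have lM : (l.+1 < M)%N by apply: leq_ltn_trans mmM; rewrite leqW.
    apply: dt_le (dt_writes (C := [:: _; _; _; _]) _ _) _ _ => //.
    move=> sg6 [sg6E fr6].
    have cl i : (count g (take l (loc i)) <= l)%N.
      apply: leq_trans (count_size _ _) _; rewrite size_take_min; exact: geq_minl.
    have sg6E' i : sg6 i = upd (upd (upd (upd (sg5 i) vX 0 (Int (b && leq_word (sg5 i aA l) w)))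
         aA (count g (take l (loc i))) (sg5 i aA l)) vK 0 (Int (count g (take l.+1 (loc i))))) vJ 0 (Int l.+1).
      have X5 : ev M (sg5 i) pass (b && leq_word (sg5 i aA l) w).
        by apply: ev_pass => //; rewrite fr5 // fr04 //; apply: PE.
      rewrite sg6E (exec_set _ (w := Int (b && leq_word (sg5 i aA l) w))) ?ltM //.
      rewrite (exec_write _ (x := count g (take l (loc i))) (w := sg5 i aA l)); first last.
      - by apply: (eval_read (x := l)); [ev_by JE5 => //; apply: ltM|].
      - by ev_by K5 => //; apply: ltM.
      set m1 := upd _ aA _ _.
      have X1 : m1 vX 0%N = Int (b && leq_word (sg5 i aA l) w) by [].
      have J1' : m1 vJ 0%N = Int l by rewrite /m1 /upd /= JE5.
      have C1 : m1 vCNT 0%N = Int (size (loc i)) by rewrite /m1 /upd /= fr5 // fr04.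
      have K1 : m1 vK 0%N = Int (count g (take l (loc i))) by rewrite /m1 /upd /= K5.
      have Kp1 : m1 vKp 0%N = Int (f xs) by rewrite /m1 /upd /= fr5 // sg4E'.
      rewrite (exec_set _ (w := Int (count g (take l.+1 (loc i))))) ?ltM //; last first.
        have cM : (count g (take l.+1 (loc i)) < M)%N.
          apply: BMx; apply: leq_trans (count_size _ _) _; rewrite size_take_min.
          by apply: leq_trans (geq_minr _ _) _; have := szB i; clear; lia.
        rewrite -/(ev _ _ _ _) take_count; rewrite take_count in cM.
        apply: ev_add; [by ev_by K1 => //; apply: ltM| |exact: cM].
        have Xb : ((l < size (loc i)) && g (nth xs (loc i) l))%N =
            (l < size (loc i))%N && ((b && leq_word (sg5 i aA l) w) == f xs).
          case: ltnP => //= ls; rewrite A5 ltnNge cl /= leqnn ls /=; congr (_ == _).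
        rewrite Xb -mulnb; have b1 (x : bool) : (x < M)%N by apply/ltM; case: x.
        apply: ev_mul; [exact: ev_live| |by rewrite mulnb; apply: b1].
        apply: (@ev_eq _ _ _ _ _ _ (((b && leq_word (sg5 i aA l) w) <= f xs) *
           (f xs <= (b && leq_word (sg5 i aA l) w)))%N); last first.
          by case: (b && _); case: (f xs).
        by ev_by (X1, Kp1) => //; try exact: ltM; rewrite mulnb.
      by rewrite (exec_set _ (w := Int l.+1)) ?ltM //; apply: ev_next; rewrite // /upd /= JE5.
    split=> [i||i|i j].
    + by rewrite sg6E'.
    + by apply: (frame_sub (frame_cat fr5 fr6)).
    + by rewrite sg6E'.
    have clj := cl i.
    rewrite sg6E' /upd /= take_count take_filter.
    have szg : size [seq y <- take l (loc i) | g y] = count g (take l (loc i)).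
      by rewrite size_filter.
    have Al : (l < size (loc i))%N -> sg5 i aA l = Elt (nth xs (loc i) l).
      by move=> ls; rewrite A5 ltnNge clj /= leqnn ls.
    rewrite nth_cat szg; case: (ltngtP j (count g (take l (loc i)))) => jc.
    + by rewrite ltn_addr // A5 jc.
    + have hl : (j < count g (take l (loc i)) + ((l < size (loc i)) && g (nth xs (loc i) l)))%N = false.
        by apply/negbTE; rewrite -leqNgt; case: (_ && _); rewrite ?addn1 ?addn0 // ltnW.
      rewrite hl; case: (boolP (l < j < size (loc i))%N) => // /andP[lj js].
      by rewrite A5 ltnNge (ltnW jc) /= (ltnW lj) js.
    case: (boolP ((l < size (loc i))%N && g (nth xs (loc i) l))) => [/andP[ls gl]|ngl].
      by rewrite jc addn1 ltnSn subnn /= Al.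
    by rewrite /= addn0 jc ltnn [(l < _)%N]ltnNge clj.
  split=> [i||i|i j].
  - by rewrite sg4E'.
  - by [].
  - by rewrite sg4E' /= take0.
  rewrite take0 /=; case: ifP => // js; rewrite sg4E' /upd /=.
  by rewrite fr3 // fr2 // AE.
move=> sg5 [JE5 fr5 K5 A5].
apply: dt_le (dt_writes (C := [:: _; _; _]) _ _) _ _ => //.
move=> sg6 [sg6E fr6].
have fr05 := frame_cat fr04 (frame_cat fr5 fr6).
have takemm i : take mm (loc i) = loc i by rewrite take_oversize.
set N := (\sum_i size (loc i))%N.
have NB : (N <= B)%N := totB.
have Cg : (\sum_i count g (loc i))%N = if f xs then C else (N - C)%N.
  rewrite /g; case: (f xs).
    by apply: eq_bigr => i _; apply: eq_count => y; rewrite eqb_id.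
  have -> : N = (C + \sum_i count (fun y => f y == false) (loc i))%N.
    rewrite -big_split /=; apply: eq_bigr => i _; rewrite -(count_predC f).
    by congr (_ + _)%N; apply: eq_count => y; rewrite /= eqbF_neg.
  by rewrite addKn.
have Rg : (\sum_i count (fun y => (y < xs)%O) (seq.filter g (loc i)))%N = if f xs then r else (r - C)%N.
  rewrite /g; case: (boolP (f xs)) => fxs.
    apply: eq_bigr => i _; rewrite count_filter; apply: eq_count => y /=.
    by case: ltP => //= yx; rewrite (fd _ _ (ltW yx)).
  have -> : r = (C + \sum_i count (fun y => (y < xs)%O) [seq y <- loc i | f y == false])%N.
    rewrite -big_split /=; apply: eq_bigr => i _; rewrite count_filter.
    rewrite -(count_predUI f); set z := count (predI _ _) _.
    have -> : z = 0%N.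
      apply/eqP; rewrite eqn0Ngt -has_count; apply/hasPn => y _ /=.
      by case: (f y); rewrite ?andbF.
    rewrite addn0; apply: eq_count => y /=; case: (boolP (f y)) => fy /=.
      by rewrite ltNge; apply: contra fxs => h; apply: fd fy.
    by rewrite andbT.
  by rewrite addKn.
have sg6E' i : sg6 i = upd (upd (upd (sg5 i) vCNT 0 (Int (count g (loc i))))
    vN 0 (Int (\sum_i count g (loc i))%N)) vR 0 (Int (\sum_i count (fun y => (y < xs)%O) (seq.filter g (loc i)))%N).
  have Kp5 : sg5 i vKp 0%N = Int (f xs) by rewrite fr5 // sg4E'.
  have C5 : sg5 i vC 0%N = Int C by rewrite fr5 // fr4.
  have N5 : sg5 i vN 0%N = Int N by rewrite fr5 // fr04.
  have R5 : sg5 i vR 0%N = Int r by rewrite fr5 // fr4.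
  rewrite sg6E (exec_set _ (w := Int (count g (loc i)))) ?ltM //; last first.
    by rewrite eval_readl ?ltM // K5 takemm.
  rewrite (exec_set _ (w := Int (\sum_i count g (loc i))%N)) ?ltM //; last first.
  { rewrite -/(ev _ _ _ _) Cg; ev_by (Kp5, C5, N5) => //; try exact: ltM.
    all: try by case: (f xs); rewrite /= ?subnn ?subn0 ?mul0n ?mul1n ?addn0 ?add0n.
    all: apply: BMx; case: (f xs); clear -NB CB; lia. }
  rewrite (exec_set _ (w := Int (\sum_i count (fun y => (y < xs)%O) (seq.filter g (loc i)))%N)) ?ltM //.
  { rewrite -/(ev _ _ _ _) Rg; ev_by (Kp5, C5, R5) => //; try exact: ltM.
    all: try by case: (f xs); rewrite /= ?subnn ?mul0n ?subn0 ?mul1n.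
    all: apply: BMx; case: (f xs); clear -NB CB rB; lia. }
split.
  by apply: (frame_sub fr05).
split.
- exact: env_frame fr05 isT en.
- by move=> i; rewrite sg6E' /upd /= /restrict size_filter.
- move=> i j; rewrite /restrict size_filter => jc.
  by rewrite sg6E' /upd /= A5 takemm jc.
- by move=> i; rewrite sg6E' /upd /= sum_size_restrict.
by move=> i; rewrite sg6E' /upd /=.
Qed.

Lemma state_restrict f g loc sg : (forall y, (f y == f xs) = (g y == g xs)) ->
  state (restrict f loc) sg -> state (restrict g loc) sg.
Proof.
move=> fg; suff -> : restrict g loc = restrict f loc by [].
by apply: funext => i; apply: eq_filter => y; rewrite fg.
Qed.

(** * Ranks with respect to a sample *)

Definition below (Z : seq T) (y : T) : nat := count (fun z => (z < y)%O) Z.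

Lemma below_le Z y : (below Z y <= size Z)%N.
Proof. exact: count_size. Qed.

Lemma below_mono Z x y : (x <= y)%O -> (below Z x <= below Z y)%N.
Proof. by move=> xy; apply: sub_count => z zx; apply: lt_le_trans zx xy. Qed.

Lemma below_lt Z x y : x \in Z -> (x < y)%O -> (below Z x < below Z y)%N.
Proof.
move=> xZ xy; rewrite /below -addn1.
have e0 : count (predI (pred1 x) (fun z => (z < x)%O)) Z = 0%N.
  apply/eqP; rewrite eqn0Ngt -has_count; apply/hasPn => z _ /=.
  by case: eqP => // ->; rewrite ltxx.
have := count_predUI (pred1 x) (fun z => (z < x)%O) Z; rewrite e0 addn0 => e.
apply: leq_trans (_ : count (predU (pred1 x) (fun z => (z < x)%O)) Z <= _)%N; last first.
  by apply: sub_count => z /= /orP[/eqP ->|zx] //; apply: lt_trans zx xy.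
by rewrite e addnC leq_add2r -has_count has_pred1.
Qed.

Lemma below_lt_size Z x : x \in Z -> (below Z x < size Z)%N.
Proof.
move=> xZ; rewrite ltn_neqAle below_le andbT -all_count; apply/allPn.
by exists x; rewrite ?ltxx.
Qed.

Lemma below_surj Z j : uniq Z -> (j < size Z)%N ->
  exists2 u, (u < size Z)%N & below Z (nth xs Z u) = j.
Proof.
move=> uZ jZ; pose Z' := sort <=%O Z.
have sz : size Z' = size Z by rewrite size_sort.
have zZ : nth xs Z' j \in Z by rewrite -(mem_sort <=%O) mem_nth ?sz.
exists (index (nth xs Z' j) Z); rewrite ?index_mem // nth_index // /below.
rewrite -(permP (permEl (perm_sort <=%O Z))) /= count_lt_nth ?sz //.
by rewrite sort_lt_sorted.
Qed.

Lemma rank_below Z u : rank (size Z) (nth xs Z) u = below Z (nth xs Z u).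
Proof.
rewrite /rank /below -sum1_count (big_nth xs) [RHS]big_mkcond /=.
by apply: eq_bigr => v _; case: (_ < _)%O.
Qed.

(* Broadcasts the item of rank [jq], counted from 1, if there is one. *)
Definition pick (jq : expr) : program :=
  broadcast (Op Mul (Op Leq (Lit 1) (var vRk))
    (Op Mul (Op Leq (var vRk) jq) (Op Leq jq (var vRk)))) (var vIt) ++
  [:: asg vV (var aG); asg vPv (Read aG (Lit 1))].

Definition ranked (Z : seq T) (sg : mem) : Prop :=
  forall t : 'I_p, let S := size Z in let u := ((t %/ S.+1) %% S)%N in
      sg t vRk 0%N = Int (((0 < S) && (S <= t %% S.+1))%N * (rank S (nth xs Z) u).+1) /\
      ((0 < S)%N -> sg t vIt 0%N = Elt (nth xs Z u)).

(** The element of rank [j], counted from 1, has [j - 1] sampled ones below it, so [y] exceeds it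
    exactly if [j <= below Z y]. In this form ranks outside the sample are harmless: for [j = 0] the
    comparison always holds, for [j > size Z] never, and the absent pivot accordingly separates
    nothing. *)
Lemma dt_pick Z j a sg : uniq Z -> (size Z * (size Z).+1 <= p)%N ->
  env sg -> ranked Z sg -> a \notin [:: aG; vV; vPv] -> (forall i, sg i a 0%N = Int j) ->
  dt (pick (var a)) sg (fun sg' => frame [:: aG; vD; vV; vPv] sg sg' /\
    exists b w, [/\ forall i, sg' i vV 0%N = Int (b : bool), forall i, b -> sg' i vPv 0%N = w &
      forall y, (passes b w y == passes b w xs) =
        ((j <= below Z y)%N == (j <= below Z xs)%N)]) (logcost *+ 2).
Proof.
move=> uZ SS en rk na aE; have h0 := W0; have lcW := logcost_W.
set S := size Z.
have pM x : (x <= 8 * p)%N -> (x < M)%N by clear -BM pB p0; lia.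
have Sp : (S <= p)%N by apply: leq_trans SS; rewrite leq_pmulr.
pose u (t : 'I_p) := ((t %/ S.+1) %% S)%N.
pose b (t : 'I_p) := [&& (0 < S)%N, (S <= t %% S.+1)%N & (below Z (nth xs Z (u t))).+1 == j].
have rkE (t : 'I_p) : sg t vRk 0%N = Int (((0 < S) && (S <= t %% S.+1))%N * (below Z (nth xs Z (u t))).+1).
  by have [-> _] := rk t; rewrite rank_below.
apply: (dt_le (c := (2%:R * W + logcost) + 2%:R * W) _ _ (fun _ => id)); last first.
  by rewrite -[logcost *+ 2]mulr_natl; lra.
apply: dt_cat; last by costs.
  apply: (dt_broadcast (b := b) (u := fun t => Elt (nth xs Z (u t)))) => //.
  - move=> t; rewrite /b; have h1 := rkE t; have h2 := aE t.
    set x := ((_ && _) * _)%N in h1.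
    have -> : [&& (0 < S)%N, (S <= t %% S.+1)%N & (below Z (nth xs Z (u t))).+1 == j] =
       ((1 <= x) * ((x <= j) * (j <= x)))%N :> nat.
      rewrite !mulnb -eqn_leq /x; case: (0 < S)%N; case: (S <= _)%N => //=.
      by rewrite mul1n.
    have b1 (c : bool) : (c < M)%N by apply: ltM; case: c.
    by ev_by (h1, h2) => //; try exact: ltM; rewrite ?mulnb.
  move=> t /and3P[S0 _ _]; rewrite eval_readl ?ltM // /upd /=.
  by have [_ ->] := rk t.
move=> sg1 [fr1 nob hasb]; have en1 := env_frame fr1 isT en.
apply: dt_le (dt_writes (C := [:: _; _]) _ _) _ _ => // sg2 [sg2E fr2].
split; first by apply: (frame_sub (frame_cat fr1 fr2)).
have sg2E' i : sg2 i = upd (upd (sg1 i) vV 0 (sg1 i aG 0%N)) vPv 0 (sg1 i aG 1%N).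
  rewrite sg2E (exec_set _ (w := sg1 i aG 0%N)) ?ltM ?eval_readl ?ltM //.
  by rewrite (exec_set _ (w := sg1 i aG 1%N)) ?ltM ?eval_readl ?ltM.
have [jS|jS] := boolP (0 < j <= S)%N; last first.
  have nb i : ~~ b i.
    apply/negP => /and3P[S0 _ /eqP jE]; move: jS; rewrite -jE /= => /negP; apply.
    by apply/below_lt_size/mem_nth; rewrite ltn_mod.
  exists false, (Int 0); split=> [i|//|y]; first by rewrite sg2E' /upd /= nob.
  rewrite /passes /= eqxx; symmetry; apply/eqP.
  case: (posnP j) => [->|j0]; first by rewrite !leq0n.
  have Sj : (S < j)%N by rewrite ltnNge; apply: contra jS => ->; rewrite j0.
  by rewrite leqNgt (leq_ltn_trans (below_le Z y) Sj) leqNgt (leq_ltn_trans (below_le Z xs) Sj).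
have /andP[j0 jS'] := jS.
have [u0 u0S u0E] : exists2 u, (u < S)%N & below Z (nth xs Z u) = j.-1.
  by apply: below_surj => //; rewrite prednK.
set z := nth xs Z u0 in u0E.
have zZ : z \in Z by apply: mem_nth.
(* The last PE of row [u0] carries the rank of [z], and the size condition ensures that it
   exists. *)
have t0p : (u0 * S.+1 + S < p)%N.
  by apply: leq_trans SS; rewrite -addnS addnC -mulSn leq_mul2r u0S orbT.
pose t0 : 'I_p := Ordinal t0p.
have ut0 : u t0 = u0 by rewrite /u /= divnMDl // divn_small // addn0 modn_small.
have bt0 : b t0.
  rewrite /b ut0 /= modnMDl modn_small // leqnn -/z u0E prednK // eqxx.
  by rewrite (leq_ltn_trans _ u0S).
have inj t : b t -> nth xs Z (u t) = z.
  case/and3P=> S0 _ /eqP bE; have zZ' : nth xs Z (u t) \in Z by rewrite mem_nth // ltn_mod.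
  case: (ltgtP (nth xs Z (u t)) z) => // lt.
    by have := below_lt zZ' lt; rewrite u0E -bE ltnn.
  by have := below_lt zZ lt; rewrite u0E -bE ltnn.
have {}hasb := hasb t0 (Elt z) bt0.
have {}hasb i : sg1 i aG 0%N = Int 1 /\ sg1 i aG 1%N = Elt z.
  by apply: hasb => t /inj ->.
exists true, (Elt z); split=> [i|i _|y].
- by rewrite sg2E' /upd /=; have [-> _] := hasb i.
- by rewrite sg2E' /upd /=; have [_ ->] := hasb i.
have pE x : passes true (Elt z) x = ~~ (j <= below Z x)%N.
  rewrite /passes /= -ltnNge; case: leP => xz.
    by have := below_mono Z xz; rewrite u0E -ltnS prednK.
  by have := below_lt zZ xz; rewrite u0E prednK // ltnNge => ->.
by rewrite !pE; case: (_ <= _)%N; case: (_ <= _)%N.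
Qed.

Lemma dt_pick_split Z j a loc mm sg : uniq Z -> (size Z * (size Z).+1 <= p)%N ->
  ranked Z sg -> a \notin [:: aG; vV; vPv] -> (forall i, sg i a 0%N = Int j) ->
  state loc sg -> (exists i, xs \in loc i) -> (\sum_i size (loc i) <= B)%N ->
  (forall i, sg i vMM 0%N = Int mm) -> (forall i, (size (loc i) <= mm)%N) -> (mm <= B)%N ->
  dt (pick (var a) ++ split) sg (fun sg' =>
    frame [:: vV; vPv; vAcc; vJ; vRcv; vD; aG; vC; vKp; vK; vX; aA; vCNT; vN; vR] sg sg' /\
    state (restrict (fun y => j <= below Z y)%N loc) sg') (mm%:R * (8%:R * W) + logcost *+ 7).
Proof.
move=> uZ SS rk na aE st hx tot MME szmm mmB; have lc0 := logcost_ge0.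
have [en _ _ _ _] := st; have h0 := W0.
apply: (dt_le (c := logcost *+ 2 + (mm%:R * (8%:R * W) + logcost *+ 5)) _ _ (fun _ => id)); last first.
  by rewrite addrCA -mulrnDr.
apply: dt_cat; [exact: (dt_pick uZ SS en rk na aE)| |by costs].
move=> sg1 [fr1 [b [w [VE PE fE]]]].
apply: dt_le (dt_split (b := b) (w := w) _ hx tot _ szmm mmB VE PE) _ _ => //.
- exact: state_frame fr1 _ st.
- by move=> i; rewrite fr1.
move=> sg2 [fr2 st2]; split; first by apply: (frame_sub (frame_cat fr1 fr2)).
exact: state_restrict fE st2.
Qed.

(** * Sampling *)

Notation rnd := {ffun 'I_p -> 'I_(M`!)}.
Notation vM0 := 29%N.
Notation vJL := 39%N.
Notation vJH := 40%N.

(** A PE draws numbers also past the end of its list, and [live] discards them, so that all PEs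
    consume the same number of random rows. *)
Definition sample_loop : instr :=
  for_loop [:: Draw vX (Lit 0) (Op Add (var vN) (var vN));
    Write aB (var vSC) (Read aA (var vJ));
    asg vSC (Op Add (var vSC) (Op Mul live
      (Op Leq (Op Add (var vX) (Lit 1)) (Op Mul (var vU) (var vU)))));
    asg vJ next].

(* The elements that PE [i] samples, [pre] being its random numbers. *)
Definition sampled (N U : nat) (loc : 'I_p -> seq T) (pre : seq rnd) (i : 'I_p) : seq T :=
  mask [seq ((r : rnd) i %% maxn 1 (N + N) < U * U)%N | r <- pre] (loc i).

Lemma mask_step (m : bitseq) b (s : seq T) : mask (rcons m b) s =
  mask m s ++ (if (size m < size s)%N && b then [:: nth xs s (size m)] else [::]).
Proof.
elim: m s => [|a m IH] [|x s] /=.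
- by case: (b).
- by case: (b); rewrite ?mask0s.
- by [].
by rewrite IH ltnS; case: a.
Qed.

Lemma sampled_size N U loc pre i : (size (sampled N U loc pre i) <= size (loc i))%N.
Proof. by apply/size_subseq/mask_subseq. Qed.

(** Apart from the running costs, the credit inside the loop is the conditional mean of [f] given
    the rows drawn so far. It is a martingale, so each draw can pay for its outcomes. *)
Lemma wp_sample_loop N U loc mm (f : seq rnd -> R) Q sg x :
  env sg -> (forall i, sg i vCNT 0%N = Int (size (loc i))) ->
  (forall i j, (j < size (loc i))%N -> sg i aA j = Elt (nth xs (loc i) j)) ->
  (forall i, sg i vN 0%N = Int N) -> (N <= B)%N ->
  (forall i, sg i vU 0%N = Int U) -> (U <= B)%N ->
  (forall i, sg i vMM 0%N = Int mm) -> (mm <= B)%N ->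
  (forall i, sg i vJ 0%N = Int 0) -> (forall i, sg i vSC 0%N = Int 0) ->
  (forall i, (size (loc i) <= B)%N) ->
  (forall pre, 0 <= f pre) ->
  (forall (ws : mm.-tuple rnd) sg' x', frame [:: vX; aB; vSC; vJ] sg sg' ->
     (forall i, sg' i vSC 0%N = Int (size (sampled N U loc ws i))) ->
     (forall i j, (j < size (sampled N U loc ws i))%N ->
        sg' i aB j = Elt (nth xs (sampled N U loc ws i) j)) ->
     f ws <= x' -> Q sg' x') ->
  mm%:R * (5%:R * W) + W + avg (fun ws : mm.-tuple rnd => f ws) <= x ->
  wp M alpha beta final [:: sample_loop] Q sg x.
Proof.
move=> en CE AE NE NB UE UB MME mmB J0 SC0 szB f0 hQ hx; have h0 := W0.
pose I sg' y := exists pre : seq rnd,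
  [/\ (size pre <= mm)%N /\ frame [:: vX; aB; vSC; vJ] sg sg',
      (forall i, sg' i vSC 0%N = Int (size (sampled N U loc pre i))) /\
      (forall i, sg' i vJ 0%N = Int (size pre)),
      (forall i j, (j < size (sampled N U loc pre i))%N ->
        sg' i aB j = Elt (nth xs (sampled N U loc pre i) j)) &
      (mm - size pre)%:R * (5%:R * W) + W +
        avg (fun ws : (mm - size pre).-tuple rnd => f (pre ++ ws)) <= y].
have B0 : (0 < B)%N by apply: leq_trans pB.
apply: (wp_while p0 unit_workW (I := I)) => //; last first.
  exists [::]; split=> //.
  by rewrite /= subn0.
move=> sg1 y [pre [[sp fr1] [SC1 J1] B1 hy]].
have MM1 i : sg1 i vMM 0%N = Int mm by rewrite fr1.
have lM : ((size pre).+1 < M)%N by apply: BMx; clear -sp mmB B0; lia.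
exists (size pre < mm)%N.
  move=> i; have -> : evaln M (sg1 i) (Op Leq next (var vMM)) = (size pre < mm)%N.
    apply: evn; apply: ev_leq; [exact: ev_next|by ev_by MM1 => //; apply: ltM|exact: ltM].
  by case: (_ < _)%N.
case: ltnP => lmm; last first.
  have e : size pre = mm by apply/eqP; rewrite eqn_leq sp.
  move: hy; rewrite e subnn mul0r add0r avg_tuple0 cats0 => hy.
  have fp := f0 pre; split; first by lra.
  apply: (hQ (tcast e (in_tuple pre))); rewrite ?val_tcast //=; by lra.
set l := size pre in lM hy lmm *.
have ml : (mm - l = (mm - l.+1).+1)%N by rewrite subnSK.
move: hy; rewrite ml avg_tupleS -natr1; set m := (mm - l.+1)%N => hy.
apply: (wp_draw p0 unit_workW (g := fun v => m%:R * (5%:R * W) + W + 3%:R * W +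
    avg (fun w : m.-tuple rnd => f (pre ++ v :: w)))); [by []| |]; last first.
  by rewrite avgD avg_cst ?card_rnd //=; lra.
move=> r; set sg2 := fun j => _.
have N1 i : sg1 i vN 0%N = Int N by rewrite fr1.
have sg2E i : sg2 i = upd (sg1 i) vX 0 (Int (r i %% maxn 1 (N + N))).
  rewrite /sg2 evaln_lit ?ltM // write_blockE; congr (upd _ _ _ (Int (_ %% maxn 1 _))).
  by apply: evn; ev_by N1 => //; try exact: ltM; apply: BMx; clear -NB; lia.
have fr2 : frame [:: vX] sg1 sg2.
  by move=> i a z; rewrite sg2E /upd inE => /negPf ->.
have [_] := dt_writes (C := behead [:: Draw vX (Lit 0) (Op Add (var vN) (var vN));
    Write aB (var vSC) (Read aA (var vJ));
    asg vSC (Op Add (var vSC) (Op Mul live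
      (Op Leq (Op Add (var vX) (Lit 1)) (Op Mul (var vU) (var vU)))));
    asg vJ next]) sg2 isT; apply.
  have : 0 <= avg (fun w : m.-tuple rnd => f (pre ++ r :: w)) by apply: avg_ge0.
  have : 0 <= m%:R * (5%:R * W) by costs.
  by rewrite /=; lra.
move=> sg3 x3 [sg3E fr3] hx3; exists (rcons pre r).
have szr : size (rcons pre r) = l.+1 by rewrite size_rcons.
have sE i : sampled N U loc (rcons pre r) i = sampled N U loc pre i ++
   (if (l < size (loc i))%N && (r i %% maxn 1 (N + N) < U * U)%N then [:: nth xs (loc i) l] else [::]).
  by rewrite /sampled map_rcons mask_step size_map.
have szs i : (size (sampled N U loc (rcons pre r) i) <= B)%N.
  exact: leq_trans (sampled_size _ _ _ _ _) (szB i).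
have sg3E' i : sg3 i = upd (upd (upd (sg2 i) aB (size (sampled N U loc pre i)) (sg1 i aA l))
   vSC 0 (Int (size (sampled N U loc (rcons pre r) i)))) vJ 0 (Int l.+1).
  have SC2 : sg2 i vSC 0%N = Int (size (sampled N U loc pre i)) by rewrite fr2.
  have J2 : sg2 i vJ 0%N = Int l by rewrite fr2.
  rewrite sg3E /behead (exec_write _ (x := size (sampled N U loc pre i)) (w := sg1 i aA l)); first last.
  - by apply: (eval_read (x := l)); [ev_by J2 => //; apply: ltM|rewrite fr2].
  - by ev_by SC2 => //; apply: ltM.
  set m1 := upd _ aB _ _.
  have U1 : m1 vU 0%N = Int U by rewrite /m1 /upd /= fr2 // fr1.
  have X1 : m1 vX 0%N = Int (r i %% maxn 1 (N + N)) by rewrite /m1 sg2E /upd.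
  have SC1' : m1 vSC 0%N = Int (size (sampled N U loc pre i)) by rewrite /m1 /upd /= SC2.
  have J1' : m1 vJ 0%N = Int l by rewrite /m1 /upd /= J2.
  have C1 : m1 vCNT 0%N = Int (size (loc i)) by rewrite /m1 /upd /= fr2 // fr1.
  have UUM : (U * U < M)%N.
    apply: leq_ltn_trans (leq_mul UB UB) _; apply: leq_trans BBM.
    by rewrite -mulnA ltn_Pmull // muln_gt0 B0.
  have xM : ((r i %% maxn 1 (N + N)).+1 < M)%N.
    have h : (r i %% maxn 1 (N + N) < maxn 1 (N + N))%N by rewrite ltn_mod leq_max.
    by apply: BMx; move: h; clear -NB B0; lia.
  have b1 (z : bool) : (z < M)%N by apply/ltM; case: z.
  rewrite (exec_set _ (w := Int (size (sampled N U loc (rcons pre r) i)))) ?ltM //; last first.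
    rewrite -/(ev _ _ _ _) sE size_cat.
    have -> : size (if (l < size (loc i))%N && (r i %% maxn 1 (N + N) < U * U)%N
        then [:: nth xs (loc i) l] else [::]) =
        ((l < size (loc i)) * (r i %% maxn 1 (N + N) < U * U))%N.
      by rewrite mulnb; case: (_ && _).
    apply: ev_add; [by ev_by SC1' => //; apply: ltM| |].
      apply: ev_mul; [exact: ev_live| |by rewrite mulnb].
      by rewrite -addn1; ev_by (X1, U1) => //; rewrite ?addn1 //; exact: ltM.
    apply: BMx; have := leq_trans (sampled_size N U loc pre i) (szB i).
    by rewrite mulnb; case: (_ && _); clear -B0; lia.
  rewrite (exec_set _ (w := Int l.+1)) ?ltM //; by apply: ev_next.
split.
- by rewrite szr; split=> //; apply: (frame_sub (frame_cat fr1 (frame_cat fr2 fr3))).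
- by split=> i; rewrite sg3E' // szr.
- move=> i j; rewrite sg3E' sE size_cat nth_cat /upd /= => hj.
  case: (ltngtP j (size (sampled N U loc pre i))) => js.
  + by rewrite fr2 // B1.
  + by move: hj js; case: (_ && _) => /=; clear; lia.
  rewrite js subnn; move: hj; rewrite js; case: ifP => [/andP[ls _] _|_] /=.
    by rewrite fr1 // AE.
  by rewrite addn0 ltnn.
move: hx3; rewrite szr -/m.
rewrite (eq_avg (g := fun ws : m.-tuple rnd => f (pre ++ r :: ws))) => [|ws]; last first.
  by rewrite cat_rcons.
by rewrite /=; lra.
Qed.

(** * Collecting a sample *)

Lemma nth_codom_ord (samp : 'I_p -> seq T) (i : 'I_p) : nth [::] (codom samp) i = samp i.
Proof. by rewrite codomE (nth_map i) ?size_enum_ord // nth_ord_enum. Qed.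

Lemma nth_shape_codom (samp : 'I_p -> seq T) (i : 'I_p) :
  nth 0%N (shape (codom samp)) i = size (samp i).
Proof. by rewrite (nth_map [::]) ?size_codom ?card_ord // nth_codom_ord. Qed.

Lemma cum_ext_take (samp : 'I_p -> seq T) j : (j <= p)%N ->
  cum (ext (fun i => size (samp i))) j = sumn (take j (shape (codom samp))).
Proof.
have szsh : size (shape (codom samp)) = p by rewrite size_map size_codom card_ord.
elim: j => [|j IH] jp; first by rewrite take0 /cum big_geq.
rewrite cumS IH ?(ltnW jp) // (take_nth 0%N) ?szsh //.
rewrite -cats1 sumn_cat /= addn0; congr (_ + _)%N.
by rewrite -[j]/(nat_of_ord (Ordinal jp)) ext_ord nth_shape_codom.
Qed.

Lemma flatten_owner (samp : 'I_p -> seq T) :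
  let m := ext (fun i => size (samp i)) in
  exists own : 'I_p -> 'I_p, forall t : 'I_p, (t < cum m p)%N ->
    [/\ owners m (own t), (cum m (own t) <= t < cum m (own t) + m (own t))%N &
        nth xs (samp (own t)) (t - cum m (own t)) = nth xs (flatten (codom samp)) t].
Proof.
move=> m; set sh := shape (codom samp).
have szsh : size sh = p by rewrite size_map size_codom card_ord.
have mE (i : 'I_p) : m i = nth 0%N sh i by rewrite /m ext_ord nth_shape_codom.
have totE : cum m p = sumn sh by rewrite cum_ext_take // take_oversize ?szsh.
exists (fun t : 'I_p => insubd t (reshape_index sh t)) => t; rewrite totE => tS.
set o := insubd _ _; have rp : (reshape_index sh t < p)%N by have := reshape_indexP tS; rewrite szsh.
have oE : o = reshape_index sh t :> nat by rewrite val_insubd rp.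
have cE : cum m o = sumn (take (reshape_index sh t) sh) by rewrite cum_ext_take ?(ltnW (ltn_ord o)) // oE.
have ct : (cum m o + reshape_offset sh t)%N = t by rewrite cE -[RHS](reshape_indexK sh).
have off : (reshape_offset sh t < m o)%N by rewrite mE oE; apply: reshape_offsetP.
split.
- by rewrite /owners; apply: leq_ltn_trans off.
- by apply/andP; split; [rewrite -[X in (_ <= X)%N]ct leq_addr|rewrite -[X in (X < _)%N]ct ltn_add2l].
by rewrite nth_flatten -/sh -{1}ct addKn -oE nth_codom_ord.
Qed.

(** The flag [vX] multiplies all counts and thereby empties an oversized sample without a branch;
    the same code then runs on the empty sample. *)
Definition collect : program :=
  [:: asg vAcc (var vSC)] ++ allreduce (Op Add) vS ++
  [:: asg vX (Op Leq (Op Mul (var vS) (Op Add (var vS) (Lit 1))) np);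
      asg vA (Op Mul (Op Sub (var vAcc) (var vSC)) (var vX));
      asg vSC (Op Mul (var vSC) (var vX));
      asg vS (Op Mul (var vS) (var vX));
      asg vL (emin (var vMM) (var vS))] ++ spread ++ rank_items.

(* A sample that is too large for the grid of [rank_items] is discarded. *)
Definition usable (Z : seq T) : seq T :=
  if (size Z * (size Z).+1 <= p)%N then Z else [::].

Lemma dt_collect samp mm (lam : R) sg : env sg ->
  (forall i, sg i vSC 0%N = Int (size (samp i))) ->
  (forall i j, (j < size (samp i))%N -> sg i aB j = Elt (nth xs (samp i) j)) ->
  (forall i, sg i vMM 0%N = Int mm) -> (mm <= B)%N ->
  (forall i, (size (samp i) <= mm)%N) ->
  (size (flatten (codom samp)) <= B)%N ->
  (minn mm (size (usable (flatten (codom samp)))))%:R <= lam ->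
  dt collect sg (fun sg' =>
    frame [:: vAcc; vRcv; vD; aG; vS; vX; vA; vSC; vL; aH; vC1; vC2; aQ; vY; vRk; vIt] sg sg' /\
    ranked (usable (flatten (codom samp))) sg') (logcost *+ 18 + 3%:R * (lam * beta)).
Proof.
move=> en SCE BE MME mmB szm totB lamP; have h0 := W0; have lcW := logcost_W; have lc0 := logcost_ge0.
have h2 := be0; have lam0 : 0 <= lam by apply: le_trans lamP.
have B0 : (0 < B)%N by apply: leq_trans pB.
set Z := usable _ in lamP *.
set m := ext (fun i => size (samp i)).
set S := size (flatten (codom samp)) in totB.
have sumE : (\sum_i size (samp i))%N = S.
  rewrite /S size_flatten sumnE !big_map -enumT.
  by rewrite big_enum.
apply: (dt_le (c := 1%:R * W + (logcost *+ 3 + (5%:R * W + ((logcost *+ 9 + 3%:R * ((minn mm (size Z))%:R * beta)) + logcost *+ 5))))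
   _ _ (fun _ => id)); last first.
  have : (minn mm (size Z))%:R * beta <= lam * beta by rewrite ler_wpM2r.
  by rewrite -[logcost *+ 3]mulr_natl -[logcost *+ 9]mulr_natl -[logcost *+ 5]mulr_natl -[logcost *+ 18]mulr_natl; lra.
apply: dt_cat; [exact: dt_writes| |by costs].
move=> sg1 [sg1E fr1]; have en1 := env_frame fr1 isT en.
have Acc1 i : sg1 i vAcc 0%N = Int (m i).
  rewrite sg1E (exec_set _ (w := Int (size (samp i)))) ?ltM ?eval_readl ?ltM ?SCE //.
  by rewrite /m ext_ord.
apply: dt_cat; last by costs.
  apply: (dt_allreduce (op := addn)) Acc1 => //.
  - exact: ev_opadd.
  by move=> a b' bp /=; apply: BMx; apply: leq_trans (sum_ext_le _ _ bp) _; rewrite sumE;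
    apply: leq_trans totB _; clear; lia.
move=> sg2 [fr2 Acc2 S2]; have en2 := env_frame fr2 isT en1.
have {}S2 i : sg2 i vS 0%N = Int S by rewrite S2 /= sum_ext sumE.
have {}Acc2 i : sg2 i vAcc 0%N = Int (cum m i.+1) by rewrite Acc2.
set ok := (S * S.+1 <= p)%N.
have SZ : size Z = (S * ok)%N.
  by rewrite /Z /usable -/S -/ok; case: (ok); rewrite ?muln1 ?muln0.
apply: dt_cat; [exact: dt_writes| |by costs].
move=> sg3 [sg3E fr3]; have en3 := env_frame fr3 isT en2.
have sg3E' i : sg3 i = upd (upd (upd (upd (upd (sg2 i) vX 0 (Int ok))
    vA 0 (Int (cum m i * ok))) vSC 0 (Int (m i * ok))) vS 0 (Int (S * ok)))
    vL 0 (Int (minn mm (S * ok))).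
  have cB j : (j <= p)%N -> (cum m j <= B)%N.
    by move=> jp; apply: leq_trans (sum_ext_le _ _ jp) _; rewrite sumE.
  have MM2 : sg2 i vMM 0%N = Int mm by rewrite fr2 // fr1.
  have mi : (m i <= B)%N by rewrite /m ext_ord; apply: leq_trans (szm i) mmB.
  have SC2 : sg2 i vSC 0%N = Int (m i) by rewrite fr2 // fr1 // SCE /m ext_ord.
  have okB : (ok <= 1)%N by case: (ok).
  rewrite sg3E (exec_set _ (w := Int ok)) ?ltM //; last first.
  { rewrite -/(ev _ _ _ _); apply: ev_leq; [|exact: ev_np|exact: ltM].
    rewrite -[S.+1]addn1; have S2i := S2 i; ev_by S2i => //; try exact: ltM.
      by apply: BMx; clear -totB B0; lia.
    apply: leq_trans BBM; move: totB B0; clear; nia. }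
  set m1 := upd _ vX _ _.
  rewrite (exec_set _ (w := Int (cum m i * ok))) ?ltM //; last first.
  { rewrite -/(ev _ _ _ _); have A1 : m1 vAcc 0%N = Int (cum m i.+1) by rewrite /m1 /upd /= Acc2.
    have X1 : m1 vX 0%N = Int ok by [].
    have SC1 : m1 vSC 0%N = Int (m i) by rewrite /m1 /upd /= SC2.
    have ci := cB _ (ltn_ord i).
    ev_by (A1, X1, SC1); rewrite ?cumS ?addnK //; try exact: ltM.
      by rewrite -cumS; apply: BMx; clear -ci; lia.
    apply: BMx; rewrite cumS in ci; clear -ci okB.
    by case: (ok) okB => /=; rewrite ?muln0 ?muln1; lia. }
  set m2 := upd _ vA _ _.
  rewrite (exec_set _ (w := Int (m i * ok))) ?ltM //; last first.
  { rewrite -/(ev _ _ _ _); have SC1 : m2 vSC 0%N = Int (m i) by rewrite /m2 /m1 /upd /= SC2.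
    have X1 : m2 vX 0%N = Int ok by [].
    ev_by (X1, SC1) => //; try exact: ltM.
    by apply: BMx; case: (ok); rewrite /= ?muln1 ?muln0; clear -mi; lia. }
  set m3 := upd _ vSC _ _.
  rewrite (exec_set _ (w := Int (S * ok))) ?ltM //; last first.
  { rewrite -/(ev _ _ _ _); have S1 : m3 vS 0%N = Int S by rewrite /m3 /m2 /m1 /upd /= S2.
    have X1 : m3 vX 0%N = Int ok by [].
    ev_by (X1, S1) => //; try exact: ltM.
    by apply: BMx; case: (ok); rewrite /= ?muln1 ?muln0; clear -totB; lia. }
  set m4 := upd _ vS _ _.
  rewrite (exec_set _ (w := Int (minn mm (S * ok)))) ?ltM //.
  rewrite -/(ev _ _ _ _); have S1 : m4 vS 0%N = Int (S * ok) by [].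
  have M1' : m4 vMM 0%N = Int mm by rewrite /m4 /m3 /m2 /m1 /upd /= MM2.
  ev_by (M1', S1) => //; try exact: ltM.
  by apply: BMx; clear -mmB; lia.
pose samp' i := if ok then samp i else [::].
pose m' := ext (fun i => size (samp' i)).
have m'E i : m' i = (m i * ok)%N.
  by rewrite /m' /m /ext; case: insub => // i'; rewrite /samp'; case: (ok); rewrite ?muln1 ?muln0.
have cm' j : cum m' j = (cum m j * ok)%N.
  by rewrite /cum big_distrl /=; apply: eq_bigr => i _; rewrite m'E.
have flE : flatten (codom samp') = Z.
  rewrite /Z /usable -/S -/ok /samp'; case: (ok) => //.
  by rewrite codomE; elim: (enum 'I_p).
have cmp : cum m' p = size Z by rewrite cm' {1}/cum sum_ext sumE SZ.
have ZZ : (size Z * (size Z).+1 <= p)%N.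
  by rewrite SZ /ok; case: (leqP (S * S.+1) p) => ?; rewrite ?muln1 ?muln0 ?mul0n.
have Zp : (size Z <= p)%N by apply: leq_trans ZZ; rewrite leq_pmulr.
have [own ownP] := flatten_owner samp'; rewrite -/m' cmp in ownP.
apply: dt_cat; last by costs.
  have tot' : (cum m' p <= p)%N by rewrite cmp.
  have ownP' (t : 'I_p) : (t < cum m' p)%N ->
      owners m' (own t) && (cum m' (own t) <= t < cum m' (own t) + m' (own t))%N.
    by rewrite cmp => /ownP[-> ->].
  apply: (dt_spread tot' ownP' (L := minn mm (size Z))) => //.
  - by apply: leq_trans (geq_minr _ _) _.
  - move=> i; rewrite leq_min {1}/m' ext_ord; apply/andP; split.
      by rewrite /samp'; case: (ok).
    rewrite -cmp; apply: leq_trans (cum_le _ (ltn_ord i)).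
    by rewrite cumS leq_addl.
  - by move=> i; rewrite sg3E' m'E.
  - by move=> i; rewrite sg3E' cm'.
  - by move=> i; rewrite sg3E' SZ.
move=> sg4 [fr4 Q4]; have en4 := env_frame fr4 isT en3.
apply: dt_le (dt_rank_items (S := size Z) (g := nth xs Z) ZZ en4 _ _) _ _ => //.
- by move=> i; rewrite fr4 // sg3E' SZ.
- move=> t tS; rewrite Q4 ?cmp //; have [_ /andP[h1 h3] h4] := ownP t tS.
  rewrite -flE -h4 fr3 // fr2 // fr1 // BE.
    move: (ownP t tS) => _; congr (Elt (nth _ _ _)).
    have -> // : samp' (own t) = samp (own t).
    by move: tS; rewrite SZ /samp'; case: (ok); rewrite ?muln0.
  have : (t - cum m' (own t) < m' (own t))%N by clear -h1 h3; lia.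
  by rewrite {2}/m' ext_ord /samp'; case: (ok).
move=> sg5 [fr5 rk5]; split.
  by apply: (frame_sub (frame_cat fr1 (frame_cat fr2 (frame_cat fr3 (frame_cat fr4 fr5))))).
exact: rk5.
Qed.
(** * Rounds *)

Lemma wp_dt C1 C2 Q sg x (P : mem -> Prop) c : dt C1 sg P c -> c <= x ->
  (forall sg1 x1, P sg1 -> x - c <= x1 -> wp M alpha beta final C2 Q sg1 x1) ->
  wp M alpha beta final (C1 ++ C2) Q sg x.
Proof. by move=> [_ h] cx hQ; apply/wp_cat/h. Qed.

Definition tot (loc : 'I_p -> seq T) : nat := (\sum_i size (loc i))%N.

Definition good (loc : 'I_p -> seq T) : Prop :=
  uniq (flatten (codom loc)) /\ exists i, xs \in loc i.

Lemma subseq_flatten (l l' : 'I_p -> seq T) : (forall i, subseq (l i) (l' i)) ->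
  subseq (flatten (codom l)) (flatten (codom l')).
Proof.
move=> h; rewrite !codomE; elim: (enum 'I_p) => //= i s IH.
exact: cat_subseq.
Qed.

Lemma size_flatten_codom (l : 'I_p -> seq T) : size (flatten (codom l)) = tot l.
Proof.
rewrite /tot size_flatten /shape codomE -map_comp sumnE big_map.
by rewrite big_enum.
Qed.

Lemma restrict_subseq f loc i : subseq (restrict f loc i) (loc i).
Proof. exact: filter_subseq. Qed.

Lemma good_restrict f loc : good loc -> good (restrict f loc).
Proof.
move=> [u [i xi]]; split; last by exists i; rewrite mem_filter eqxx.
by apply: subseq_uniq u; apply: subseq_flatten => j; apply: restrict_subseq.
Qed.

Lemma tot_restrict f loc : (tot (restrict f loc) <= tot loc)%N.
Proof. by apply: leq_sum => i _; apply/size_subseq/restrict_subseq. Qed.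

(* The pivots are the sampled elements whose ranks in the sample lie [slack]
   below and above the expected rank of [xs]. *)
Definition slack (N U : nat) : nat := (4 * (U - 1) * (1 - (N + N <= U * U)))%N.
Definition center (N U r : nat) : nat := (r * minn (U * U) (N + N) %/ (N + N))%N.
Definition lower_rank N U r : nat := (center N U r - slack N U)%N.
(** With slack 0 the two ranks are consecutive. If every element is sampled they single out [xs];
    for [U = 1] and [r < N] they are 0 and 1, so that a single sampled element becomes the only
    pivot. *)
Definition upper_rank N U r : nat := (center N U r + slack N U + 1)%N.

Definition round : program :=
  let UU := Op Mul (var vU) (var vU) in let NN := Op Add (var vN) (var vN) in
  [:: asg vMM (emin (var vM0) (var vN)); asg vSC (Lit 0); asg vJ (Lit 0);
      asg vX (Op Div (Op Mul (var vR) (emin UU NN)) NN);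
      asg vV (Op Mul (Op Mul (Lit 4) (Op Sub (var vU) (Lit 1))) (Op Sub (Lit 1) (Op Leq NN UU)));
      asg vJL (Op Sub (var vX) (var vV));
      asg vJH (Op Add (Op Add (var vX) (var vV)) (Lit 1))] ++
  sample_loop :: collect ++ (pick (var vJL) ++ split) ++ (pick (var vJH) ++ split).

Definition round_vars : seq nat :=
  [:: vMM; vSC; vJ; vX; vV; vJL; vJH; aB; vAcc; vRcv; vD; aG; vS; vA; vL; aH; vC1; vC2;
      aQ; vY; vRk; vIt; vPv; vC; vKp; vK; aA; vCNT; vN; vR].

Definition lower (loc : 'I_p -> seq T) : nat :=
  (\sum_i count (fun y => (y < xs)%O) (loc i))%N.

Definition round_result U loc (ws : seq rnd) : 'I_p -> seq T :=
  let N := tot loc in let r := lower loc in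
  let Z := usable (flatten (codom (sampled N U loc ws))) in
  restrict (fun y => upper_rank N U r <= below Z y)%N
    (restrict (fun y => lower_rank N U r <= below Z y)%N loc).

(** 21 = 5 + 8 + 8 instructions per element, for sampling and the two splits. 33 = 18 + 7 + 7 + 1,
    for collecting, the two pivots and the remaining straight-line code. The last summand is the
    volume of [spread]. *)
Definition round_cost (mm : nat) : R := mm%:R * (21%:R * W) + logcost *+ 33 +
  3%:R * (Num.min mm%:R (Num.sqrt p%:R) * beta).

Lemma usable_size Z : (size (usable Z))%:R <= Num.sqrt (p%:R : R).
Proof.
have h : (size (usable Z) * (size (usable Z)).+1 <= p)%N.
  by rewrite /usable; case: ifP.
rewrite -[X in X <= _]ger0_norm // -sqrtr_sqr ler_wsqrtr // -natrX ler_nat.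
by apply: leq_trans h; rewrite -mulnn leq_mul2l leqnSn orbT.
Qed.

Lemma center_le N U r : (center N U r <= r)%N.
Proof.
rewrite /center; case: (posnP (N + N)) => [->|N0]; first by rewrite divn0.
by apply: leq_trans (leq_div2r _ (leq_mul (leqnn r) (geq_minr _ _))) _; rewrite mulnK.
Qed.

Lemma slack_le N U : (slack N U <= 4 * U)%N.
Proof.
rewrite /slack; apply: leq_trans (leq_mul (leqnn _) (leq_subr _ _)) _.
by rewrite muln1 leq_mul2l leq_subr.
Qed.

Lemma lower_le loc : (lower loc <= tot loc)%N.
Proof. by apply: leq_sum => i _; apply: count_size. Qed.

Lemma size_le_tot loc i : (size (loc i) <= tot loc)%N.
Proof. by rewrite /tot (bigD1 i) //= leq_addr. Qed.

(** Once the rows [ws] are fixed, the round is deterministic with result [round_result U loc ws];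
    hence the only mean to be paid for is that of [Phi], and [Q] is reached for every [ws]. *)
Lemma wp_round U loc m0 (Phi : nat -> R) Q sg x :
  state loc sg -> good loc -> (tot loc <= B)%N ->
  (forall i, sg i vU 0%N = Int U) -> (U <= B)%N ->
  (forall i, sg i vM0 0%N = Int m0) -> (m0 <= B)%N -> (forall i, (size (loc i) <= m0)%N) ->
  (forall n, 0 <= Phi n) ->
  (forall sg' x' loc', state loc' sg' -> good loc' -> frame round_vars sg sg' ->
     (tot loc' <= tot loc)%N -> (forall i, (size (loc' i) <= size (loc i))%N) ->
     Phi (tot loc') <= x' -> Q sg' x') ->
  round_cost (minn m0 (tot loc)) +
    avg (fun ws : (minn m0 (tot loc)).-tuple rnd => Phi (tot (round_result U loc ws))) <= x ->
  wp M alpha beta final round Q sg x.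
Proof.
set mm := minn m0 (tot loc) => st gd totB UE UB M0E m0B szm0 Phi0 hQ hx.
have h0 := W0; have lcW := logcost_W; have lc0 := logcost_ge0; have h2 := be0.
have B0 : (0 < B)%N by apply: leq_trans pB.
have [en CE AE NE RE] := st.
set N := tot loc in totB; set r := lower loc.
have rB : (r <= B)%N by apply: leq_trans (lower_le loc) totB.
have mmB : (mm <= B)%N by apply: leq_trans (geq_minl _ _) m0B.
have szmm i : (size (loc i) <= mm)%N by rewrite leq_min szm0 size_le_tot.
set lam := Num.min mm%:R (Num.sqrt p%:R : R).
have lam0 : 0 <= lam by rewrite le_min ler0n sqrtr_ge0.
set A := avg _ in hx.
have A0 : 0 <= A by apply: avg_ge0.
have sq0 : 0 <= lam * beta by rewrite mulr_ge0.
have mmW k : 0 <= mm%:R * (k%:R * W) by costs.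
have hx' : 7%:R * W + (mm%:R * (5%:R * W) + W + ((logcost *+ 18 + 3%:R * (lam * beta)) +
     ((mm%:R * (8%:R * W) + logcost *+ 7) + (mm%:R * (8%:R * W) + logcost *+ 7)) + A)) <= x.
  apply: le_trans hx; rewrite /round_cost -/lam.
  by rewrite -[logcost *+ 18]mulr_natl -[logcost *+ 7]mulr_natl -[logcost *+ 33]mulr_natl; lra.
rewrite /round; set prep := [:: _; _; _; _; _; _; _].
apply: (wp_dt (P := fun sg1 => (forall i, sg1 i = exec M prep (sg i)) /\ frame (targets prep) sg sg1) (c := 7%:R * W)).
- exact: dt_writes.
- have h1 := mmW 5%N; have h3 := mmW 8%N; rewrite -[logcost *+ 18]mulr_natl -[logcost *+ 7]mulr_natl in hx'; lra.
move=> sg1 x1 [sg1E fr1] x1E; have st1 := state_frame fr1 isT st.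
have sg1E' i : sg1 i = upd (upd (upd (upd (upd (upd (upd (sg i) vMM 0 (Int mm)) vSC 0 (Int 0)) vJ 0 (Int 0))
    vX 0 (Int (center N U r))) vV 0 (Int (slack N U))) vJL 0 (Int (lower_rank N U r))) vJH 0 (Int (upper_rank N U r)).
  have Ni := NE i; have Ri := RE i; have Ui := UE i; have M0i := M0E i.
  have UUM : (U * U < M)%N.
    apply: leq_ltn_trans (leq_mul UB UB) _; apply: leq_trans BBM.
    by rewrite -mulnA ltn_Pmull // muln_gt0 B0.
  have cB := leq_trans (center_le N U r) rB.
  have sB : (slack N U <= 4 * B)%N by apply: leq_trans (slack_le N U) _; rewrite leq_mul2l.
  have NNM : (N + N < M)%N by apply: BMx; clear -totB; lia.
  rewrite sg1E (exec_set _ (w := Int mm)) ?ltM //; last first.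
  { rewrite -/(ev _ _ _ _); ev_by (M0i, Ni) => //; try exact: ltM.
    by apply: BMx; clear -m0B; lia. }
  rewrite (exec_set _ (w := Int 0)) ?ltM //; last exact/ev_lit/ltM.
  rewrite (exec_set _ (w := Int 0)) ?ltM //; last exact/ev_lit/ltM.
  set m1 := upd _ vJ _ _.
  have N1 : m1 vN 0%N = Int N by rewrite /m1 /upd /=.
  have R1 : m1 vR 0%N = Int r by rewrite /m1 /upd /=.
  have U1 : m1 vU 0%N = Int U by rewrite /m1 /upd /=.
  rewrite (exec_set _ (w := Int (center N U r))) ?ltM //; last first.
  { rewrite -/(ev _ _ _ _); ev_by (N1, R1, U1) => //; try exact: ltM.
    all: have h : (r * minn (U * U) (N + N) < M)%N.
    all: try (apply: leq_ltn_trans (leq_mul rB (geq_minr _ _)) _; apply: leq_trans BBM).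
    all: try (clear -totB B0; nia).
    all: exact: h. }
  set m2 := upd _ vX _ _.
  rewrite (exec_set _ (w := Int (slack N U))) ?ltM //; last first.
  { rewrite -/(ev _ _ _ _); have N2 : m2 vN 0%N = Int N by [].
    have U2 : m2 vU 0%N = Int U by [].
    ev_by (N2, U2) => //; try exact: ltM.
    - by apply: BMx; clear -UB; lia.
    - by apply: BMx; clear -UB; lia.
    by apply: BMx; apply: leq_trans sB _; clear; lia. }
  set m3 := upd _ vV _ _.
  have X3 : m3 vX 0%N = Int (center N U r) by [].
  have V3 : m3 vV 0%N = Int (slack N U) by [].
  rewrite (exec_set _ (w := Int (lower_rank N U r))) ?ltM //; last first.
  { rewrite -/(ev _ _ _ _); ev_by (X3, V3) => //; try exact: ltM.
    by apply: BMx; clear -cB; lia. }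
  set m4 := upd _ vJL _ _.
  have X4 : m4 vX 0%N = Int (center N U r) by [].
  have V4 : m4 vV 0%N = Int (slack N U) by [].
  rewrite (exec_set _ (w := Int (upper_rank N U r))) ?ltM //.
  { rewrite -/(ev _ _ _ _); ev_by (X4, V4) => //; try exact: ltM;
    by apply: BMx; clear -cB sB B0; lia. }
have [en1 CE1 AE1 NE1 RE1] := st1.
rewrite -cat1s; apply/wp_cat/(wp_sample_loop (N := N) (U := U) (loc := loc) (mm := mm)
  (f := fun ws => (logcost *+ 18 + 3%:R * (lam * beta)) +
     ((mm%:R * (8%:R * W) + logcost *+ 7) + (mm%:R * (8%:R * W) + logcost *+ 7)) +
     Phi (tot (round_result U loc ws)))) => //.
- by move=> i; rewrite fr1.
- by move=> i; rewrite sg1E'.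
- by move=> i; rewrite sg1E'.
- by move=> i; rewrite sg1E'.
- by move=> i; apply: leq_trans (szmm i) mmB.
- by move=> ws; rewrite addr_ge0 //; costs.
- move=> ws sg2 x2 fr2 SC2 B2 x2E.
  pose samp := sampled N U loc ws.
  pose Z := usable (flatten (codom samp)).
  have st2 := state_frame fr2 isT st1; have [en2 _ _ _ _] := st2.
  have fl : subseq (flatten (codom samp)) (flatten (codom loc)).
    by apply: subseq_flatten => i; apply: mask_subseq.
  have uZ : uniq Z.
    by rewrite /Z /usable; case: ifP => // _; apply: subseq_uniq fl _; case: gd.
  have ZZ : (size Z * (size Z).+1 <= p)%N by rewrite /Z /usable; case: ifP.
  apply: wp_dt (dt_collect (samp := samp) (mm := mm) (lam := lam) en2 SC2 B2 _ mmB _ _ _) _ _.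
  + by move=> i; rewrite fr2 // sg1E'.
  + by move=> i; apply: leq_trans (sampled_size _ _ _ _ _) (szmm i).
  + by apply: leq_trans (size_subseq fl) _; rewrite size_flatten_codom.
  + rewrite le_min ler_nat geq_minl /=; apply: le_trans (usable_size (flatten (codom samp))).
    by rewrite ler_nat geq_minr.
  + have := Phi0 (tot (round_result U loc ws)); have := mmW 8%N.
    by rewrite -[logcost *+ 7]mulr_natl in x2E; lra.
  move=> sg3 x3 [fr3 rk3] x3E; have st3 := state_frame fr3 isT st2.
  apply: wp_dt (dt_pick_split (j := lower_rank N U r) (mm := mm) uZ ZZ rk3 _ _ st3 _ _ _ szmm mmB) _ _ => //.
  + by move=> i; rewrite fr3 // fr2 // sg1E'.
  + by case: gd.
  + by move=> i; rewrite fr3 // fr2 // sg1E'.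
  + have := Phi0 (tot (round_result U loc ws)); have := mmW 8%N.
    by rewrite -[logcost *+ 7]mulr_natl; rewrite -[logcost *+ 7]mulr_natl in x2E; lra.
  move=> sg4 x4 [fr4 st4] x4E.
  set loc1 := restrict _ loc in st4.
  have gd1 : good loc1 := good_restrict _ gd.
  have rk4 : ranked Z sg4 by move=> t; rewrite !fr4 //; apply: rk3.
  have sz1 i : (size (loc1 i) <= mm)%N.
    by apply: leq_trans (szmm i); apply/size_subseq/restrict_subseq.
  rewrite -[pick _ ++ split]cats0.
  apply: wp_dt (dt_pick_split (j := upper_rank N U r) (mm := mm) uZ ZZ rk4 _ _ st4 _ _ _ sz1 mmB) _ _ => //.
  + by move=> i; rewrite fr4 // fr3 // fr2 // sg1E'.
  + by case: gd1.
  + by apply: leq_trans (tot_restrict _ _) totB.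
  + by move=> i; rewrite fr4 // fr3 // fr2 // sg1E'.
  + have := Phi0 (tot (round_result U loc ws)); have := mmW 8%N.
    by rewrite -[logcost *+ 7]mulr_natl; rewrite -[logcost *+ 7]mulr_natl in x2E x4E; lra.
  move=> sg5 x5 [fr5 st5] x5E.
  have Px : Phi (tot (round_result U loc ws)) <= x5 by lra.
  apply: wp_nil; first by apply: le_trans Px.
  apply: (hQ _ _ (round_result U loc ws)) => //.
  + by do 2!apply: good_restrict.
  + by apply: (frame_sub (frame_cat fr1 (frame_cat fr2 (frame_cat fr3 (frame_cat fr4 fr5))))).
  + by apply: leq_trans (tot_restrict _ _) (tot_restrict _ _).
  move=> i; apply: leq_trans (size_subseq (restrict_subseq _ _ _)) _.
  exact: size_subseq (restrict_subseq _ _ _).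
rewrite avgD avg_cst; first by rewrite -/A; lra.
by rewrite card_tuple expn_gt0 card_rnd.
Qed.

(** * The progress of a round *)

Section Progress.
Variables (loc : 'I_p -> seq T) (mm U : nat).
Hypothesis szmm : forall i, (size (loc i) <= mm)%N.
Let N := tot loc.
Let all := flatten (codom loc).
Let q := maxn 1 (N + N).
Hypothesis qM : (q <= M)%N.

Definition selects : pred 'I_(M`!) := fun v => (v %% q < U * U)%N.
Definition holds_at (P : pred T) : pred ('I_p * 'I_mm) := fun e =>
  ((e.2 < size (loc e.1)) && P (nth xs (loc e.1) e.2))%N.
Definition sample (ws : seq rnd) : seq T := flatten (codom (sampled N U loc ws)).

Lemma count_codom (P : pred T) (l : 'I_p -> seq T) :
  count P (flatten (codom l)) = (\sum_i count P (l i))%N.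
Proof. by rewrite count_flatten codomE -map_comp sumnE big_map big_enum. Qed.

Lemma card_holds_at P : #|holds_at P| = count P all.
Proof.
rewrite -sum1_card big_mkcond /= count_codom.
rewrite -(pair_bigA _ (fun i j => if (i, j) \in holds_at P then 1 else 0)%N) /=.
apply: eq_bigr => i _; rewrite (count_nth xs _ (szmm i)) big_mkord.
by apply: eq_bigr => j _; rewrite -topredE /holds_at /=; case: (_ && _).
Qed.

(** Identifies a count in the sample with a sum of independent indicators, one for each position of
    a list. *)
Lemma hits_sample P (f : {ffun 'I_p * 'I_mm -> 'I_(M`!)}) :
  hits R selects (holds_at P) f = (count P (sample (rows f)))%:R.
Proof.
rewrite /hits -natr_sum; congr (_%:R); rewrite /sample count_codom big_mkcond.
transitivity (\sum_i \sum_j (if holds_at P (i, j) then selects (f (i, j)) : nat else 0))%N.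
  by rewrite pair_bigA; apply: eq_bigr => -[i j] _.
apply: eq_bigr => i _; rewrite (count_mask xs _ _ (szmm i)) big_mkord.
apply: eq_bigr => j _; rewrite (nth_map (tnth (rows f) j)) ?size_tuple //.
rewrite -tnth_nth tnth_mktuple ffunE /selects /holds_at -/N -/q.
by rewrite [(i, j).1]/= [(i, j).2]/=; case: (_ && P _).
Qed.

Definition density : R := (minn (U * U) q)%:R / q%:R.

Lemma avg_selects : avg (fun v => (selects v)%:R) = density.
Proof. by apply: avg_modn; rewrite qM andbT leq_max. Qed.

Let V0 : (0 < #|'I_(M`!)|)%N.
Proof. by rewrite card_ord fact_gt0. Qed.

Lemma chebyshev_sample P (dl : R) : 0 < dl ->
  avg (fun ws : mm.-tuple rnd =>
    (dl <= `|(count P (sample ws))%:R - (count P all)%:R * density|)%R%:R)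
  <= (count P all)%:R * density / dl ^+ 2.
Proof.
move=> dl0; rewrite (avg_reindex _ (rows_bij p mm _)) -avg_selects -card_holds_at.
apply: le_trans (chebyshev_hits V0 selects (holds_at P) dl0).
by apply: avg_le => f; rewrite hits_sample.
Qed.

Lemma single_sample P :
  (count P all)%:R * density * (1 - N%:R * density) <=
  avg (fun ws : mm.-tuple rnd =>
    ((count P (sample ws) == 1) && (size (sample ws) == 1))%N%:R).
Proof.
rewrite (avg_reindex _ (rows_bij p mm _)) -avg_selects -card_holds_at.
have NE : N = #|holds_at xpredT| by rewrite card_holds_at count_predT size_flatten_codom.
have sub : {subset holds_at P <= holds_at xpredT}.
  by move=> e; rewrite -!topredE /holds_at /= andbT => /andP[].
rewrite NE; have h := @single_hit R _ _ V0 selects _ _ sub.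
apply: le_trans h _.
by apply: avg_le => f; rewrite !hits_sample count_predT !pnatr_eq1.
Qed.

Hypothesis gd : good loc.

(** * Ranks among the remaining elements *)

Definition rk (y : T) : nat := below all y.

(** Distinct elements have the ranks from 0 to [N - 1], each once, which turns counting elements
    into counting integers. *)
Lemma rk_perm : perm_eq [seq rk y | y <- all] (iota 0 N).
Proof.
have [u _] := gd; pose s := sort <=%O all.
have ps : perm_eq s all by apply/permEl/perm_sort.
apply: perm_trans (perm_map rk (s := all) (t := s) _) _; first by rewrite perm_sym.
have szs : size s = N by rewrite size_sort size_flatten_codom.
suff -> : [seq rk y | y <- s] = iota 0 N by [].
apply: (@eq_from_nth _ 0%N); rewrite ?size_map ?size_iota // szs => j jN.
rewrite (nth_map xs) ?szs // nth_iota // add0n /rk /below -(permP ps).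
by rewrite count_lt_nth ?szs // sort_lt_sorted.
Qed.

Lemma count_rk (Q : pred nat) : count (fun y => Q (rk y)) all = count Q (iota 0 N).
Proof. by rewrite -(permP rk_perm) count_map. Qed.

Lemma count_rk_lt k : count (fun y => rk y < k)%N all = minn k N.
Proof.
rewrite (count_rk (fun v => (v < k)%N)) -sum1_count big_mkcond /=.
rewrite /iota; elim: N => [|n IH]; first by rewrite big_nil minn0.
rewrite -/(iota 0 n.+1) -addn1 iotaD big_cat /= IH big_cons big_nil add0n addn0.
by case: (ltnP n k) => h; clear -h; lia.
Qed.

Lemma count_rk_range (P : pred T) lo hi :
  (forall y, y \in all -> P y -> (lo <= rk y < hi)%N) -> (count P all <= hi - lo)%N.
Proof.
move=> h; apply: leq_trans (_ : count (fun y => lo <= rk y < hi)%N all <= _)%N.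
  elim: (all) h => //= x s IH h; apply: leq_add.
    by case Px: (P x); rewrite // h ?inE ?eqxx.
  by apply: IH => y ys; apply: h; rewrite inE ys orbT.
rewrite (count_rk (fun v => (lo <= v < hi)%N)) -size_filter -(size_iota lo (hi - lo)).
apply: uniq_leq_size; first by rewrite filter_uniq ?iota_uniq.
move=> v; rewrite mem_filter !mem_iota => /andP[/andP[h1 h2] _]; rewrite h1 /=.
by clear -h1 h2; lia.
Qed.

Lemma rk_lt y z : y \in all -> (rk y < rk z)%N = (y < z)%O.
Proof.
move=> ya; case: (ltP y z) => yz; first exact: below_lt.
by rewrite ltnNge below_mono.
Qed.

Lemma xs_all : xs \in all.
Proof. by have [_ [i xi]] := gd; apply/flattenP; exists (loc i) => //; apply: codom_f. Qed.

Lemma rk_xs : rk xs = lower loc.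
Proof. by rewrite /rk /below count_codom. Qed.

Lemma rk_ltN y : y \in all -> (rk y < N)%N.
Proof. by move=> ya; have := below_lt_size ya; rewrite size_flatten_codom. Qed.

Lemma sample_sub ws : {subset sample ws <= all}.
Proof.
by apply/mem_subseq/subseq_flatten => i; apply: mask_subseq.
Qed.

Lemma below_sample ws y : below (sample ws) y = count (fun z => rk z < rk y)%N (sample ws).
Proof. by apply: eq_in_count => z /sample_sub zs; rewrite rk_lt. Qed.

Definition jl : nat := lower_rank N U (lower loc).
Definition jh : nat := upper_rank N U (lower loc).

Lemma tot_round_result ws : tot (round_result U loc ws) = count (fun y =>
   ((jl <= below (usable (sample ws)) y)%N == (jl <= below (usable (sample ws)) xs)%N) &&
   ((jh <= below (usable (sample ws)) y)%N == (jh <= below (usable (sample ws)) xs)%N)) all.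
Proof.
rewrite /tot count_codom; apply: eq_bigr => i _; rewrite /round_result /restrict.
rewrite size_filter count_filter -/N -/(sample ws) -/jl -/jh.
by apply: eq_count => y; rewrite /= andbC.
Qed.

Lemma round_result_le ws : (tot (round_result U loc ws) <= N)%N.
Proof. by rewrite tot_round_result /N -(size_flatten_codom loc) count_size. Qed.

(* The sample consists of all elements. *)
Lemma round_exhaustive ws : size ws = mm -> (0 < N)%N -> (N + N <= U * U)%N ->
  (N * N.+1 <= p)%N -> (tot (round_result U loc ws) <= 1)%N.
Proof.
move=> szw N0 NU Np; have sE : sample ws = all.
  congr (flatten (codom _)); apply: funext => i; rewrite /sampled.
  have -> : [seq ((r : rnd) i %% maxn 1 (N + N) < U * U)%N | r <- ws] = nseq mm true.
    rewrite -szw; elim: (ws) => //= r s ->; congr (_ :: _).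
    apply: leq_trans NU; apply: leq_trans (ltn_pmod _ _) _; rewrite ?leq_max //.
    by rewrite geq_max leqnn andbT addn_gt0 N0.
  by apply: mask_true.
have uE : usable all = all by rewrite /usable size_flatten_codom Np.
have NN0 : (0 < N + N)%N by rewrite addn_gt0 N0.
have cE : center N U (lower loc) = lower loc.
  by rewrite /center (minn_idPr NU) mulnK.
have slE : slack N U = 0%N by rewrite /slack NU muln0.
have jlE : jl = rk xs by rewrite /jl /lower_rank cE slE subn0 rk_xs.
have jhE : jh = (rk xs).+1 by rewrite /jh /upper_rank cE slE addn0 addn1 rk_xs.
rewrite tot_round_result sE uE; apply: leq_trans (count_rk_range (lo := rk xs) (hi := (rk xs).+1) _) _.
  move=> y ya; rewrite -!/(rk _) jlE jhE leqnn ltnn eqb_id => /andP[-> /=].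
  by rewrite eqbF_neg -leqNgt ltnS.
by rewrite subSnn.
Qed.

(** The lower pivot is absent and the upper one is the sampled element. It has at least about a
    quarter of the elements on either side, so at most three quarters remain, whichever side [xs]
    lies on. *)
Lemma round_single ws : U = 1%N -> (1 < p)%N ->
  count (fun y => N <= 4 * (rk y).+1 <= 3 * N)%N (sample ws) = 1%N -> size (sample ws) = 1%N ->
  (4 * tot (round_result U loc ws) <= 3 * N)%N.
Proof.
move=> U1 p1 cA sz; have uE : usable (sample ws) = sample ws.
  by rewrite /usable sz p1.
case sE: (sample ws) sz cA (@sample_sub ws) => [|z [|//]] // _ /=; rewrite addn0.
case: (boolP (N <= 4 * (rk z).+1 <= 3 * N)%N) => // /andP[z1 z2] _ /(_ z); rewrite inE eqxx => /(_ isT) za.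
have rN := rk_ltN xs_all; rewrite rk_xs in rN.
have N0 : (0 < N)%N by apply: leq_trans rN.
have jlE : jl = 0%N.
  rewrite /jl /lower_rank /center U1 (minn_idPl _) ?muln1; last by rewrite addn_gt0 N0.
  by rewrite divn_small //; apply: leq_trans rN _; rewrite leq_addr.
have jhE : jh = 1%N.
  have slE : slack N U = 0%N by rewrite /slack U1 subnn muln0 mul0n.
  move: jlE; rewrite /jl /jh /lower_rank /upper_rank slE subn0 addn0 => ->.
  by [].
have zN := rk_ltN za.
rewrite tot_round_result uE sE jlE jhE /below /= addn0.
case: (ltP z xs) => zx.
  apply: leq_trans (_ : 4 * (N - (rk z).+1) <= _)%N; last by clear -z1 zN; lia.
  rewrite leq_mul2l /=; apply: count_rk_range => y ya; rewrite addn0.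
  by case: (ltP z y) => // zy _; rewrite rk_ltN // andbT rk_lt.
apply: leq_trans (_ : 4 * ((rk z).+1 - 0) <= _)%N; last by rewrite subn0.
rewrite leq_mul2l /=; apply: count_rk_range => y ya; rewrite addn0.
by case: (ltP z y) => // zy _; rewrite /= ltnS below_mono.
Qed.

(* [D] elements contain on average more than [2 * slack + 1] sampled ones, so that
   deviations up to [slack] cannot keep an element of rank further than [D] from
   the one of [xs] between the pivots. *)
Lemma round_typical ws D : (N + N > U * U)%N -> (1 < U)%N -> (10 * U ^ 4 <= p)%N ->
  ((8 * U - 7) * (N + N) < D * (U * U))%N ->
  (forall k, k \in [:: rk xs; (rk xs + D).+1; rk xs - D; N]%N ->
    `|(count (fun y => rk y < k)%N (sample ws))%:R - (minn k N)%:R * density| < (4 * (U - 1))%:R) ->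
  (tot (round_result U loc ws) <= D.*2.+1)%N.
Proof.
move=> NU U1 Up hD dev.
have N0 : (0 < N)%N by move: NU; case: (N).
pose Y k := count (fun y => rk y < k)%N (sample ws).
have Ymono a b : (a <= b)%N -> (Y a <= Y b)%N.
  by move=> ab; apply: sub_count => y /= ya; apply: leq_trans ab.
have qE : q = (N + N)%N by rewrite /q; apply/maxn_idPr; rewrite addn_gt0 N0.
have dE : density = (U * U)%:R / (N + N)%:R by rewrite /density qE (minn_idPl (ltnW NU)).
set rho := density in dE dev.
have NN0 : 0 < (N + N)%:R :> R by rewrite ltr0n addn_gt0 N0.
have rhoN : (N + N)%:R * rho = (U * U)%:R by rewrite dE mulrC divfK ?gt_eqF.
have slE : slack N U = (4 * (U - 1))%N by rewrite /slack leqNgt NU subn0 muln1.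
set dl := (4 * (U - 1))%N in dev slE.
have dlE : dl%:R = 4 * U%:R - 4 :> R by rewrite /dl natrM natrB 1?ltnW //; ring.
have U1R : 2 <= U%:R :> R by rewrite (ler_nat _ 2).
have rho0 : 0 <= rho by rewrite dE divr_ge0.
have szS : size (sample ws) = Y N.
  rewrite /Y -[LHS]count_predT; apply: eq_in_count => y /sample_sub ys.
  by rewrite rk_ltN.
(* The deviation at [k = N] bounds the size of the sample: [2 * Y N < 5 * U^2], and then
   [Y N * (Y N + 1) <= 10 * U^4]. This is the origin of the 10. *)
have uE : usable (sample ws) = sample ws.
  rewrite /usable szS; have /dev : N \in [:: rk xs; (rk xs + D).+1; rk xs - D; N]%N.
    by rewrite !inE eqxx !orbT.
  rewrite -/(Y N) minnn ltr_norml => /andP[_ h].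
  have YN : (Y N + Y N < U * U + 8 * U)%N.
    rewrite -(ltr_nat R) !natrD !natrM; rewrite natrD in rhoN; rewrite natrM in rhoN.
    by move: h; rewrite dlE; lra.
  suff -> : (Y N * (Y N).+1 <= p)%N by [].
  apply: leq_trans Up; rewrite (_ : U ^ 4 = (U * U) * (U * U))%N; last by rewrite !expnS expn0; clear; lia.
  have YU : (2 * Y N < 5 * (U * U))%N.
    have UU : (2 * U <= U * U)%N by rewrite leq_mul2r U1 orbT.
    by move: YN UU; move: (U * U)%N (Y N); clear; lia.
  have h1 : ((2 * Y N) * (2 * Y N + 2) <= (5 * (U * U)) * (5 * (U * U) + 2))%N.
    by apply: leq_mul; [exact: ltnW|rewrite leq_add2r ltnW].
  have U4 : (1 <= U * U)%N by rewrite muln_gt0 ltnW.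
  have h2 : (U * U <= (U * U) * (U * U))%N by rewrite leq_pmulr.
  by move: h1 h2; move: (U * U)%N (Y N); clear; lia.
have rN := rk_ltN xs_all.
set c := center N U (lower loc).
have cE : c = (rk xs * (U * U) %/ (N + N))%N by rewrite /c /center (minn_idPl (ltnW NU)) rk_xs.
have c1 : c%:R <= (rk xs)%:R * rho.
  rewrite dE mulrA ler_pdivlMr // -!natrM ler_nat cE; exact: leq_trunc_div.
have c2 : (rk xs)%:R * rho < c%:R + 1.
  rewrite dE mulrA ltr_pdivrMr // natr1 -!natrM ltr_nat cE mulnC.
  by rewrite mulnC ltn_ceil // addn_gt0 N0.
(* [8 * U - 7] is [2 * dl + 1]: one [dl] for the slack, one for the deviation, and 1 for rounding in
   [center]. *)
have Drho : 2 * dl%:R + 1 < D%:R * rho.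
  rewrite dE mulrA ltr_pdivlMr // -[D%:R * _]natrM.
  have e : ((8 * U - 7) * (N + N))%:R = (2 * dl%:R + 1) * (N + N)%:R :> R.
    rewrite natrM natrB; last by apply: leq_trans (leq_mul (leqnn 8) (ltnW U1)).
    by rewrite dlE natrM; congr (_ * _); ring.
  by rewrite -e ltr_nat.
have Yr : `|(Y (rk xs))%:R - (minn (rk xs) N)%:R * rho| < dl%:R.
  by apply: dev; rewrite inE eqxx.
rewrite (minn_idPl (ltnW rN)) ltr_norml in Yr; have /andP[Yr1 Yr2] := Yr.
have jlr : (jl <= Y (rk xs))%N.
  rewrite /jl /lower_rank -/c slE leq_subLR -ltnS -(ltr_nat R) -natr1 natrD; lra.
have jhr : (Y (rk xs) < jh)%N.
  rewrite /jh /upper_rank -/c slE addn1 -(ltr_nat R) -natr1 natrD; lra.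
have jhr' : (jh <= Y (rk xs))%N = false by rewrite leqNgt jhr.
rewrite tot_round_result uE below_sample -/(Y _) jlr jhr'.
apply: leq_trans (count_rk_range (lo := rk xs - D) (hi := (rk xs + D).+1) _) _; last by clear; lia.
move=> y ya; rewrite below_sample -/(Y _) eqb_id eqbF_neg -ltnNge => /andP[y1 y2].
apply/andP; split; rewrite leqNgt; apply/negP => hy.
  have rD : (D <= rk xs)%N by clear -hy; lia.
  have := dev (rk xs - D)%N; rewrite !inE eqxx !orbT => /(_ isT).
  rewrite -/(Y _) (minn_idPl _); last by apply: leq_trans (leq_subr _ _) (ltnW rN).
  rewrite natrB // ltr_norml => /andP[_ h].
  have := leq_trans y1 (Ymono _ _ (ltnW hy)); rewrite /jl /lower_rank -/c slE leq_subLR.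
  rewrite -(ler_nat R) natrD; lra.
rewrite ltnS in hy; have := dev (rk xs + D).+1; rewrite !inE eqxx !orbT => /(_ isT).
rewrite -/(Y _) (minn_idPl _); last by apply: leq_trans hy (ltnW (rk_ltN ya)).
rewrite -natr1 natrD ltr_norml => /andP[h _].
have := leq_ltn_trans (Ymono _ _ hy) y2; rewrite /jh /upper_rank -/c slE.
rewrite addn1 -(ltr_nat R) -natr1 natrD; lra.
Qed.

(* With [growth] as below, a round reduces the number of elements by this
   factor with constant probability. *)
Definition growth : R := if U == 1%N then 4 / 3 else U%:R / 33.

Lemma round_progress : (2 <= N)%N -> (1 < p)%N ->
  U = 1%N \/ (128 <= U)%N /\ (10 * U ^ 4 <= p)%N ->
  exists N1 : nat, ((N1 <= 1)%N \/ N1%:R * growth <= N%:R) /\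
    1 / 16 <= avg (fun ws : mm.-tuple rnd => (tot (round_result U loc ws) <= N1)%N%:R) :> R.
Proof.
move=> N2 p1 hU; have N0 : (0 < N)%N by apply: ltn_trans N2.
have mx1 : (0 < #|{: mm.-tuple rnd}|)%N by rewrite card_tuple expn_gt0 card_rnd.
have qE : q = (N + N)%N by rewrite /q; apply/maxn_idPr; rewrite addn_gt0 N0.
have NN0 : 0 < (N + N)%:R :> R by rewrite ltr0n addn_gt0 N0.
case: hU => [U1|[U128 Up]].
  exists (3 * N %/ 4)%N; split.
    right; rewrite /growth U1 eqxx mulrA ler_pdivrMr // -!natrM ler_nat mulnC.
    by rewrite [(N * 3)%N]mulnC mulnC leq_trunc_div.
  pose A y := (N <= 4 * (rk y).+1 <= 3 * N)%N.
  (* About half of the elements have such a rank; a quarter remains true after rounding for small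
     [N]. *)
  have cA : (N <= 4 * count A all)%N.
    have -> : count A all = (count (fun y => rk y < 3 * N %/ 4)%N all - count (fun y => rk y < (N + 3) %/ 4 - 1)%N all)%N.
      have sub : (count (fun y => rk y < (N + 3) %/ 4 - 1) all + count A all = count (fun y => rk y < 3 * N %/ 4) all)%N.
        rewrite -(count_predUI (fun y => rk y < (N + 3) %/ 4 - 1)%N A all) [X in (_ + X)%N](_ : _ = 0%N) ?addn0.
          by apply: eq_count => y; rewrite /A /=; apply/idP/idP; clear -N2; lia.
        apply/eqP; rewrite eqn0Ngt -has_count; apply/hasPn => y _; rewrite /A /=; clear; lia.
      by rewrite -sub addKn.
    by rewrite !count_rk_lt; clear -N2; lia.
  have dE : density = 1 / (N + N)%:R.
    by rewrite /density qE U1 (minn_idPl _) // addn_gt0 N0.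
  apply: (@le_trans _ _ (avg (fun ws : mm.-tuple rnd =>
      ((count A (sample ws) == 1) && (size (sample ws) == 1))%N%:R))); last first.
    apply: avg_le => ws; rewrite ler_nat; case: andP => // -[/eqP h1 /eqP h2].
    have := round_single U1 p1 h1 h2; move: (tot _) => t.
    by rewrite lt0b leq_divRL // mulnC => ->.
  (* The bound is at least [1/8 * (1 - 1/2)], the worst of all cases and the origin of 1/16. *)
  apply: le_trans (single_sample A); rewrite dE.
  have e : N%:R * (1 / (N + N)%:R) = 1 / 2 :> R.
    by rewrite natrD; field; rewrite ?pnatr_eq0; move: N0; case: (N) => //.
  rewrite e; have cA' : N%:R <= 4 * (count A all)%:R :> R by rewrite -natrM ler_nat.
  have : (1 / 8 : R) <= (count A all)%:R * (1 / (N + N)%:R).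
    by rewrite mulrA ler_pdivlMr // natrD; lra.
  lra.
have U1 : (U == 1)%N = false by apply/eqP => U1; rewrite U1 in U128.
have [NU|NU] := leqP (N + N) (U * U).
  exists 1%N; split; first by left.
  have e : avg (fun ws : mm.-tuple rnd => (tot (round_result U loc ws) <= 1)%N%:R) = 1 :> R.
    rewrite -[RHS](avg_cst 1 mx1); apply: eq_avg => ws.
    rewrite round_exhaustive ?size_tuple //; apply: leq_trans Up.
    have h : (4 * (N * N.+1) <= (N + N) * (N + N) * 2)%N by move: N2; clear; nia.
    have h' : ((N + N) * (N + N) <= (U * U) * (U * U))%N by apply: leq_mul.
    by rewrite (_ : U ^ 4 = (U * U) * (U * U))%N; [lia|rewrite !expnS expn0; lia].
  by rewrite e; lra.
have UU0 : (0 < U * U)%N by rewrite muln_gt0 andbb; apply: leq_trans U128.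
set D := ((8 * U - 7) * (N + N) %/ (U * U)).+1.
exists D.*2.+1; split.
  right; rewrite /growth U1 mulrA ler_pdivrMr // -!natrM ler_nat.
  rewrite -(leq_pmul2r (_ : 0 < U)%N); last by apply: leq_trans U128.
  (* Since [2 * D + 1 = 2 * (D - 1) + 3] and [U^2 < 2 * N], the product [(2 * D + 1) * U^2] is at
     most [32 * U * N] and a negative term; [growth] rounds the 32 up to 33. *)
  have h : ((D.-1) * (U * U) <= (8 * U - 7) * (N + N))%N by apply: leq_trunc_div.
  have h2 : (D.*2.+1 * U * U = 2 * (D.-1 * (U * U)) + 3 * (U * U))%N.
    by rewrite /D /=; clear; lia.
  rewrite h2; apply: leq_trans (_ : 2 * ((8 * U - 7) * (N + N)) + 3 * (N + N) <= _)%N.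
    by apply: leq_add; rewrite leq_mul2l //= ltnW.
  rewrite mulnBl; have : (7 * (N + N) <= 8 * U * (N + N))%N.
    by rewrite leq_mul2r; apply/orP; right; clear -U128; lia.
  by clear; lia.
have hD : ((8 * U - 7) * (N + N) < D * (U * U))%N by rewrite /D ltn_ceil.
pose ks := [:: rk xs; (rk xs + D).+1; rk xs - D; N]%N.
pose dl : R := (4 * (U - 1))%:R.
have dlE : dl = 4 * U%:R - 4.
  by rewrite /dl natrM natrB; [ring|apply: leq_trans U128].
have U128R : 128 <= U%:R :> R by rewrite (ler_nat _ 128).
have dl0 : 0 < dl by rewrite dlE; lra.
pose bad k (ws : mm.-tuple rnd) : bool :=
  dl <= `|(count (fun y => rk y < k)%N (sample ws))%:R - (minn k N)%:R * density|.
have dE : density = (U * U)%:R / (N + N)%:R by rewrite /density qE (minn_idPl (ltnW NU)).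
(* The variance is at most [U^2 / 2], and [dl^2 = 16 * (U - 1)^2] is at least [4 * U^2]. *)
have badle k : avg (fun ws => (bad k ws)%:R) <= 1 / 8 :> R.
  have h := chebyshev_sample (fun y => rk y < k)%N dl0.
  rewrite count_rk_lt in h; apply: le_trans h _.
  rewrite ler_pdivrMr ?exprn_gt0 //.
  apply: (@le_trans _ _ (N%:R * density)).
    by rewrite ler_wpM2r ?ler_nat ?geq_minr // dE divr_ge0.
  have -> : N%:R * density = U%:R * U%:R / 2.
    by rewrite dE natrD natrM; field; rewrite ?pnatr_eq0; move: N0; case: (N) => //.
  by rewrite dlE; nra.
(* The union bound over the four ranks: the indicator of success is at least 1 minus the number of
   bad events, whose mean is at most 1/2. *)
apply: (@le_trans _ _ (avg (fun ws => 1 + -1 * \sum_(k <- ks) (bad k ws)%:R))); last first.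
  apply: avg_le => ws; case: leqP => hN /=.
    have : 0 <= \sum_(k <- ks) (bad k ws)%:R :> R by apply: sumr_ge0 => k _; rewrite ler0n.
    lra.
  have [/hasP[k kks bk]|/hasPn nb] := boolP (has (bad^~ ws) ks).
    rewrite (big_rem k kks) /= bk.
    have : 0 <= \sum_(k <- rem k ks) (bad k ws)%:R :> R by apply: sumr_ge0 => ? _; rewrite ler0n.
    by rewrite /=; lra.
  exfalso; move: hN; rewrite ltnNge => /negP; apply; apply: round_typical => //.
    by apply: leq_trans U128.
  by move=> k /nb; rewrite /bad -ltNge.
rewrite avgD avg_cst // avgZ /ks.
rewrite (eq_avg (g := fun ws => (bad (rk xs) ws)%:R + ((bad (rk xs + D).+1 ws)%:R +
   ((bad (rk xs - D)%N ws)%:R + (bad N ws)%:R)))) => [|ws]; last first.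
  by rewrite !big_cons big_nil addr0.
rewrite !avgD; have := badle (rk xs); have := badle (rk xs + D).+1.
by have := badle (rk xs - D)%N; have := badle N; lra.
Qed.

End Progress.

(** * The program *)

(* The largest power [U] of [128] with [10 U^4 <= p]; the sample of a round has
   about [U^2 / 2] elements, and its ranking takes [S (S + 1)] PEs. *)
Definition size_loop : instr :=
  let V := Op Mul (Lit 128) (var vU) in
  While (Op Leq (Lit 1) (Op Div (Op Div (Op Div (Op Div (Op Div np (Lit 10)) V) V) V) V))
    [:: asg vU V].

Definition valid_size (U : nat) : Prop :=
  (U = 1 \/ (128 <= U) /\ (10 * U ^ 4 <= p))%N.

Lemma dt_size_loop sg : env sg -> (forall i, sg i vU 0%N = Int 1) ->
  dt [:: size_loop] sg (fun sg' => frame [:: vU] sg sg' /\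
    exists U, [/\ forall i, sg' i vU 0%N = Int U, valid_size U & (p < 10 * (128 * U) ^ 4)%N])
   logcost.
Proof.
move=> en U1; have h0 := W0; have B0 : (0 < B)%N by apply: leq_trans pB.
pose J l sg' := [/\ frame [:: vU] sg sg', forall i, sg' i vU 0%N = Int (128 ^ l)%N &
  l = 0%N \/ (10 * (128 ^ l) ^ 4 <= p)%N].
apply: (dt_le (c := \sum_(0 <= l < up_log 2 p) (W + 1%:R * W) + W) _ _ (fun _ => id)); last first.
  have h1 := al0; have h2 := be0; have h3 : W + 1%:R * W <= level by rewrite /level; lra.
  rewrite sumr_const_nat subn0 /logcost [level *+ _.+1]mulrS.
  have := ler_wMn2r (up_log 2 p) h3; lra.
apply: (dt_while p0 unit_workW (J := J) (c := fun=> 1%:R * W)) => //.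
- by move=> l; costs.
- move=> l sg1 [fr1 UE hl]; set U := (128 ^ l)%N in UE hl *.
  have U0 : (0 < U)%N by rewrite expn_gt0.
  have Up : (U <= p)%N.
    case: hl => [l0|hl]; first by rewrite /U l0.
    by apply: leq_trans hl; apply: leq_trans (leq_pexp2l U0 (isT : 1 <= 4)%N) (leq_pmull _ _).
  have VM : (128 * U < M)%N by apply: leq_trans BM; apply: leq_trans (_ : 128 * B < _)%N; [rewrite ltnS leq_mul2l /= (leq_trans Up)|clear -B0; lia].
  have en1 := env_frame fr1 isT en.
  have pM : (p < M)%N by apply: BMx; clear -pB; lia.
  have VE i : ev M (sg1 i) (Op Mul (Lit 128) (var vU)) (128 * U).
    by have Ui := UE i; ev_by Ui => //; apply: ltM.
  exists (10 * (128 * U) ^ 4 <= p)%N.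
    move=> i; set e := Op Leq _ _.
    have -> : evaln M (sg1 i) e = (1 <= p %/ 10 %/ (128 * U) %/ (128 * U) %/ (128 * U) %/ (128 * U))%N.
      apply: evn; apply: ev_leq; [exact/ev_lit/ltM| |exact: ltM].
      have dM a b : (a < M)%N -> (a %/ b < M)%N by apply: leq_ltn_trans (leq_div _ _).
      apply: ev_div _ (VE i) _; last by do 4!(apply: (dM _ _)).
      apply: ev_div _ (VE i) _; last by do 3!(apply: (dM _ _)).
      apply: ev_div _ (VE i) _; last by do 2!(apply: (dM _ _)).
      apply: ev_div _ (VE i) _; last by apply: dM.
      by apply: ev_div; [exact: ev_np|exact/ev_lit/ltM|].
    (* Repeated division tests [10 * (128 * U)^4 <= p] without forming a power that might exceed the
       word capacity. *)
    rewrite -!divnMA divn_gt0; last by rewrite !muln_gt0 U0.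
    rewrite (_ : (128 * U) ^ 4 = 128 * U * (128 * U * (128 * U * (128 * U))))%N; last by rewrite !expnS expn0 muln1.
    by case: (_ <= _)%N.
  case: (leqP (10 * (128 * U) ^ 4) p) => hU; last first.
    split=> //; exists U; split=> //; case: hl => [l0|hl].
      by left; rewrite /U l0.
    case: (posnP l) => [l0|l0]; first by left; rewrite /U l0.
    by right; split=> //; rewrite /U -[X in (X <= _)%N]expn1 leq_exp2l.
  split.
    apply: (lt_up_log (d0 := 1)) => //; rewrite mul1n.
    apply: leq_ltn_trans (_ : U < p)%N; first by rewrite /U; case: (l) => // l'; rewrite leq_exp2r.
    have V0 : (0 < 128 * U)%N by rewrite muln_gt0.
    apply: leq_trans hU; apply: leq_trans (_ : 128 * U <= _)%N; first by rewrite ltn_Pmull.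
    by apply: leq_trans (leq_pexp2l V0 (isT : 1 <= 4)%N) (leq_pmull _ _).
  apply: dt_le (dt_writes (C := [:: _]) _ _) _ _ => // sg2 [sg2E fr2].
  have sg2E' i : sg2 i = upd (sg1 i) vU 0 (Int (128 * U)).
    by rewrite sg2E (exec_set _ (w := Int (128 * U))) ?ltM //; apply: VE.
  split.
  - by apply: (frame_sub (frame_cat fr1 fr2)).
  - by move=> i; rewrite sg2E' expnS.
  by right; rewrite [(128 ^ l.+1)%N]expnS.
by split=> //; left.
Qed.

(** [vR] starts at [k - 1], the number of elements below [xs]. For [n = 1] the reduction is skipped:
    [alpha * ln n] is 0, and 1 bounds all list lengths anyway. *)
Definition prepare : program :=
  [:: asg vN (Read 0 (Lit 2)); asg vR (Op Sub (Read 0 (Lit 3)) (Lit 1));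
      asg vCNT (Read 0 (Lit 4)); asg vM0 (Lit 1); asg vU (Lit 1)] ++
  [:: If (Op Leq (Lit 2) (var vN))
         (asg vAcc (var vCNT) :: allreduce emax vM0 ++ [:: size_loop]) [::]] ++
  [:: asg vJ (Lit 0); asg vMM (var vM0)] ++
  [:: for_loop [:: Write aA (var vJ) (Read 1 (var vJ)); asg vJ next]].

(* A single element needs no communication. *)
Definition finish : program :=
  [:: asg vPv (Read aA (Lit 0))] ++
  [:: If (Op Leq (Lit 2) (Read 0 (Lit 2)))
         (broadcast (var vCNT) (Read aA (Lit 0)) ++ [:: asg vPv (Read aG (Lit 1))]) [::]] ++
  [:: asg vJ (Lit 0); asg vMM (var vM0)] ++
  [:: for_loop [:: Write 2 (var vJ) (Op Leq (Read 1 (var vJ)) (var vPv)); asg vJ next]].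

Definition select : program :=
  prepare ++ [:: While (Op Leq (Lit 2) (var vN)) round] ++ finish.

(** * The program on a given input *)

Section Select.
Variables (inp : 'I_p -> seq T) (k n : nat).
Hypotheses (k1 : (1 <= k <= n)%N) (nE : tot inp = n) (nB : (n <= B)%N).
Hypotheses (gi : good inp) (kE : lower inp = k.-1).

Definition m0 : nat := if (2 <= n)%N then \max_i size (inp i) else 1%N.

Definition input_state (sg : mem) : Prop :=
  [/\ env sg, forall i, sg i 0%N 2%N = Int n, forall i, sg i 0%N 3%N = Int k,
      forall i, sg i 0%N 4%N = Int (size (inp i)) &
      forall i j, (j < size (inp i))%N -> sg i 1%N j = Elt (nth xs (inp i) j)].

Lemma size_m0 i : (size (inp i) <= m0)%N.
Proof.
rewrite /m0; case: leqP => n2; last exact: leq_bigmax.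
by apply: leq_trans (size_le_tot inp i) _; rewrite nE.
Qed.

Lemma m0_le : (m0 <= n)%N.
Proof.
rewrite /m0; case: leqP => n2; first by case/andP: k1 => h h'; apply: leq_trans h h'.
by apply/bigmax_leqP => i _; rewrite -nE size_le_tot.
Qed.

Lemma m0_gt0 : (0 < m0)%N.
Proof. by have [_ [i xi]] := gi; apply: leq_trans (size_m0 i); case: (inp i) xi. Qed.

Definition setup_cost : R := if (2 <= n)%N then logcost *+ 5 else 0.

Lemma input_frame l sg sg' : frame l sg sg' -> all (fun a => a \notin l) [:: 0; 1]%N ->
  input_state sg -> input_state sg'.
Proof.
move=> fr /= /and3P[l0 l1 _] [h0 h1 h2 h3 h4]; split.
- exact: env_frame fr l0 h0.
- by move=> i; rewrite fr.
- by move=> i; rewrite fr.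
- by move=> i; rewrite fr.
by move=> i j /h4 <-; rewrite fr.
Qed.

Lemma dt_prepare sg : input_state sg ->
  dt prepare sg (fun sg' => [/\ input_state sg', state inp sg',
      forall i, sg' i vM0 0%N = Int m0 &
      exists U, [/\ forall i, sg' i vU 0%N = Int U, valid_size U &
                    (1 < n)%N -> (p < 10 * (128 * U) ^ 4)%N]])
    (m0%:R * (3%:R * W) + 10%:R * W + setup_cost).
Proof.
move=> st; have [en nS kS cS iS] := st.
have h0 := W0; have lcW := logcost_W; have lc0 := logcost_ge0.
have B0 : (0 < B)%N by apply: leq_trans pB.
have m0W k' : 0 <= m0%:R * (k'%:R * W) by costs.
have sc0 : 0 <= setup_cost by rewrite /setup_cost; case: ifP => _; costs.
have m0B : (m0 <= B)%N := leq_trans m0_le nB.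
have cB i : (size (inp i) <= B)%N := leq_trans (size_m0 i) m0B.
apply: (dt_le (c := 5%:R * W + ((W + setup_cost) + (2%:R * W + (m0%:R * (W + 2%:R * W) + W)))) _ _ (fun _ => id)); last by lra.
apply: dt_cat; [exact: dt_writes| |by costs].
move=> sg1 [sg1E fr1]; have st1 := input_frame fr1 isT st.
have sg1E' i : sg1 i = upd (upd (upd (upd (upd (sg i) vN 0 (Int n)) vR 0 (Int k.-1))
    vCNT 0 (Int (size (inp i)))) vM0 0 (Int 1)) vU 0 (Int 1).
  rewrite sg1E (exec_set _ (w := Int n)) ?ltM ?eval_readl ?ltM //.
  rewrite (exec_set _ (w := Int k.-1)) ?ltM //; last first.
    have ki := kS i; rewrite -/(ev _ _ _ _) -subn1; ev_by ki => //; try exact: ltM.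
    by apply: BMx; case/andP: k1 nB; clear; lia.
  rewrite (exec_set _ (w := Int (size (inp i)))) ?ltM ?eval_readl ?ltM //; last by rewrite /upd /= cS.
  rewrite (exec_set _ (w := Int 1)) ?ltM //; last exact/ev_lit/ltM.
  by rewrite (exec_set _ (w := Int 1)) ?ltM //; last exact/ev_lit/ltM.
pose P2 sg' := [/\ frame [:: vAcc; vRcv; vD; aG; vM0; vU] sg1 sg',
      forall i : 'I_p, sg' i vM0 0%N = Int m0 &
      exists U, [/\ forall i : 'I_p, sg' i vU 0%N = Int U, valid_size U &
                    (1 < n)%N -> (p < 10 * (128 * U) ^ 4)%N]].
apply: (dt_cat (P1 := P2)); last by costs.
  apply: (dt_if p0 unit_workW (b := (2 <= n)%N)) => //.
    move=> i; have -> : evaln M (sg1 i) (Op Leq (Lit 2) (var vN)) = (2 <= n)%N.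
      apply: evn; have Ni : sg1 i vN 0%N = Int n by rewrite sg1E'.
      by ev_by Ni => //; exact: ltM.
    by case: (_ <= _)%N.
  rewrite /setup_cost; case: ifP => n2; last first.
    apply: dt_nil; split=> //; first by move=> i; rewrite sg1E' /m0 n2.
    by exists 1%N; split; [move=> i; rewrite sg1E'|left|rewrite n2].
  have [en1 _ _ _ _] := st1.
  apply: (dt_le (c := 1%:R * W + (logcost *+ 3 + logcost)) _ _ (fun _ => id)); last first.
    by rewrite -[logcost *+ 3]mulr_natl -[logcost *+ 5]mulr_natl; lra.
  rewrite -cat1s; apply: dt_cat; [exact: dt_writes| |by costs].
  move=> sg2 [sg2E fr2]; have en2 := env_frame fr2 isT en1.
  have Acc2 i : sg2 i vAcc 0%N = Int (ext (fun i => size (inp i)) i).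
    rewrite sg2E (exec_set _ (w := Int (size (inp i)))) ?ltM //; first by rewrite ext_ord.
    by rewrite eval_readl ?ltM // sg1E'.
  have maxB a b : (\big[maxn/0%N]_(a <= j < b) ext (fun i => size (inp i)) j <= B)%N.
    elim/big_ind: _ => // [x y xB yB|j _]; first by rewrite geq_max xB.
    by rewrite /ext; case: insub => // i.
  apply: dt_cat; last by costs.
    apply: (dt_allreduce (op := maxn)) Acc2 => //.
    - exact: ev_opmax.
    by move=> a b _ /=; apply: BMx; apply: leq_trans (maxB a b) _; clear; lia.
  move=> sg3 [fr3 _ M3]; have en3 := env_frame fr3 isT en2.
  apply: dt_le (dt_size_loop en3 _) _ _ => //.
    by move=> i; rewrite fr3 // fr2 // sg1E'.
  move=> sg4 [fr4 [U [UE hU pU]]]; split.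
  - by apply: (frame_sub (frame_cat fr2 (frame_cat fr3 fr4))).
  - move=> i; rewrite fr4 // M3 /m0 n2 /= big_mkord.
    by congr Int; apply: eq_bigr => j _; rewrite ext_ord.
  by exists U; split.
move=> sg2 [fr2 M2 [U [UE hU pU]]].
apply: dt_cat; [exact: dt_writes| |by costs].
move=> sg3 [sg3E fr3].
have sg3E' i : sg3 i = upd (upd (sg2 i) vJ 0 (Int 0)) vMM 0 (Int m0).
  rewrite sg3E (exec_set _ (w := Int 0)) ?ltM //; last exact/ev_lit/ltM.
  by rewrite (exec_set _ (w := Int m0)) ?ltM ?eval_readl ?ltM //; apply: M2.
have fr03 := frame_cat fr1 (frame_cat fr2 fr3).
pose J l sg' := [/\ frame [:: aA; vJ] sg3 sg', forall i, sg' i vJ 0%N = Int l &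
  forall i j, (j < l)%N -> (j < size (inp i))%N -> sg' i aA j = Elt (nth xs (inp i) j)].
apply: (dt_for (J := J)) => //.
- by costs.
- by apply: BMx; clear -m0B B0; lia.
- by move=> l sg' [fr h _] i; rewrite h fr // sg3E'.
- move=> l sg4 lm [fr4 J4 A4].
  have lM : (l.+1 < M)%N by apply: BMx; clear -lm m0B; lia.
  apply: dt_le (dt_writes (C := [:: _; _]) _ _) _ _ => // sg5 [sg5E fr5].
  have sg5E' i : sg5 i = upd (upd (sg4 i) aA l (sg4 i 1%N l)) vJ 0 (Int l.+1).
    have Ji := J4 i.
    rewrite sg5E (exec_write _ (x := l) (w := sg4 i 1%N l)); first last.
    - by apply: (eval_read (x := l)) => //; ev_by Ji => //; apply: ltM.
    - by ev_by Ji => //; apply: ltM.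
    by rewrite (exec_set _ (w := Int l.+1)) ?ltM //; apply: ev_next.
  split.
  + by apply: (frame_sub (frame_cat fr4 fr5)).
  + by move=> i; rewrite sg5E'.
  move=> i j; rewrite ltnS leq_eqVlt sg5E' /upd /= => /orP[/eqP -> js|jl js].
    by rewrite eqxx fr4 // fr03 // iS.
  by rewrite (ltn_eqF jl) A4.
- by split=> // i; rewrite sg3E'.
move=> sg4 [fr4 J4 A4]; have fr04 := frame_cat fr03 fr4.
have st4 : input_state sg4 := input_frame fr04 isT st.
have [en4 _ _ _ _] := st4; split=> //.
- split=> //.
  + by move=> i; rewrite fr4 // fr3 // fr2 // sg1E'.
  + by move=> i j js; apply: A4 => //; apply: leq_trans js (size_m0 i).
  + by move=> i; rewrite fr4 // fr3 // fr2 // sg1E' /upd /= -nE.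
  by move=> i; rewrite fr4 // fr3 // fr2 // sg1E' /upd /= -kE.
- by move=> i; rewrite fr4 // fr3 // M2.
by exists U; split=> // i; rewrite fr4 // fr3.
Qed.

Lemma dt_finish loc sg : input_state sg -> state loc sg -> good loc -> (tot loc <= 1)%N ->
  (tot loc <= n)%N -> (forall i, (size (loc i) <= size (inp i))%N) ->
  (forall i, sg i vM0 0%N = Int m0) ->
  dt finish sg (fun sg' => forall i j, (j < size (inp i))%N ->
     sg' i 2%N j = Int (nth xs (inp i) j <= xs)%O)
    (m0%:R * (3%:R * W) + 10%:R * W + setup_cost).
Proof.
move=> ist st gl t1 tn szl M0E; have [en nS kS cS iS] := ist.
have [_ CE AE _ _] := st.
have h0 := W0; have lcW := logcost_W; have lc0 := logcost_ge0.
have B0 : (0 < B)%N by apply: leq_trans pB.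
have m0W k' : 0 <= m0%:R * (k'%:R * W) by costs.
have sc0 : 0 <= setup_cost by rewrite /setup_cost; case: ifP => _; costs.
have m0B : (m0 <= B)%N := leq_trans m0_le nB.
have [ul [ix xix]] := gl.
have cix : size (loc ix) = 1%N.
  apply/eqP; rewrite eqn_leq (leq_trans (size_le_tot loc ix) t1) /=.
  by case: (loc ix) xix.
have c0 i : i != ix -> size (loc i) = 0%N.
  move=> iix; apply/eqP; rewrite -leqn0 -ltnS; apply: leq_trans t1.
  rewrite /tot (bigD1 ix) //= cix ltnS (bigD1 i) //= leq_addr //.
have locx : loc ix = [:: xs].
  by case: (loc ix) cix xix => [|y [|//]] // _; rewrite inE => /eqP ->.
apply: (dt_le (c := 1%:R * W + ((W + setup_cost) + (2%:R * W + (m0%:R * (W + 2%:R * W) + W)))) _ _ (fun _ => id)); last by lra.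
apply: dt_cat; [exact: dt_writes| |by costs].
move=> sg1 [sg1E fr1]; have st1 := input_frame fr1 isT ist; have stl1 := state_frame fr1 isT st.
have [en1 CE1 AE1 _ _] := stl1.
have ax i : i = ix -> sg i aA 0%N = Elt xs by move=> ->; rewrite AE locx.
have P1 i : i = ix -> sg1 i vPv 0%N = Elt xs.
  by move=> /ax h; rewrite sg1E (exec_set _ (w := Elt xs)) ?ltM ?eval_readl ?ltM.
pose P2 (sg' : mem) := frame [:: aG; vD; vPv] sg1 sg' /\
  forall i : 'I_p, (0 < size (inp i))%N -> sg' i vPv 0%N = Elt xs.
apply: (dt_cat (P1 := P2)); last by costs.
  apply: (dt_if p0 unit_workW (b := (2 <= n)%N)) => //.
    move=> i; have -> : evaln M (sg1 i) (Op Leq (Lit 2) (Read 0 (Lit 2))) = (2 <= n)%N.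
      have [_ nS1 _ _ _] := st1; have ni := nS1 i.
      by apply: evn; ev_by ni => //; exact: ltM.
    by case: (_ <= _)%N.
  rewrite /setup_cost; case: ifP => n2; last first.
    apply: dt_nil; split=> // i si; apply: P1.
    (* Without a broadcast the pivot is known only at [ix], which is here the only PE with a
       nonempty list. *)
    have n1 : tot inp = 1%N.
      by apply/eqP; rewrite nE eqn_leq leqNgt n2 /=; case/andP: k1; apply: leq_trans.
    apply/eqP; apply: contraT => iix.
    have : (0 < size (inp ix))%N by apply: leq_trans (szl ix); rewrite cix.
    move: n1; rewrite /tot (bigD1 ix) //= (bigD1 i) //=; move: si; clear; lia.
  apply: (dt_le (c := (2%:R * W + logcost) + 1%:R * W) _ _ (fun _ => id)); last first.
    by rewrite -[logcost *+ 5]mulr_natl; lra.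
  apply: dt_cat; last by costs.
    apply: (dt_broadcast (b := fun i => i == ix) (u := fun _ => Elt xs)) => //.
    - move=> i; rewrite (_ : (i == ix : nat) = size (loc i)).
        by ev_by CE1 => //; apply: ltM.
      by case: eqP => [->|/eqP /c0 ->].
    by move=> i /eqP ->; rewrite eval_readl ?ltM // /upd /= AE1 locx.
  move=> sg2 [fr2 _ G2]; have {}G2 i := G2 ix (Elt xs) (eqxx ix) (fun _ _ => erefl) i.
  apply: dt_le (dt_writes (C := [:: _]) _ _) _ _ => // sg3 [sg3E fr3].
  split; first by apply: (frame_sub (frame_cat fr2 fr3)).
  move=> i _; rewrite sg3E (exec_set _ (w := Elt xs)) ?ltM //.
  by rewrite eval_readl ?ltM //; case: (G2 i).
move=> sg2 [fr2 P2E].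
apply: dt_cat; [exact: dt_writes| |by costs].
move=> sg3 [sg3E fr3].
have sg3E' i : sg3 i = upd (upd (sg2 i) vJ 0 (Int 0)) vMM 0 (Int m0).
  rewrite sg3E (exec_set _ (w := Int 0)) ?ltM //; last exact/ev_lit/ltM.
  rewrite (exec_set _ (w := Int m0)) ?ltM ?eval_readl ?ltM //.
  by rewrite /upd /= fr2 // fr1.
have fr03 := frame_cat fr1 (frame_cat fr2 fr3).
pose J l sg' := [/\ frame [:: 2; vJ]%N sg3 sg', forall i, sg' i vJ 0%N = Int l &
  forall i j, (j < l)%N -> (j < size (inp i))%N -> sg' i 2%N j = Int (nth xs (inp i) j <= xs)%O].
apply: (dt_for (J := J)) => //.
- by costs.
- by apply: BMx; clear -m0B B0; lia.
- by move=> l sg' [fr h _] i; rewrite h fr // sg3E'.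
- move=> l sg4 lm [fr4 J4 A4].
  have lM : (l.+1 < M)%N by apply: BMx; clear -lm m0B; lia.
  apply: dt_le (dt_writes (C := [:: _; _]) _ _) _ _ => // sg5 [sg5E fr5].
  have sg5E' i : sg5 i = upd (upd (sg4 i) 2%N l (Int (leq_word (sg4 i 1%N l) (sg4 i vPv 0%N)))) vJ 0 (Int l.+1).
    have Ji := J4 i.
    rewrite sg5E (exec_write _ (x := l) (w := Int (leq_word (sg4 i 1%N l) (sg4 i vPv 0%N)))); first last.
    - apply: ev_leq_word; [|by rewrite eval_readl ?ltM|exact: ltM].
      by apply: (eval_read (x := l)) => //; ev_by Ji => //; apply: ltM.
    - by ev_by Ji => //; apply: ltM.
    by rewrite (exec_set _ (w := Int l.+1)) ?ltM //; apply: ev_next.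
  split.
  + by apply: (frame_sub (frame_cat fr4 fr5)).
  + by move=> i; rewrite sg5E'.
  move=> i j; rewrite ltnS leq_eqVlt sg5E' /upd /= => /orP[/eqP -> js|jl js].
    rewrite eqxx !fr4 // fr03 // iS // fr3 // P2E //.
    exact: leq_ltn_trans js.
  by rewrite (ltn_eqF jl) A4.
- by split=> // i; rewrite sg3E'.
move=> sg4 [fr4 J4 A4] i j js; apply: A4 => //.
exact: leq_trans js (size_m0 i).
Qed.

Definition select_cost : R := m0%:R * (6%:R * W) + 21%:R * W + setup_cost *+ 2.
(** One [logcost] more than in [round_cost], to cover the guard of the main loop; the length of
    messages is bounded independently of the round. *)
Definition latency_cost : R := logcost *+ 34 + 3%:R * (Num.min m0%:R (Num.sqrt p%:R) * beta).

Lemma growth_ge U : valid_size U -> 4 / 3 <= growth U.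
Proof.
rewrite /growth => -[->|[U128 _]]; first by rewrite eqxx.
have h : 128 <= U%:R :> R by rewrite (ler_nat _ 128).
by case: eqP => // _; lra.
Qed.

(** The program computes [U] itself, so the credit must do for every value it may find. The separate
    bound by [select_cost] pays for [prepare], which runs before [U] is known. *)
Lemma wp_select sg x : input_state sg -> (1 < p)%N -> select_cost <= x ->
  (forall U, valid_size U -> ((1 < n)%N -> p < 10 * (128 * U) ^ 4)%N ->
    select_cost + potential m0 latency_cost (21%:R * W) (growth U) n <= x) ->
  wp M alpha beta final select (fun sg' _ => forall i j, (j < size (inp i))%N ->
     sg' i 2%N j = Int (nth xs (inp i) j <= xs)%O) sg x.
Proof.
move=> ist p1 scx hx; have h0 := W0; have lc0 := logcost_ge0; have lcW := logcost_W.
have sc0 : 0 <= setup_cost by rewrite /setup_cost; case: ifP => _; costs.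
have m0W k' : 0 <= m0%:R * (k'%:R * W) by costs.
have m0B : (m0 <= B)%N := leq_trans m0_le nB.
have m0R : (0 < m0)%N := m0_gt0.
have B0 : (0 < B)%N by apply: leq_trans pB.
set cF := m0%:R * (3%:R * W) + 10%:R * W + setup_cost.
have cF0 : 0 <= cF by rewrite /cF; have := m0W 3%N; lra.
have cE : select_cost = cF + (W + cF) by rewrite /select_cost /cF mulr2n; ring.
rewrite cE in scx hx.
apply: wp_dt (dt_prepare ist) _ _; first by rewrite -/cF; lra.
move=> sg1 x1 [ist1 st1 M01 [U [U1 hU pU]]] x1E; rewrite -/cF in x1E.
have {}hx := hx U hU pU; have G43 := growth_ge hU.
have UB : (U <= B)%N.
  case: hU => [->|[U128 Up]] //; apply: leq_trans pB; apply: leq_trans Up.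
  have U0 : (0 < U)%N by apply: leq_trans U128.
  by apply: leq_trans (leq_pexp2l U0 (isT : 1 <= 4)%N) (leq_pmull _ _).
set A := latency_cost in hx.
have A0 : 0 <= A.
  rewrite /A /latency_cost; costs; by rewrite le_min ler0n sqrtr_ge0.
have w0 : 0 <= 21%:R * W by costs.
pose pot := potential m0 A (21%:R * W) (growth U).
have pot0 N : 0 <= pot N by apply: potential_ge0.
(* Beside the potential, the final guard and [finish] are kept in reserve. *)
pose I sg' y := exists loc, [/\ state loc sg' /\ good loc,
  (tot loc <= n)%N /\ forall i, (size (loc i) <= size (inp i))%N,
  input_state sg', (forall i, sg' i vM0 0%N = Int m0) /\ (forall i, sg' i vU 0%N = Int U) &
  pot (tot loc) + (W + cF) <= y].
apply/wp_cat; apply: (wp_while p0 unit_workW (I := I)) => //; last first.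
  exists inp; split=> //; first by rewrite nE.
  by rewrite nE /pot; lra.
move=> sg2 y [loc [[st2 gl] [tn szl] ist2 [M02 U2] hy]].
have potl := pot0 (tot loc).
have totB : (tot loc <= B)%N := leq_trans tn nB.
exists (2 <= tot loc)%N.
  have [_ _ _ N2 _] := st2; move=> i; have N2i := N2 i.
  have -> : evaln M (sg2 i) (Op Leq (Lit 2) (var vN)) = (2 <= tot loc)%N.
    by apply: evn; ev_by N2i => //; exact: ltM.
  by case: (_ <= _)%N.
case: ifP => N2; last first.
  have t1 : (tot loc <= 1)%N by rewrite leqNgt N2.
  split; first by lra.
  rewrite -[finish]cats0.
  apply: wp_dt (dt_finish ist2 st2 gl t1 tn szl M02) _ _; first by rewrite -/cF; lra.
  by move=> sg3 x3 h3 x3E; apply: wp_nil => //; rewrite -/cF in x3E; lra.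
have szlm i : (size (loc i) <= m0)%N := leq_trans (szl i) (size_m0 i).
apply: (wp_round (U := U) (loc := loc) (m0 := m0) (Phi := fun N => pot N + (W + cF))) => //.
- by move=> N; rewrite addr_ge0 //; lra.
- move=> sg3 x3 loc3 st3 gl3 fr3 tl sl hx3; exists loc3; split=> //.
  + split; first exact: leq_trans tl tn.
    by move=> i; apply: leq_trans (sl i) (szl i).
  + exact: input_frame fr3 isT ist2.
  by split=> i; rewrite fr3.
set mm := minn m0 (tot loc).
have szmm i : (size (loc i) <= mm)%N by rewrite leq_min szlm size_le_tot.
have mx1 : (0 < #|{: mm.-tuple rnd}|)%N by rewrite card_tuple expn_gt0 card_rnd.
rewrite avgD avg_cst //.
have qM : (maxn 1 (tot loc + tot loc) <= M)%N.
  by rewrite geq_max; apply/andP; split; [apply: leq_trans M1|apply/ltnW/BMx; clear -totB; lia].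
have [N1 [hN1 hpr]] := round_progress szmm qM gl N2 p1 hU.
have := potential_drift m0R A0 w0 G43 (X := fun ws : mm.-tuple rnd => tot (round_result U loc ws))
  mx1 N2 hN1 (fun ws => round_result_le loc U ws) hpr.
rewrite -/pot => hd.
have : round_cost mm + W <= A + 21%:R * W * Num.min (tot loc)%:R m0%:R.
  have mmE : mm%:R = Num.min (tot loc)%:R m0%:R :> R.
    by rewrite /mm minnC; case: (leqP (tot loc) m0) => h; [rewrite min_l ?ler_nat|rewrite min_r ?ler_nat // ltnW].
  rewrite /round_cost /A /latency_cost -mmE.
  have : Num.min mm%:R (Num.sqrt p%:R) * beta <= Num.min m0%:R (Num.sqrt p%:R) * beta :> R.
    by rewrite ler_wpM2r // le_min !ge_min lexx ler_nat geq_minl orbT.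
  by rewrite -[logcost *+ 33]mulr_natl -[logcost *+ 34]mulr_natl; lra.
by lra.
Qed.

End Select.

End Rounds.

End Selection.


(** * The total cost *)

Section Cost.
Variable R : realType.

(** The origin of 128 and 80. If [U = 1], then [p < 10 * 128^4 <= 4^16] and [4 <= (4/3)^5], whence
    [80 = 5 * 16]. Otherwise [10 * 128^4 <= 128^5] gives [p <= U^9], and [33^4 <= 128^3] gives
    [U <= (U / 33)^4]; 36 is less than 80. *)
Lemma ln_growth p U : (1 < p)%N -> valid_size p U ->
  p%:R < 10 * (128 * U%:R) ^+ 4 :> R -> ln (p%:R : R) <= 80 * ln (growth R U).
Proof.
move=> p1 hU pU; have p0 : 0 < p%:R :> R by rewrite ltr0n ltnW.
have pe (x : R) k : 0 < x -> p%:R <= x ^+ k -> ln (p%:R : R) <= k%:R * ln x.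
  by move=> x0 h; rewrite mulr_natl -lnXn // ler_ln // posrE exprn_gt0.
rewrite /growth; case: hU pU => [->|[U128 _]] pU.
  rewrite eqxx; apply: pe; first lra.
  apply: (@le_trans _ _ (4 ^+ 16)).
    by apply: ltW; apply: lt_le_trans pU _; rewrite !exprS !expr0; lra.
  rewrite (exprM (4 / 3) 5 16); apply: lerXn2r; rewrite ?nnegrE ?exprn_ge0 //.
  by rewrite !exprS expr0; lra.
have U1 : (U == 1)%N = false by apply/eqP => U1; rewrite U1 in U128.
have U0 : 128 <= U%:R :> R by rewrite (ler_nat _ 128).
clear U128; rewrite U1; have h9 : ln (p%:R : R) <= 9 * ln (U%:R : R).
  apply: pe; first lra.
  apply: ltW; apply: lt_le_trans pU _; rewrite exprMn mulrA (exprD _ 5 4).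
  apply: ler_wpM2r; first by rewrite exprn_ge0.
  apply: (@le_trans _ _ (128 ^+ 5)); last by rewrite lerXn2r // nnegrE; lra.
  by rewrite !exprS !expr0; lra.
have h4 : ln (U%:R : R) <= 4 * ln (U%:R / 33 : R).
  rewrite mulr_natl -lnXn; last by lra.
  rewrite ler_ln ?posrE ?exprn_gt0 //; [|lra|lra].
  rewrite expr_div_n ler_pdivlMr ?exprn_gt0 // exprS ler_pM2l; last lra.
  apply: (@le_trans _ _ (128 ^+ 3)); last by rewrite lerXn2r // nnegrE; lra.
  by rewrite !exprS expr0; lra.
have l0 : 0 <= ln (U%:R : R) by apply: ln_ge0; lra.
by lra.
Qed.

(** From [exp x >= 1 + x] at [x = - 1/2]. *)
Lemma ln_ge_half (n : nat) : (2 <= n)%N -> 1 / 2 <= ln (n%:R : R).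
Proof.
move=> n2; apply: (@le_trans _ _ (ln 2)); last first.
  by rewrite ler_ln ?posrE ?(ler_nat _ 2) // ltr0n ltnW.
have h : ln (2^-1 : R) <= - (1 / 2).
  rewrite -[X in _ <= X]expRK ler_ln ?posrE ?expR_gt0 ?invr_gt0 //.
  by apply: le_trans (expR_ge1Dx _); lra.
by rewrite lnV ?posrE // in h; lra.
Qed.

(* The length of the messages of a round times the order of the number of rounds. *)
Lemma volume_bound (c : R) (p n m : nat) : (1 < p)%N -> (1 < n)%N ->
  m%:R <= c * (n%:R / p%:R) -> 0 < c ->
  Num.min m%:R (Num.sqrt p%:R) * (ln n%:R / ln p%:R) <=
  (3 * c + 5) * Num.min (Num.sqrt p%:R * (ln n%:R / ln p%:R)) (n%:R / p%:R) :> R.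
Proof.
move=> p1 n1 mc c0; set P : R := p%:R in mc *; set N : R := n%:R in mc *.
have P2 : 2 <= P by rewrite (ler_nat _ 2).
have N2 : 2 <= N by rewrite (ler_nat _ 2).
have l0 := ln_ge_half p1; have L0 := ln_ge_half n1; rewrite -/P -/N in l0 L0.
set l := ln P in l0 *; set L := ln N in L0 *.
have q0 : 0 <= L / l by rewrite divr_ge0 //; lra.
set V := Num.min _ _; have V0 : 0 <= V by rewrite /V le_min ler0n sqrtr_ge0.
have Vm : V <= m%:R by rewrite /V ge_min lexx.
have Vs : V <= Num.sqrt P by rewrite /V ge_min lexx orbT.
have NP0 : 0 <= N / P by rewrite divr_ge0.
have sq0 : 0 <= Num.sqrt P * (L / l) by rewrite mulr_ge0 ?sqrtr_ge0.
have VL : V * (L / l) <= Num.sqrt P * (L / l) by rewrite ler_wpM2r.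
set Y := Num.sqrt P * (L / l) in VL sq0 *; set Z := N / P in mc NP0 *; case: (leP Y Z) => _.
  by apply: le_trans VL _; rewrite -[X in X <= _]mul1r ler_wpM2r //; lra.
(* The minimum is now [n / p]. If [n <= p^3], the ratio of logarithms is at most 3, and bounding the
   message by [m] gives [3 * c]. *)
have [h|h] := leP N (P ^+ 3).
  have hl : L <= 3 * l.
    by rewrite /L /l mulr_natl -lnXn ?ler_ln ?posrE ?exprn_gt0 //; lra.
  have h3 : L / l <= 3 by rewrite ler_pdivrMr //; lra.
  apply: (@le_trans _ _ (m%:R * 3)); first by apply: ler_pM.
  by lra.
(* If [n > p^3], then [sqrt p <= sqrt n / p], while the ratio of logarithms is at most [4 * sqrt n];
   the product is at most [4 * n / p]. *)
apply: le_trans VL _; set s := Num.sqrt N.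
have s0 : 0 < s by rewrite sqrtr_gt0; lra.
have sE : s * s = N by rewrite -expr2 sqr_sqrtr //; lra.
have Ls : L <= 2 * s.
  have : ln s < s by apply: ln_sublinear.
  by rewrite /L -sE lnM ?posrE //; lra.
have Ps : P * Num.sqrt P <= s.
  rewrite /s -[X in X <= _]ger0_norm ?mulr_ge0 ?sqrtr_ge0 //.
  rewrite -sqrtr_sqr ler_wsqrtr // exprMn sqr_sqrtr; last lra.
  by apply: le_trans (ltW h); rewrite -exprSr.
have {}Ps : Num.sqrt P <= s / P by rewrite ler_pdivlMr 1?mulrC //; lra.
have Ll : L / l <= 4 * s by rewrite ler_pdivrMr //; nra.
apply: (@le_trans _ _ ((s / P) * (4 * s))); first by apply: ler_pM => //; exact: sqrtr_ge0.
have -> : s / P * (4 * s) = 4 * Z by rewrite /Z -sE; ring.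
by rewrite ler_wpM2r //; lra.
Qed.

(** The hypotheses on [kappa] let [alpha] dominate both the unit work and the few words of a
    level. *)
Lemma logcost_le (kappa a b W : R) p : (1 < p)%N -> 0 <= W -> 0 < kappa -> 0 <= a ->
  b <= kappa * a -> 1 <= kappa * a ->
  logcost p a b W <= 6 * ((10 * W + 5) * kappa + 1) * (a * ln p%:R).
Proof.
move=> p1 W0 k0 a0 bka ka; have l0 := ln_ge_half p1.
have lev : level a b W <= ((10 * W + 5) * kappa + 1) * a.
  by rewrite /level; have := ler_wpM2l W0 ka; rewrite mulr1; lra.
have lev0 : 0 <= ((10 * W + 5) * kappa + 1) * a by rewrite mulr_ge0 // addr_ge0 // mulr_ge0 //; lra.
(* [up_log 2 p - 1 <= 2 * ln p] because [ln 2 >= 1/2], and the missing 2 is at most [4 * ln p]. *)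
have up : (up_log 2 p).+1%:R <= 6 * ln p%:R :> R.
  have h : (up_log 2 p).-1%:R * ln 2 <= ln p%:R :> R.
    rewrite mulr_natl -lnXn // ler_ln ?posrE ?exprn_gt0 // ?ltr0n ?(ltnW p1) //.
    by rewrite -natrX ler_nat ltnW // up_log_gtn.
  have l2 := ln_ge_half (isT : 2 <= 2)%N.
  have ul0 : (0 < up_log 2 p)%N by rewrite up_log_gt0.
  rewrite -[up_log 2 p]prednK // -!natr1.
  have : 0 <= (up_log 2 p).-1%:R :> R by [].
  by nra.
rewrite /logcost -[level _ _ _ *+ _]mulr_natl.
have -> : 6 * ((10 * W + 5) * kappa + 1) * (a * ln p%:R) =
   (6 * ln p%:R) * (((10 * W + 5) * kappa + 1) * a) by ring.
apply: (@le_trans _ _ ((up_log 2 p).+1%:R * (((10 * W + 5) * kappa + 1) * a))).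
  by rewrite ler_wpM2l.
by rewrite ler_wpM2r.
Qed.

(** As [n / m <= p], the logarithmic part is at most 80: the rounds with more than [m] elements are
    bounded in number. *)
Lemma work_left_le (p n m : nat) (G : R) : (1 < p)%N -> 4 / 3 <= G ->
  ln (p%:R : R) <= 80 * ln G -> (0 < m)%N -> (0 < n)%N -> (n <= p * m)%N ->
  work_left m G n%:R <= 81 * m%:R.
Proof.
move=> p1 G43 lG m0 n0 nm; have Lg := lnG_gt0 G43; have l0 := ln_ge_half p1.
have mR : 0 < m%:R :> R by rewrite ltr0n.
rewrite /work_left; apply: (@le_trans _ _ (m%:R + m%:R * 80)); last lra.
apply: lerD; first by rewrite ge_min lexx orbT.
rewrite ler_pM2l // ler_pdivrMr // ge_max; apply/andP; split; first by lra.
apply: le_trans lG; rewrite ler_ln ?posrE ?divr_gt0 ?ltr0n //; last exact: ltnW.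
by rewrite ler_pdivrMr // -natrM ler_nat.
Qed.

(** Makes [2 * p] a fictitious growth factor, with which the fixed cost can be estimated when no [U]
    is available. *)
Lemma ln_double (x : R) : 2 <= x -> 4 / 3 <= 2 * x /\ ln x <= 80 * ln (2 * x).
Proof.
move=> x2; have : ln x <= ln (2 * x) by rewrite ler_ln ?posrE; lra.
have : 0 < ln (2 * x) by apply: ln_gt0; lra.
by split; lra.
Qed.

(** [ln p] is at most [ln (max c 1) + ln n], and [ln n >= 1/2] absorbs the constant. This converts
    startups from [log p] to [log n]. *)
Lemma log_le (c : R) (p n : nat) : (1 < p)%N -> (1 < n)%N -> p%:R <= c * n%:R ->
  ln p%:R <= (2 * ln (Num.max c 1) + 1) * ln (n%:R : R).
Proof.
move=> p1 n1 pc; have L0 := ln_ge_half n1; have p0 : 0 < p%:R :> R by rewrite ltr0n ltnW.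
have n0 : 0 < n%:R :> R by rewrite ltr0n ltnW.
have c1 : 1 <= Num.max c 1 by rewrite le_max lexx orbT.
have lc0 : 0 <= ln (Num.max c 1) by apply: ln_ge0.
have : ln (p%:R : R) <= ln (Num.max c 1) + ln n%:R.
  rewrite -lnM ?posrE //; last by lra.
  rewrite ler_ln ?posrE ?mulr_gt0 //; last by lra.
  by apply: le_trans pc _; rewrite ler_pM2r // le_max lexx.
by nra.
Qed.

Definition log_factor (c : R) : R := 2 * ln (Num.max c 1) + 1.
(** 27 = 6 + 21 comes from [select_cost]. In all three constants 16 is the factor of [potential]; 81
    is from [work_left_le], 34 and 3 are from [latency_cost], and [log_factor c + 80] bounds [1 + q]
    against [log_p n], [q] being the number of reductions from [n]. *)
Definition work_const (c W : R) : R := (27 * W + 16 * (8 * (21 * W) * 81)) * c.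
Definition startup_const (c kappa W : R) : R :=
  6 * ((10 * W + 5) * kappa + 1) *
  (10 * log_factor c + 16 * 34 * (log_factor c + 80)).
Definition volume_const (c : R) : R := 16 * 3 * (log_factor c + 80) * (3 * c + 5).

Lemma log_factor_ge1 c : 1 <= log_factor c.
Proof.
rewrite /log_factor lerDr mulr_ge0 //; apply: ln_ge0.
by rewrite le_max lexx orbT.
Qed.

Lemma work_const_ge0 c W : 0 < c -> 0 <= W -> 0 <= work_const c W.
Proof. by move=> c0 W0; rewrite mulr_ge0 ?(ltW c0) // addr_ge0 ?mulr_ge0. Qed.

Lemma work_const_ge c W x : 0 <= W -> 1%:R <= c * x -> 27 * W <= work_const c W * x.
Proof.
move=> W0 cx; rewrite /work_const -mulrA.
apply: le_trans (_ : (27 * W + 16 * (8 * (21 * W) * 81)) * 1 <= _); first by rewrite mulr1; lra.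
by rewrite ler_wpM2l //; lra.
Qed.

Lemma startup_const_ge0 c kappa W : 0 < kappa -> 0 <= W -> 0 <= startup_const c kappa W.
Proof.
move=> k0 W0; have := log_factor_ge1 c; set f := log_factor c => f1.
have h : 0 <= (10 * W + 5) * kappa by rewrite mulr_ge0 ?(ltW k0) // addr_ge0 // mulr_ge0.
by rewrite /startup_const -/f; apply: mulr_ge0; lra.
Qed.

Lemma volume_const_ge0 c : 0 < c -> 0 <= volume_const c.
Proof.
move=> c0; have := log_factor_ge1 c; set f := log_factor c => f1.
by rewrite /volume_const -/f; apply: mulr_ge0; lra.
Qed.

(** [K] stands for [logcost]. A round has [O(log p)] startups and there are [O(log_p n)] rounds; the
    logarithm of [p] cancels in the product and leaves [log n]. *)
Lemma total_cost (c kappa a b W G K : R) (p n m : nat) :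
  0 < c -> 0 < kappa -> 0 <= b -> b <= kappa * a -> 1 <= kappa * a -> 0 <= W ->
  (1 < p)%N -> (1 < n)%N -> (0 < m)%N -> m%:R <= c * (n%:R / p%:R) -> (n <= p * m)%N ->
  4 / 3 <= G -> ln (p%:R : R) <= 80 * ln G ->
  0 <= K <= 6 * ((10 * W + 5) * kappa + 1) * (a * ln p%:R) ->
  m%:R * (6 * W) + 21 * W + 10 * K +
    potential m (34 * K + 3 * (Num.min m%:R (Num.sqrt p%:R) * b)) (21 * W) G n <=
  work_const c W * (n%:R / p%:R) + startup_const c kappa W * (a * ln n%:R) +
  volume_const c * (b * Num.min (Num.sqrt p%:R * (ln n%:R / ln p%:R)) (n%:R / p%:R)).
Proof.
move=> c0 k0 b0 bka ka W0 p1 n1 m0 mc nm G43 lG /andP[K0 KE].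
have a0 : 0 < a by rewrite -(pmulr_rgt0 _ k0); lra.
have l0 := ln_ge_half p1; have L0 := ln_ge_half n1; have Lg := lnG_gt0 G43.
have P0 : 0 < p%:R :> R by rewrite ltr0n ltnW.
have N0 : 0 < n%:R :> R by rewrite ltr0n ltnW.
have m1 : 1 <= m%:R :> R by rewrite ler1n.
have pcn : p%:R <= c * n%:R.
  by move: (le_trans m1 mc); rewrite mulrA ler_pdivlMr // mul1r.
have lc := log_le p1 n1 pcn; rewrite -/(log_factor c) in lc.
have lf1 := log_factor_ge1 c.
have wl := work_left_le p1 G43 lG m0 (ltnW n1) nm.
have vb := volume_bound p1 n1 mc c0.
rewrite /potential leqNgt n1 /=.
set V := Num.min m%:R _ in vb *; set mn := Num.min (_ * _) _ in vb *.
have V0 : 0 <= V by rewrite /V le_min ler0n sqrtr_ge0.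
set l := ln p%:R in l0 lc KE vb lG *; set L := ln n%:R in L0 lc vb *.
set K1 := 6 * ((10 * W + 5) * kappa + 1) in KE *.
have K10 : 0 <= K1 by rewrite /K1 mulr_ge0 // addr_ge0 // mulr_ge0 //; lra.
set q := L / ln G; set f := log_factor c in lc lf1 *.
have l00 : 0 < l by lra.
have q0 : 0 <= q by rewrite /q divr_ge0 //; lra.
have ql : q <= 80 * (L / l).
  rewrite /q mulrA ler_pdivrMr // mulrAC ler_pdivlMr //.
  have : L * l <= L * (80 * ln G) by rewrite ler_wpM2l //; lra.
  by lra.
have f1 : 1 <= f * (L / l) by rewrite mulrA ler_pdivlMr // mul1r.
(* one round costs [K] in startups, and there are [q] rounds *)
have aL : 0 <= K1 * a by rewrite mulr_ge0 // ltW.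
have Kq : K * q <= 80 * K1 * (a * L).
  apply: (@le_trans _ _ (K1 * (a * l) * (80 * (L / l)))); first by apply: ler_pM.
  have -> : K1 * (a * l) * (80 * (L / l)) = 80 * K1 * (a * L) * (l / l) by ring.
  by rewrite divff ?mulr1 // gt_eqF.
have KL : K <= K1 * f * (a * L).
  apply: le_trans KE _; have : K1 * a * l <= K1 * a * (f * L) by rewrite ler_wpM2l.
  by lra.
have Vq : V * b * (1 + q) <= (f + 80) * (3 * c + 5) * (b * mn).
  apply: (@le_trans _ _ (V * b * ((f + 80) * (L / l)))).
    by rewrite ler_wpM2l ?mulr_ge0 //; lra.
  have : (f + 80) * b * (V * (L / l)) <= (f + 80) * b * ((3 * c + 5) * mn).
    by rewrite ler_wpM2l // mulr_ge0 //; lra.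
  by lra.
have wW : 8 * (21 * W) * work_left m G n%:R <= 8 * (21 * W) * (81 * m%:R).
  by rewrite ler_wpM2l // mulr_ge0 // mulr_ge0.
have Wm : (27 * W + 16 * (8 * (21 * W) * 81)) * m%:R <= work_const c W * (n%:R / p%:R).
  by rewrite /work_const -[_ * c * _]mulrA ler_wpM2l //; lra.
have Wm1 : W <= W * m%:R by rewrite ler_peMr.
rewrite /startup_const -/K1 -/f /volume_const -/f.
have -> : (34 * K + 3 * (V * b)) * (1 + q) = 34 * K + 34 * (K * q) + 3 * (V * b * (1 + q)) by ring.
by lra.
Qed.

End Cost.

(** * The bound for the machine *)

Theorem theorem1 (R : realType) :
  exists (P : program) (e : nat), forall c kappa : R, 0 < c -> 0 < kappa ->
  exists C : R, forall (d : Order.disp_t) (T : orderType d) (p n k : nat)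
    (alpha beta : R) (inp : 'I_p -> seq T),
  (1 < p)%N -> (1 <= k <= n)%N ->
  0 <= beta -> beta <= kappa * alpha -> 1 <= kappa * alpha ->
  uniq (elements inp) -> size (elements inp) = n ->
  (forall i : 'I_p, (size (inp i))%:R <= c * (n%:R / p%:R)) ->
  let M := ((n + p) ^ e)%N in
  identifies M alpha beta P inp k /\
  (expected_time M alpha beta (initial R P inp k) <=
   (C * (n%:R / p%:R
         + beta * Num.min (Num.sqrt p%:R * (ln n%:R / ln p%:R)) (n%:R / p%:R)
         + alpha * ln n%:R))%:E)%E.
Proof.
exists select, 9%N => c kappa c0 k0.
set W : R := unit_work%:R.
have W0 : 0 <= W by [].
set Cw := work_const c W; set Ca := startup_const c kappa W; set Cb := volume_const c.
exists (Cw + Ca + Cb) => d T p n k alpha beta inp p1 kn be0 bka ka ue sn szc M.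
have p0 : (0 < p)%N := ltnW p1.
have a0 : 0 < alpha by rewrite -(pmulr_rgt0 _ k0); lra.
have [x0 _] : exists x0 : T, true.
  by case: (elements inp) sn => [/= n0|x s _]; [move: kn; rewrite -n0; case: k|exists x].
pose xs := nth x0 (sort <=%O (elements inp)) k.-1.
have k1n : (k.-1 < n)%N by case/andP: kn => h1 h2; rewrite prednK.
have totE : tot inp = n by rewrite -size_flatten_codom.
have gi : good xs inp.
  split=> //; have : xs \in elements inp by rewrite -(mem_sort <=%O) mem_nth // size_sort sn.
  by move=> /flattenP[s /codomP[i ->] xi]; exists i.
have lowE : lower xs inp = k.-1.
  rewrite /lower -count_codom -/(elements inp) -(permP (permEl (perm_sort <=%O _))).
  by rewrite count_lt_nth ?size_sort ?sn // sort_lt_sorted.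
have n0 : (0 < n)%N by case/andP: kn => h h'; apply: leq_trans h h'.
pose B := (n + p)%N; have B3 : (3 <= B)%N by rewrite -[3%N]/(1 + 2)%N leq_add.
(* The exponent 9 is 7 + 2: intermediate results stay below [1000 * B^2], and [B >= 3] gives
   [1000 <= 3^7 <= B^7]. *)
have B7 : (1000 <= B ^ 7)%N by apply: leq_trans (_ : 3 ^ 7 <= _)%N; rewrite ?leq_exp2r.
have pB : (p <= B)%N := leq_addl _ _.
have nB : (n <= B)%N := leq_addr _ _.
have BBM : (1000 * B * B <= M)%N.
  by rewrite -mulnA -(expnD B 1 1) /M (expnD B 7 2) leq_mul2r B7 orbT.
have BM : (1000 * B <= M)%N by apply: leq_trans BBM; rewrite leq_pmulr // (leq_trans _ B3).
pose c0' := initial R select inp k.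
pose fin (sg : mem T p) := forall (i : 'I_p) j x, onth (inp i) j = Some x ->
  sg i 2%N j = Int (among_smallest k (elements inp) x).
have ist : input_state xs inp k n (memories c0').
  split=> //; first by move=> i; rewrite /memories /= sn.
  by move=> i j ji; rewrite /memories /= (nth_map xs).
set X := (_ + _) * _; set r1 := n%:R / p%:R in X *.
set r2 := Num.min _ _ in X *; set r3 := ln n%:R in X *.
have r10 : 0 <= r1 by rewrite divr_ge0.
have r30 : 0 <= r3 by apply: ln_nat_ge0.
have r20 : 0 <= r2.
  by rewrite le_min r10 mulr_ge0 ?sqrtr_ge0 // divr_ge0 ?ln_nat_ge0.
have Cw0 : 0 <= Cw := work_const_ge0 c0 W0.
have Ca0 : 0 <= Ca := startup_const_ge0 c k0 W0.
have Cb0 : 0 <= Cb := volume_const_ge0 c0.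
have leX : Cw * r1 + Ca * (alpha * r3) + Cb * (beta * r2) <= X.
  have ar : 0 <= alpha * r3 by rewrite mulr_ge0 // ltW.
  have br : 0 <= beta * r2 by rewrite mulr_ge0.
  rewrite /X !mulrDr !mulrDl.
  have := mulr_ge0 Cw0 br; have := mulr_ge0 Cw0 ar; have := mulr_ge0 Ca0 r10.
  have := mulr_ge0 Ca0 br; have := mulr_ge0 Cb0 r10; have := mulr_ge0 Cb0 ar.
  by lra.
have m0c : (m0 inp n)%:R <= c * r1.
  rewrite /m0; case: ifP => _.
    have [|i ->] := @bigop.eq_bigmax _ (fun i => size (inp i)); last exact: szc.
    by rewrite card_ord.
  have [_ [i xi]] := gi; apply: le_trans (szc i).
  by rewrite ler_nat; case: (inp i) xi.
have uW : bounds_work W by exact: lexx.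
have K0 : 0 <= logcost p alpha beta W := logcost_ge0 p (ltW a0) be0 uW.
have cost U : 4 / 3 <= U -> ln (p%:R : R) <= 80 * ln U ->
    select_cost alpha beta W inp n + potential (m0 inp n) (latency_cost alpha beta W inp n)
      (21 * W) U n <= X.
  move=> U43 lU; have m00 : (0 < m0 inp n)%N by apply: m0_gt0 totE gi.
  have m01 : 1 <= (m0 inp n)%:R :> R by rewrite ler1n.
  apply: le_trans leX; rewrite /select_cost /setup_cost; have [n2|n1] := leqP 2 n; last first.
    have m1 : m0 inp n = 1%N by rewrite /m0 leqNgt n1.
    have n1' : (n <= 1)%N by [].
    (* For [n = 1] only local work remains, and [n / p] pays for it because the PE with the element
       has [1 <= c * r1]. *)
    rewrite /potential n1' mul0rn !addr0 m1 mul1r.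
    have h1 : 27 * W <= Cw * r1 by apply: work_const_ge => //; rewrite -m1.
    have h2 : 0 <= Ca * (alpha * r3) by rewrite mulr_ge0 // mulr_ge0 // ltW.
    have h3 : 0 <= Cb * (beta * r2) by rewrite mulr_ge0 // mulr_ge0.
    by lra.
  have KE : 0 <= logcost p alpha beta W <= 6 * ((10 * W + 5) * kappa + 1) * (alpha * ln p%:R).
    by rewrite K0 logcost_le // ltW.
  have nm : (n <= p * m0 inp n)%N.
    rewrite -{1}totE -[X in (_ <= X * _)%N]card_ord -sum_nat_const.
    by apply: leq_sum => i _; apply: size_m0 totE _.
  have := total_cost c0 k0 be0 bka ka W0 p1 n2 m00 m0c nm U43 lU KE.
  have -> : logcost p alpha beta W *+ 5 *+ 2 = 10 * logcost p alpha beta W.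
    by rewrite -mulrnA mulr_natl.
  rewrite /latency_cost; have -> : logcost p alpha beta W *+ 34 = 34 * logcost p alpha beta W.
    by rewrite mulr_natl.
  by [].
have P2 : 2 <= p%:R :> R by rewrite (ler_nat _ 2).
have sX : select_cost alpha beta W inp n <= X.
  have [G43 lG] := ln_double P2.
  apply: le_trans (cost _ G43 lG); rewrite lerDl; apply: potential_ge0 => //.
  - rewrite /latency_cost addr_ge0 //; first by rewrite mulrn_wge0.
    by rewrite mulr_ge0 // mulr_ge0 // le_min ler0n sqrtr_ge0.
  - by rewrite mulr_ge0.
have UX U : valid_size p U -> ((1 < n)%N -> p < 10 * (128 * U) ^ 4)%N ->
    select_cost alpha beta W inp n + potential (m0 inp n) (latency_cost alpha beta W inp n)
      (21 * W) (growth R U) n <= X.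
  move=> hU pU; have [n1|n2] := leqP n 1; first by rewrite /potential n1 addr0.
  apply: (cost (growth R U) (growth_ge R hU)).
  apply: ln_growth => //; move: (pU n2); clear.
  by rewrite -(ltr_nat R) natrM natrX natrM.
have [_ wpX] := wp_select p0 (ltW a0) be0 fin uW pB BM BBM kn totE nB gi lowE ist p1 sX UX.
have bd s : bounded M alpha beta fin s 0 c0' (0 + X).
  apply: (wpX [::] s _ 0%N 0 c0') => [s' sg' x' _ x'0 h|]; last first.
    by move=> i; split; rewrite //= ?cats0 ?lexx.
  apply: safe_nil => // i j x ijx; have ji : (j < size (inp i))%N.
    by rewrite ltnNge; apply/negP => /onth_default; rewrite ijx.
  rewrite h //; congr Int; rewrite /among_smallest; rewrite (onth_nth xs _ _ _ ijx).
  rewrite -/(below (elements inp) x) -[k in RHS]prednK; last by case/andP: kn.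
  have rE : below (elements inp) xs = k.-1 by rewrite -lowE /lower -count_codom.
  (* Fewer than [k] elements lie below [x] exactly if [x <= xs], as [k - 1] lie below [xs]. *)
  rewrite ltnS -rE; case: leP => xx; first by rewrite below_mono.
  by rewrite leqNgt below_lt //; apply: xs_all gi.
split; first split.
- exact: bounded_halts bd.
- by move=> w hw; apply: bounded_final (leqnn (size w)) (bd _) hw.
- apply: ge_ereal_sup => _ [s _ <-].
  by rewrite lee_fin; have := bounded_expect (bd s); rewrite add0r.
Qed.
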